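(* Let $0<\alpha<\alpha_{crit}^*(3)$. Then the mean curvature flow evolution of any smoothing $M_\alpha$ of the double cone $D_\alpha\subset\mathbb{R}^3$ with angle $\alpha$ must pinch in finite time.
   Context: The ambient space is $\mathbb{R}^3$. For $0<\alpha<\frac{\pi}{2}$ let $D_\alpha = \{x\in\mathbb{R}^3 : x_2^2+x_3^2 = \tan^2\alpha\cdot x_1^2\}$ (double cone). For a function $u:\mathbb{R}\to(0,\infty)$ let $M(u) = \{(x_1,\hat{x})\in\mathbb{R}\times\mathbb{R}^2 : |\hat{x}| = u(x_1)\}$; $u$ is called the generating function of $M(u)$. Smoothing of the double cone: $M_\alpha = M(u_\alpha)$ is a smoothing of $D_\alpha$ with angle $\alpha$ if, with $\gamma = \tan\alpha$ and for some $a<0<b$, $u_\alpha(y) = \gamma|y|$ for $y\leq a$ or $y\geq b$, and $u_\alpha(y)=s(y)$ for $a\leq y\leq b$, where $s>0$ and $u_\alpha\in C^{2,\beta}(\mathbb{R})$ for some $\beta>0$. Evolution: the mean curvature flow evolution of $M_\alpha$ is $M_t=M(u(\cdot,t))$, where $u(\cdot,0)=u_\alpha$ and $\frac{\partial u}{\partial t} = \frac{u_{yy}}{1+u_y^2}-\frac{1}{u}$, on a maximal time interval $[0,T)$, $0<T\leq\infty$. It is unique, and it exists for all $t>0$ if $T=\infty$; if $T<\infty$ then it pinches in finite time, i.e. $\inf_{\mathbb{R}}u(\cdot,t)\to 0$ as $t\to T$. Definition of $\alpha_{crit}^*(3)$: let $\sigma_\alpha=\{r(\cos\alpha,\sin\alpha):r\geq0\}\subset\mathbb{R}^2$,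 with coordinates $(y,u)$ on $\mathbb{R}^2$. For a smooth curve $\gamma\subset\{u>0\}$ parametrized by arclength with tangent $(\cos\theta,\sin\theta)$ and curvature $k=\mathbf{k}\cdot(-\sin\theta,\cos\theta)$ ($\mathbf{k}$ the curvature vector), consider the equation $$k-\frac{1}{u}\cos\theta+\frac{y}{2}\sin\theta-\frac{u}{2}\cos\theta=0 \quad\text{for }(y,u)\in\gamma, \qquad ( * )$$ which expresses that the surface of rotation of $\gamma$ about the $x_1$-axis in $\mathbb{R}^3$ is the time-one slice of a self-expanding mean curvature flow ($M_t=\sqrt{t}M_1$, $t>0$). Then $\alpha_{crit}^*(3)$ is the infimum of all $\alpha\in\left(0,\frac{\pi}{2}\right)$ for which there exists a smooth, connected (complete) curve $\gamma\subset\{u>0\}$ solving $( * )$ and asymptotic to $\sigma_\alpha\cup\sigma_{\pi-\alpha}$, i.e. $\sqrt{t}\,\gamma\to\sigma_\alpha\cup\sigma_{\pi-\alpha}$ locally in Hausdorff distance as $t\to0$. *)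

(* Defs.v *)
From Stdlib Require Import Reals Lra.
From Coquelicot Require Import Coquelicot.
Open Scope R_scope.

(* [M(u)], the surface with generating function [u]. *)
Definition rev_surface (u : R -> R) (x : R * R * R) : Prop :=
  let '(x1, x2, x3) := x in sqrt (x2 ^ 2 + x3 ^ 2) = u x1.

(* [C^{2,beta}(R)], without any bound on [f] or [f'] (a profile that is conical
   at infinity is unbounded). The points [x = y] are excluded because
   [Rpower 0 beta] is not [0]. *)
Definition C2_holder (beta : R) (f : R -> R) : Prop :=
  (forall x, ex_derive f x) /\
  (forall x, ex_derive (Derive f) x) /\
  exists C : R, forall x y, x <> y ->
    Rabs (Derive_n f 2 x - Derive_n f 2 y) <= C * Rpower (Rabs (x - y)) beta.

(* The part [gamma * |y|] of the profile generates the double cone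
   [x2^2 + x3^2 = (tan alpha)^2 * x1^2]. *)
Definition smoothing_profile (alpha : R) (ua : R -> R) : Prop :=
  (exists a b : R, a < 0 < b /\
     (forall y, y <= a \/ b <= y -> ua y = tan alpha * Rabs y) /\
     (forall y, a <= y <= b -> 0 < ua y)) /\
  (exists beta : R, 0 < beta /\ C2_holder beta ua).

Definition is_smoothing (alpha : R) (M : R * R * R -> Prop) : Prop :=
  exists ua : R -> R, smoothing_profile alpha ua /\
    forall x, M x <-> rev_surface ua x.

(* [u y t] is the profile at time [t]; only the values for [0 <= t < T] matter. *)
Definition u_t (u : R -> R -> R) (y t : R) : R := Derive (fun tau => u y tau) t.
Definition u_y (u : R -> R -> R) (y t : R) : R := Derive (fun z => u z t) y.
Definition u_yy (u : R -> R -> R) (y t : R) : R := Derive_n (fun z => u z t) 2 y.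

Definition C21_at (u : R -> R -> R) (y t : R) : Prop :=
  ex_derive (fun tau => u y tau) t /\
  ex_derive (fun z => u z t) y /\
  ex_derive (fun z => u_y u z t) y /\
  continuous (fun p : R * R => u_t u (fst p) (snd p)) (y, t) /\
  continuous (fun p : R * R => u_y u (fst p) (snd p)) (y, t) /\
  continuous (fun p : R * R => u_yy u (fst p) (snd p)) (y, t).

(* Classical solution on [R x [0, T)] starting from the surface [M]:
   continuous up to [t = 0], and [C^{2,1}] for [0 < t < T]. *)
Definition mcf_solution (M : R * R * R -> Prop) (T : Rbar) (u : R -> R -> R)
  : Prop :=
  (forall y t, 0 <= t -> Rbar_lt t T -> 0 < u y t) /\
  (forall y t, 0 <= t -> Rbar_lt t T ->
     filterlim (fun p : R * R => u (fst p) (snd p))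
       (within (fun p : R * R => 0 <= snd p) (locally (y, t)))
       (locally (u y t))) /\
  (forall x, M x <-> rev_surface (fun y => u y 0) x) /\
  (forall y t, 0 < t -> Rbar_lt t T ->
     C21_at u y t /\
     u_t u y t = u_yy u y t / (1 + u_y u y t ^ 2) - 1 / u y t).

Definition mcf_evolution (M : R * R * R -> Prop) (T : Rbar) (u : R -> R -> R)
  : Prop :=
  Rbar_lt 0 T /\
  mcf_solution M T u /\
  ~ (exists (T' : Rbar) (v : R -> R -> R),
       Rbar_lt T T' /\ mcf_solution M T' v /\
       forall y t, 0 <= t -> Rbar_lt t T -> v y t = u y t).

(* [inf_R u(., t)]; the infimum is finite, hence [real] loses nothing, for a
   profile that is bounded below. *)
Definition inf_profile (u : R -> R -> R) (t : R) : R :=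
  real (Glb_Rbar (fun z => exists y, z = u y t)).

Definition pinches_in_finite_time (T : Rbar) (u : R -> R -> R) : Prop :=
  exists T0 : R, T = Finite T0 /\
    filterlim (inf_profile u) (at_left T0) (locally 0).

Definition smooth (f : R -> R) : Prop := forall n x, ex_derive_n f n x.

(* [(y, u)] is a curve in [{u > 0}] parametrized by arclength on all of R
   (hence connected and complete), with tangent [(cos theta, sin theta)].
   Closed curves are included, as periodic parametrizations. *)
Definition arclength_curve (y u theta : R -> R) : Prop :=
  smooth y /\ smooth u /\
  forall s, 0 < u s /\ is_derive y s (cos (theta s)) /\
            is_derive u s (sin (theta s)).

(* The curvature vector is the second derivative [(y'', u'')]. *)
Definition curvature (y u theta : R -> R) (s : R) : R :=
  Derive_n y 2 s * - sin (theta s) + Derive_n u 2 s * cos (theta s).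

Definition expander_equation (y u theta : R -> R) (s : R) : Prop :=
  curvature y u theta s - 1 / u s * cos (theta s)
    + y s / 2 * sin (theta s) - u s / 2 * cos (theta s) = 0.

Definition expander_curve (G : R * R -> Prop) : Prop :=
  exists y u theta : R -> R,
    arclength_curve y u theta /\
    (forall s, expander_equation y u theta s) /\
    (forall p, G p <-> exists s, p = (y s, u s)).

Definition ray (alpha : R) (p : R * R) : Prop :=
  exists r : R, 0 <= r /\ p = (r * cos alpha, r * sin alpha).

Definition dilate (c : R) (A : R * R -> Prop) (p : R * R) : Prop :=
  exists q, A q /\ p = (c * fst q, c * snd q).

Definition dist2 (p q : R * R) : R :=
  dist_euc (fst p) (snd p) (fst q) (snd q).

(* [A] lies in the [eps]-neighbourhood of [B] inside the ball of radius [rho]. *)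
Definition near_in_ball (rho eps : R) (A B : R * R -> Prop) : Prop :=
  forall p, A p -> dist2 p (0, 0) <= rho -> exists q, B q /\ dist2 p q < eps.

(* Convergence in Hausdorff distance on every ball. The neighbouring point [q]
   is not itself required to lie in the ball, as usual for local convergence;
   otherwise points leaving through the boundary would spoil it. *)
Definition local_hausdorff_cvg (F : (R -> Prop) -> Prop)
    (A : R -> R * R -> Prop) (B : R * R -> Prop) : Prop :=
  forall rho eps : R, 0 < rho -> 0 < eps ->
    F (fun t => near_in_ball rho eps (A t) B /\ near_in_ball rho eps B (A t)).

Definition asymptotic_to (G C : R * R -> Prop) : Prop :=
  local_hausdorff_cvg (at_right 0) (fun t => dilate (sqrt t) G) C.

Definition expander_angle (alpha : R) : Prop :=
  0 < alpha < PI / 2 /\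
  exists G : R * R -> Prop,
    expander_curve G /\
    asymptotic_to G (fun p => ray alpha p \/ ray (PI - alpha) p).

Definition alpha_crit_star3 : Rbar := Glb_Rbar expander_angle.

(* Main.v *)
(** Suppose first that the maximal time [T] is finite but that the infimum of the profile does not
    tend to [0]. Spherical barriers centred on the axis then keep [u >= c > 0] up to time [T], so [u]
    solves the equation with the reaction term [1 / u] replaced by the Lipschitz function
    [1 / max (u, c)]. That equation has a solution beyond time [T]: an explicit monotone difference
    scheme is Lipschitz in space and time uniformly in the mesh, a coupling (doubling of variables)
    argument makes its time derivative Lipschitz in space, and its limit is classical. A comparison
    principle that needs no growth condition, because [arctan u_y] is bounded and logarithmic
    barriers localise it, identifies this solution with [u], which contradicts maximality.

    If [T] is infinite, [u] is a lower barrier for the solution [V] with initial profile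
    [sqrt (C + gamma^2 y^2)], [gamma = tan alpha], which is therefore global. Scaling shows that
    [V (x sqrt t, t) / sqrt t] decreases in [t]; let [w (x)] be its limit. A neck with
    [w (x) < x / 2] would be pinched off by a shrinking hyperboloid, hence [w > 0] away from [0], and
    [w] satisfies the expander equation there. The equation excludes [w (0+) = 0], so [w] is the
    profile of a smooth expander, asymptotic to the cone because
    [gamma^2 x^2 - 4 <= w^2 <= gamma^2 x^2 + 2 gamma^2]. Thus [alpha] would be an expander angle, so
    [alpha_crit_star3 <= alpha]. *)

Require Import Defs.
From Stdlib Require Import Reals Lra Lia Psatz Classical ClassicalEpsilon.
From mathcomp.classical Require filter.
From Coquelicot Require Import Coquelicot.
Open Scope R_scope.

(** * Limits along an ultrafilter *)

(** The equation is used in the form [u_t = (atan u_y)_y - 1 / u]. Its flux is bounded, and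
    differentiating it in time gives a linear equation in divergence form for [u_t], so that a
    Lipschitz estimate for [u_t] takes the place of Schauder theory. Comparison asks for bounded
    derivatives of only one of the two functions. Solutions of the cut-off equation have them and
    can therefore be compared with an arbitrary classical solution. The eternal solution [u] is
    replaced by [V] because a general smoothing has no symmetry and no scaling monotonicity. The
    hyperboloid is even, increases with [|y|] and lies below its dilations by factors [lam >= 1];
    comparison hands all three properties on to [V]. The constant 4 is the rate at which the squared
    radius of a sphere in [R^3] shrinks, and [2 gamma^2] comes from the supersolution
    [sqrt (C + gamma^2 y^2 + 2 gamma^2 t)]. No bound on second derivatives is at hand when [t] tends
    to infinity, so the limit is taken in the integrated form [(atan w' + x w / 2)' = 1 / w + w],
    where the time derivative enters only through its integral. *)

Lemma free_ultrafilter : exists G : (nat -> Prop) -> Prop,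
  ProperFilter G /\ (forall P, G P \/ G (fun n => ~ P n)) /\
  (forall N, G (fun n => (N <= n)%nat)).
Proof.
  assert (HF : filter.ProperFilter
    (fun P : nat -> Prop => exists N, forall n, (N <= n)%nat -> P n)).
  { constructor.
    - intros [N HN]. exact (HN N (le_n N)).
    - constructor.
      + exists 0%nat. intros n _. exact I.
      + intros A B [N HN] [N' HN']. exists (Nat.max N N').
        intros n Hn. split; [apply HN | apply HN']; lia.
      + intros P Q HPQ [N HN]. exists N. intros n Hn. apply HPQ, HN, Hn. }
  destruct (filter.ultraFilterLemma HF) as [G [HG Hsub]].
  exists G. pose proof (@filter.ultra_proper _ _ HG) as [H0 [H1 H2 H3]].
  repeat split.
  - intros P HP. apply NNPP. intros Hn. apply H0.
    revert HP. apply H3. intros n HPn. apply Hn. exists n. exact HPn.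
  - exact H1.
  - intros P Q HP HQ. exact (H2 P Q HP HQ).
  - intros P Q HPQ. exact (H3 P Q HPQ).
  - intros P. exact (filter.in_ultra_setVsetC P HG).
  - intros N. apply Hsub. exists N. intros n Hn. exact Hn.
Qed.

(* Ultralimits replace the extraction of convergent subsequences. *)
Definition ultra : (nat -> Prop) -> Prop :=
  proj1_sig (constructive_indefinite_description _ free_ultrafilter).

#[global] Instance ultra_proper : ProperFilter ultra.
Proof. exact (proj1 (proj2_sig (constructive_indefinite_description _ free_ultrafilter))). Qed.

Lemma ultra_em (P : nat -> Prop) : ultra P \/ ultra (fun n => ~ P n).
Proof.
  exact (proj1 (proj2 (proj2_sig (constructive_indefinite_description _ free_ultrafilter))) P).
Qed.

Lemma ultra_ge (N : nat) : ultra (fun n => (N <= n)%nat).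
Proof.
  exact (proj2 (proj2 (proj2_sig (constructive_indefinite_description _ free_ultrafilter))) N).
Qed.

Lemma ultra_all (P : nat -> Prop) : (forall n, P n) -> ultra P.
Proof. intros H. now apply filter_forall. Qed.

Lemma ultra_and (P Q : nat -> Prop) : ultra P -> ultra Q -> ultra (fun n => P n /\ Q n).
Proof. apply filter_and. Qed.

Lemma ultra_imp (P Q : nat -> Prop) : (forall n, P n -> Q n) -> ultra P -> ultra Q.
Proof. apply filter_imp. Qed.

Definition ucv (x : nat -> R) (l : R) : Prop :=
  forall eps, 0 < eps -> ultra (fun n => Rabs (x n - l) < eps).

Definition ulim (x : nat -> R) : R := epsilon (inhabits 0) (ucv x).

(** The supremum of the [r] that lie below [x n] for a large set of [n] is the limit: of each set
    and its complement one is large, which decides both inequalities. *)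
Lemma ulim_cv (x : nat -> R) (M : R) : ultra (fun n => Rabs (x n) <= M) -> ucv x (ulim x).
Proof.
  intros HM. unfold ulim. apply epsilon_spec.
  destruct (completeness (fun r => ultra (fun n => r <= x n))) as [l [Hub Hl]].
  - exists (M + 1). intros r Hr.
    destruct (Rle_lt_dec r (M + 1)) as [H | H]; [exact H | exfalso].
    destruct (filter_ex _ (ultra_and _ _ HM Hr)) as [n [H1 H2]].
    apply Rabs_le_between in H1. lra.
  - exists (- M). revert HM. apply ultra_imp. intros n Hn. apply Rabs_le_between in Hn. lra.
  - exists l. intros eps Heps.
    assert (H1 : ultra (fun n => l - eps < x n)).
    { destruct (ultra_em (fun n => l - eps < x n)) as [H | H]; [exact H | exfalso].
      assert (l <= l - eps); [| lra].
      apply Hl. intros r Hr. destruct (Rle_lt_dec r (l - eps)) as [? | Hlt]; [easy | exfalso].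
      destruct (filter_ex _ (ultra_and _ _ H Hr)) as [n [Ha Hb]]. lra. }
    assert (H2 : ultra (fun n => x n < l + eps / 2)).
    { destruct (ultra_em (fun n => x n < l + eps / 2)) as [H | H]; [exact H | exfalso].
      assert (l + eps / 2 <= l); [| lra].
      apply Hub. revert H. apply ultra_imp. intros n Hn. lra. }
    generalize (ultra_and _ _ H1 H2). apply ultra_imp. intros n [Ha Hb].
    apply Rabs_def1; lra.
Qed.

Lemma ucv_const (c : R) : ucv (fun _ => c) c.
Proof. intros e He. apply ultra_all. intros n. rewrite Rminus_diag, Rabs_R0. exact He. Qed.

Lemma ucv_ext (x y : nat -> R) (l : R) : (forall n, x n = y n) -> ucv x l -> ucv y l.
Proof.
  intros H Hx e He. generalize (Hx e He). apply ultra_imp. intros n. now rewrite H.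
Qed.

Lemma ucv_cont (f : R -> R) (x : nat -> R) (l : R) :
  continuous f l -> ucv x l -> ucv (fun n => f (x n)) (f l).
Proof.
  intros Hf Hx e He.
  destruct (Hf (ball (f l) e)) as [d Hd]; [now exists (mkposreal e He) |].
  generalize (Hx d (cond_pos d)). apply ultra_imp. intros n Hn. apply Hd. exact Hn.
Qed.

Lemma ucv_plus (x y : nat -> R) (a b : R) :
  ucv x a -> ucv y b -> ucv (fun n => x n + y n) (a + b).
Proof.
  intros Hx Hy e He.
  generalize (ultra_and _ _ (Hx (e / 2) ltac:(lra)) (Hy (e / 2) ltac:(lra))).
  apply ultra_imp. intros n [H1 H2].
  apply Rabs_def2 in H1. apply Rabs_def2 in H2. apply Rabs_def1; lra.
Qed.

Lemma ucv_scal (c : R) (x : nat -> R) (a : R) : ucv x a -> ucv (fun n => c * x n) (c * a).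
Proof.
  intros Hx. apply (ucv_cont (fun z => c * z)); [| exact Hx].
  apply (ex_derive_continuous (fun z => c * z)). auto_derive. exact I.
Qed.

Lemma ucv_minus (x y : nat -> R) (a b : R) :
  ucv x a -> ucv y b -> ucv (fun n => x n - y n) (a - b).
Proof.
  intros Hx Hy. replace (a - b) with (a + -1 * b) by ring.
  apply ucv_ext with (fun n => x n + -1 * y n); [intros; ring |].
  apply ucv_plus; [exact Hx | now apply ucv_scal].
Qed.

Lemma ucv_mult (x y : nat -> R) (a b : R) :
  ucv x a -> ucv y b -> ucv (fun n => x n * y n) (a * b).
Proof.
  (* Polarisation reduces products to squares, and these are covered by [ucv_cont]. *)
  intros Hx Hy. replace (a * b) with (/ 4 * ((a + b) * (a + b)) - / 4 * ((a - b) * (a - b))) by field.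
  apply ucv_ext with (fun n => / 4 * ((x n + y n) * (x n + y n)) - / 4 * ((x n - y n) * (x n - y n)));
    [intros; field |].
  assert (Hsq : forall z c, ucv z c -> ucv (fun n => z n * z n) (c * c)).
  { intros z c. apply (ucv_cont (fun r => r * r)).
    apply (ex_derive_continuous (fun r => r * r)). auto_derive. exact I. }
  apply ucv_minus; apply ucv_scal, Hsq; [now apply ucv_plus | now apply ucv_minus].
Qed.

Lemma ucv_abs (x : nat -> R) (a : R) : ucv x a -> ucv (fun n => Rabs (x n)) (Rabs a).
Proof. apply ucv_cont. apply continuous_Rabs. Qed.

Lemma ucv_le (x y : nat -> R) (a b : R) :
  ucv x a -> ucv y b -> ultra (fun n => x n <= y n) -> a <= b.
Proof.
  intros Hx Hy H. apply Rnot_lt_le. intros Hab.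
  destruct (filter_ex _ (ultra_and _ _ H
    (ultra_and _ _ (Hx ((a - b) / 2) ltac:(lra)) (Hy ((a - b) / 2) ltac:(lra)))))
    as [n [H1 [H2 H3]]].
  apply Rabs_def2 in H2. apply Rabs_def2 in H3. lra.
Qed.

Lemma ucv_unique (x : nat -> R) (a b : R) : ucv x a -> ucv x b -> a = b.
Proof.
  intros H1 H2. apply Rle_antisym; (apply (ucv_le x x); auto; apply ultra_all; intros; lra).
Qed.

Lemma ucv_squeeze (x y : nat -> R) (a : R) :
  ultra (fun n => Rabs (x n - a) <= y n) -> ucv y 0 -> ucv x a.
Proof.
  intros H Hy e He. generalize (ultra_and _ _ H (Hy e He)). apply ultra_imp.
  intros n [H1 H2]. rewrite Rminus_0_r in H2. apply Rabs_def2 in H2. lra.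
Qed.

Lemma ucv_inv_succ : ucv (fun k => / INR (S k)) 0.
Proof.
  intros e He. destruct (archimed_cor1 e He) as [N [HN HN0]].
  generalize (ultra_ge N). apply ultra_imp. intros n Hn.
  rewrite Rminus_0_r, Rabs_pos_eq.
  - apply Rle_lt_trans with (2 := HN). apply Rinv_le_contravar.
    + now apply lt_0_INR.
    + apply le_INR. lia.
  - left. apply Rinv_0_lt_compat, lt_0_INR. lia.
Qed.

(** * Maximum principle on rectangles *)

(** Continuity relative to the closed rectangle, because solutions are controlled only for [0 <= t]
    and barriers only inside an interval. *)
Definition cont_rect (phi : R -> R -> R) (a b t0 t1 : R) : Prop :=
  forall y t, a <= y <= b -> t0 <= t <= t1 -> forall eps, 0 < eps ->
  exists d, 0 < d /\ forall z s, a <= z <= b -> t0 <= s <= t1 ->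
    Rabs (z - y) < d -> Rabs (s - t) < d -> Rabs (phi z s - phi y t) < eps.

Lemma ucv_in_segment (x : nat -> R) (a b : R) :
  (forall n, a <= x n <= b) -> ucv x (ulim x) /\ a <= ulim x <= b.
Proof.
  intros H.
  assert (Hx : ucv x (ulim x)).
  { apply ulim_cv with (Rmax (Rabs a) (Rabs b)). apply ultra_all. intros n.
    apply Rabs_le_between. split; destruct (H n);
    [pose proof (Rmax_l (Rabs a) (Rabs b)); pose proof (Rle_abs (- a));
     rewrite Rabs_Ropp in *; lra |
     pose proof (Rmax_r (Rabs a) (Rabs b)); pose proof (Rle_abs b); lra]. }
  repeat split; [exact Hx | |].
  - apply (ucv_le (fun _ => a) x); [apply ucv_const | exact Hx |]. apply ultra_all. intros n. apply H.
  - apply (ucv_le x (fun _ => b)); [exact Hx | apply ucv_const |]. apply ultra_all. intros n. apply H.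
Qed.

(** Ultralimits give every sequence of points a limit in the rectangle along which [phi] converges.
    This is applied to a sequence on which [phi] would be unbounded, then to a maximising one. *)
Lemma rect_max (phi : R -> R -> R) (a b t0 t1 : R) :
  a <= b -> t0 <= t1 -> cont_rect phi a b t0 t1 ->
  exists y t, a <= y <= b /\ t0 <= t <= t1 /\
    forall z s, a <= z <= b -> t0 <= s <= t1 -> phi z s <= phi y t.
Proof.
  intros Hab Ht Hc.
  assert (Hseq : forall p : nat -> R * R,
    (forall n, a <= fst (p n) <= b /\ t0 <= snd (p n) <= t1) ->
    exists y t, a <= y <= b /\ t0 <= t <= t1 /\
      ucv (fun n => phi (fst (p n)) (snd (p n))) (phi y t)).
  { intros p Hp.
    destruct (ucv_in_segment (fun n => fst (p n)) a b (fun n => proj1 (Hp n))) as [H1 H2].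
    destruct (ucv_in_segment (fun n => snd (p n)) t0 t1 (fun n => proj2 (Hp n))) as [H3 H4].
    eexists; eexists; split; [exact H2 | split; [exact H4 |]].
    intros e He. destruct (Hc _ _ H2 H4 e He) as [d [Hd Hd']].
    generalize (ultra_and _ _ (H1 d Hd) (H3 d Hd)). apply ultra_imp.
    intros n [Ha Hb]. apply Hd'; auto; apply Hp. }
  set (E := fun r => exists z s, a <= z <= b /\ t0 <= s <= t1 /\ r = phi z s).
  assert (HB : bound E).
  { apply NNPP. intros Hn.
    assert (Hp : forall n : nat, exists p : R * R,
      (a <= fst p <= b /\ t0 <= snd p <= t1) /\ INR n < phi (fst p) (snd p)).
    { intros n. apply NNPP. intros Hn2. apply Hn. exists (INR n). intros r [z [s [Hz [Hs ->]]]].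
      apply Rnot_lt_le. intros Hlt. apply Hn2. exists (z, s). simpl. auto. }
    set (p := fun n => proj1_sig (constructive_indefinite_description _ (Hp n))).
    assert (Hps : forall n, (a <= fst (p n) <= b /\ t0 <= snd (p n) <= t1) /\
      INR n < phi (fst (p n)) (snd (p n))).
    { intros n. exact (proj2_sig (constructive_indefinite_description _ (Hp n))). }
    destruct (Hseq p (fun n => proj1 (Hps n))) as [y [t [Hy [Ht' Hcv]]]].
    destruct (nfloor_ex (Rmax 0 (phi y t + 1))) as [N [_ HN]]; [apply Rmax_l |].
    pose proof (Rmax_r 0 (phi y t + 1)).
    destruct (filter_ex _ (ultra_and _ _ (ultra_ge (S N)) (Hcv 1 Rlt_0_1))) as [n [H1 H2]].
    apply Rabs_def2 in H2. destruct (Hps n) as [_ H3].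
    apply le_INR in H1. rewrite S_INR in H1. lra. }
  destruct (completeness E HB) as [l [Hub Hl]].
  { exists (phi a t0). exists a, t0. repeat split; lra. }
  assert (Hp : forall n : nat, exists p : R * R,
      (a <= fst p <= b /\ t0 <= snd p <= t1) /\ l - / INR (S n) <= phi (fst p) (snd p)).
  { intros n. apply NNPP. intros Hn2.
    assert (0 < / INR (S n)) by (apply Rinv_0_lt_compat, lt_0_INR; lia).
    assert (l <= l - / INR (S n)); [| lra].
    apply Hl. intros r [z [s [Hz [Hs ->]]]].
    apply Rnot_lt_le. intros Hlt. apply Hn2. exists (z, s). cbn [fst snd]. split; auto. lra. }
  set (p := fun n => proj1_sig (constructive_indefinite_description _ (Hp n))).
  assert (Hps : forall n, (a <= fst (p n) <= b /\ t0 <= snd (p n) <= t1) /\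
    l - / INR (S n) <= phi (fst (p n)) (snd (p n))).
  { intros n. exact (proj2_sig (constructive_indefinite_description _ (Hp n))). }
  destruct (Hseq p (fun n => proj1 (Hps n))) as [y [t [Hy [Ht' Hcv]]]].
  exists y, t. split; [exact Hy | split; [exact Ht' |]]. intros z s Hz Hs.
  apply Rle_trans with l; [apply Hub; exists z, s; auto |].
  replace l with (l - 0) by ring.
  apply (ucv_le (fun n => l - / INR (S n)) (fun n => phi (fst (p n)) (snd (p n)))); auto.
  - apply ucv_minus; [apply ucv_const | apply ucv_inv_succ].
  - apply ultra_all. intros n. apply Hps.
Qed.

(* [d] is the time derivative, [p] and [q] the first two space derivatives. *)
Definition jet (u : R -> R -> R) (y t d p q : R) : Prop :=
  is_derive (fun s => u y s) t d /\
  (exists r : posreal, forall z, Rabs (z - y) < r -> ex_derive (fun x => u x t) z) /\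
  Derive (fun x => u x t) y = p /\
  is_derive (fun z => Derive (fun x => u x t) z) y q.

(** If [q] were positive, [f'] would be positive just to the right of [y], and the mean value
    theorem would push [f] above its maximum. *)
Lemma max_second_derive (f : R -> R) (y q r : R) :
  0 < r -> (forall z, Rabs (z - y) < r -> ex_derive f z) ->
  (forall z, Rabs (z - y) < r -> f z <= f y) -> is_derive (Derive f) y q ->
  Derive f y = 0 /\ q <= 0.
Proof.
  intros Hr He Hm Hq.
  assert (H0 : Derive f y = 0).
  { assert (Hy : ex_derive f y) by (apply He; rewrite Rminus_diag, Rabs_R0; lra).
    apply Derive_correct in Hy. apply is_derive_Reals in Hy.
    apply (uniqueness_limite f y); auto.
    set (pr := exist _ _ Hy : derivable_pt f y).
    assert (Hz : derive_pt f y pr = 0).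
    { apply (deriv_maximum f (y - r / 2) (y + r / 2) y pr); try lra.
      intros x H1 H2. apply Hm. apply Rabs_def1; lra. }
    rewrite <- Hz at 1. unfold derive_pt, pr. simpl. exact Hy. }
  split; [exact H0 |].
  apply Rnot_lt_le. intros Hpos.
  apply is_derive_Reals in Hq. destruct (Hq (q / 2)) as [d Hd]; [lra |].
  pose proof (cond_pos d) as Hd0.
  set (m := Rmin (d / 2) (r / 2)).
  assert (Hm0 : 0 < m) by (unfold m; apply Rmin_glb_lt; lra).
  assert (Hmd : m < d) by (unfold m; pose proof (Rmin_l (d / 2) (r / 2)); lra).
  assert (Hmr : m < r) by (unfold m; pose proof (Rmin_r (d / 2) (r / 2)); lra).
  destruct (MVT_cor2 f (Derive f) y (y + m)) as [c [Hc1 Hc2]]; [lra | |].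
  - intros c Hc. apply is_derive_Reals, Derive_correct, He, Rabs_def1; lra.
  - assert (Hfm : f (y + m) <= f y) by (apply Hm, Rabs_def1; lra).
    specialize (Hd (c - y) ltac:(lra) ltac:(apply Rabs_def1; lra)).
    replace (y + (c - y)) with c in Hd by ring. rewrite H0, Rminus_0_r in Hd.
    apply Rabs_def2 in Hd.
    assert (H1 : q / 2 < Derive f c / (c - y)) by lra.
    apply (Rmult_lt_compat_r (c - y)) in H1; [| lra].
    replace (Derive f c / (c - y) * (c - y)) with (Derive f c) in H1 by (field; lra).
    assert (0 < q / 2 * (c - y)) by (apply Rmult_lt_0_compat; lra).
    assert (0 < Derive f c * (y + m - y)) by (apply Rmult_lt_0_compat; lra).
    lra.
Qed.

(** Only earlier times are compared, since a maximum over a closed time interval may sit at its end.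
    The lemma also converts monotonicity into a sign of the derivative. *)
Lemma max_left_derive (f : R -> R) (t d r : R) :
  0 < r -> (forall s, t - r < s <= t -> f s <= f t) -> is_derive f t d -> 0 <= d.
Proof.
  intros Hr Hm Hd. apply Rnot_lt_le. intros Hn.
  apply is_derive_Reals in Hd. destruct (Hd (- d / 2)) as [e He]; [lra |].
  pose proof (cond_pos e) as He0.
  set (m := Rmin (e / 2) (r / 2)).
  assert (Hm0 : 0 < m) by (unfold m; apply Rmin_glb_lt; lra).
  assert (Hme : m < e) by (unfold m; pose proof (Rmin_l (e / 2) (r / 2)); lra).
  assert (Hmr : m < r) by (unfold m; pose proof (Rmin_r (e / 2) (r / 2)); lra).
  specialize (He (- m) ltac:(lra) ltac:(apply Rabs_def1; lra)).
  apply Rabs_def2 in He.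
  assert (Hf : f (t + - m) <= f t) by (apply Hm; lra).
  assert (H1 : (f (t + - m) - f t) / - m < d / 2) by lra.
  apply (Rmult_lt_compat_r m) in H1; [| lra].
  replace ((f (t + - m) - f t) / - m * m) with (f t - f (t + - m)) in H1 by (field; lra).
  assert (d / 2 * m < 0) by nra. lra.
Qed.

(** A nonnegative maximum would lie in the interior and after [t0], where [p = 0], [q <= 0] and
    [0 <= d]. Hence the strict inequality is demanded only at points with [0 <= phi]. *)
Lemma max_principle (phi : R -> R -> R) (a b t0 t1 : R) :
  cont_rect phi a b t0 t1 ->
  (forall y, a <= y <= b -> phi y t0 < 0) ->
  (forall t, t0 <= t <= t1 -> phi a t < 0 /\ phi b t < 0) ->
  (forall y t, a < y < b -> t0 < t <= t1 -> 0 <= phi y t ->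
     exists d p q, jet phi y t d p q /\ (p = 0 -> q <= 0 -> d < 0)) ->
  forall y t, a <= y <= b -> t0 <= t <= t1 -> phi y t < 0.
Proof.
  intros Hc Hinit Hlat Hint y t Hy Ht. apply Rnot_le_lt. intros Hn.
  destruct (rect_max phi a b t0 t1 ltac:(lra) ltac:(lra) Hc) as [z [s [Hz [Hs Hmax]]]].
  assert (Hp : 0 <= phi z s) by (pose proof (Hmax y t Hy Ht); lra).
  assert (Hs0 : t0 < s).
  { destruct (Rle_lt_or_eq_dec _ _ (proj1 Hs)) as [? | <-]; [easy |].
    pose proof (Hinit z Hz). lra. }
  destruct (Hlat s Hs) as [Ha Hb].
  assert (Hza : a < z) by (destruct (Rle_lt_or_eq_dec _ _ (proj1 Hz)) as [? | <-]; lra).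
  assert (Hzb : z < b) by (destruct (Rle_lt_or_eq_dec _ _ (proj2 Hz)) as [? | ->]; lra).
  destruct (Hint z s (conj Hza Hzb) (conj Hs0 (proj2 Hs)) Hp)
    as [d [p [q [[Hd [[r Hr] [Hpz Hq]]] Hcontra]]]].
  set (r' := Rmin r (Rmin (z - a) (b - z))).
  assert (Hr' : 0 < r').
  { unfold r'. repeat apply Rmin_glb_lt; try lra. apply cond_pos. }
  assert (Hr1 : r' <= r) by apply Rmin_l.
  assert (Hr2 : r' <= z - a) by (eapply Rle_trans; [apply Rmin_r | apply Rmin_l]).
  assert (Hr3 : r' <= b - z) by (eapply Rle_trans; [apply Rmin_r | apply Rmin_r]).
  destruct (max_second_derive (fun x => phi x s) z q r' Hr') as [H1 H2].
  - intros x Hx. apply Hr. lra.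
  - intros x Hx. apply Rabs_def2 in Hx. apply Hmax; lra.
  - exact Hq.
  - assert (0 <= d).
    { apply (max_left_derive (fun x => phi z x) s d (s - t0)); [lra | | exact Hd].
      intros x Hx. apply Hmax; lra. }
    specialize (Hcontra (eq_trans (eq_sym Hpz) H1) H2). lra.
Qed.

(** * An explicit difference scheme *)

(** The difference quotient of [atan], written as an average of its derivative: it makes sense on
    the diagonal and is visibly Lipschitz in both arguments. *)
Definition atan_quotient (a b : R) : R := RInt (fun s => / (1 + (b + s * (a - b)) ^ 2)) 0 1.

Lemma one_plus_sqr_pos (x : R) : 0 < 1 + x ^ 2.
Proof. pose proof (pow2_ge_0 x). lra. Qed.

Lemma atan_quotient_integrand_continuous (a b s : R) :
  continuous (fun s => / (1 + (b + s * (a - b)) ^ 2)) s.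
Proof.
  apply (ex_derive_continuous (fun s => / (1 + (b + s * (a - b)) ^ 2))). auto_derive.
  pose proof (one_plus_sqr_pos (b + s * (a - b))). simpl in *. lra.
Qed.

Lemma ex_RInt_atan_quotient (a b : R) : ex_RInt (fun s => / (1 + (b + s * (a - b)) ^ 2)) 0 1.
Proof. apply (@ex_RInt_continuous R_CompleteNormedModule). intros s _. apply atan_quotient_integrand_continuous. Qed.

Lemma is_derive_atan_comp (x : R) : is_derive atan x (/ (1 + x ^ 2)).
Proof.
  apply is_derive_Reals, derivable_pt_lim_atan.
Qed.

Lemma atan_minus (a b : R) : atan a - atan b = atan_quotient a b * (a - b).
Proof.
  assert (H : is_RInt (fun s => (a - b) * / (1 + (b + s * (a - b)) ^ 2)) 0 1
    (minus (atan (b + 1 * (a - b))) (atan (b + 0 * (a - b))))).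
  { apply (is_RInt_derive (fun s => atan (b + s * (a - b)))).
    - intros s _.
      apply (is_derive_comp atan (fun s => b + s * (a - b)) s (/ (1 + (b + s * (a - b)) ^ 2)) (a - b)).
      + apply is_derive_atan_comp.
      + auto_derive; [exact I | ring].
    - intros s _. apply (continuous_mult (fun _ => a - b)); [apply continuous_const |].
      apply atan_quotient_integrand_continuous. }
  pose proof (RInt_correct (V := R_CompleteNormedModule) _ _ _ (ex_RInt_atan_quotient a b)) as H2.
  apply (is_RInt_scal (V := R_NormedModule) _ _ _ (a - b)) in H2.
  pose proof (eq_trans (eq_sym (is_RInt_unique (V := R_CompleteNormedModule) _ _ _ _ H))
    (is_RInt_unique (V := R_CompleteNormedModule) _ _ _ _ H2)) as H3.
  unfold minus, plus, opp, scal in H3. simpl in H3. unfold mult in H3. simpl in H3.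
  replace (b + 1 * (a - b)) with a in H3 by ring.
  replace (b + 0 * (a - b)) with b in H3 by ring.
  unfold atan_quotient. simpl. lra.
Qed.

Lemma atan_quotient_le_1 (a b : R) : atan_quotient a b <= 1.
Proof.
  replace 1 with (RInt (fun _ => 1) 0 1) by (rewrite RInt_const; unfold scal; simpl; unfold mult; simpl; ring).
  apply RInt_le; [lra | apply ex_RInt_atan_quotient | apply ex_RInt_const |].
  intros s _. rewrite <- Rinv_1 at 2. apply Rinv_le_contravar; [lra |].
  pose proof (pow2_ge_0 (b + s * (a - b))). lra.
Qed.

Lemma atan_quotient_ge (a b l : R) : Rabs a <= l -> Rabs b <= l -> / (1 + l ^ 2) <= atan_quotient a b.
Proof.
  intros Ha Hb. apply Rabs_le_between in Ha. apply Rabs_le_between in Hb.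
  replace (/ (1 + l ^ 2)) with (RInt (fun _ => / (1 + l ^ 2)) 0 1)
    by (rewrite RInt_const; unfold scal; simpl; unfold mult; simpl; ring).
  apply RInt_le; [lra | apply ex_RInt_const | apply ex_RInt_atan_quotient |].
  intros s Hs. apply Rinv_le_contravar; [apply one_plus_sqr_pos |].
  assert (- l <= b + s * (a - b) <= l) by nra.
  nra.
Qed.

Lemma atan_quotient_ge_0 (a b : R) : 0 <= atan_quotient a b.
Proof.
  apply Rle_trans with (/ (1 + (Rmax (Rabs a) (Rabs b)) ^ 2)).
  - left. apply Rinv_0_lt_compat, one_plus_sqr_pos.
  - apply atan_quotient_ge; [apply Rmax_l | apply Rmax_r].
Qed.

Lemma inv_one_plus_sqr_lip (x y : R) : Rabs (/ (1 + x ^ 2) - / (1 + y ^ 2)) <= Rabs (x - y).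
Proof.
  pose proof (one_plus_sqr_pos x) as Hx. pose proof (one_plus_sqr_pos y) as Hy.
  replace (/ (1 + x ^ 2) - / (1 + y ^ 2)) with
    ((y - x) * ((x + y) / ((1 + x ^ 2) * (1 + y ^ 2)))) by (field; lra).
  rewrite Rabs_mult, (Rabs_minus_sym y x). rewrite <- (Rmult_1_r (Rabs (x - y))) at 2.
  apply Rmult_le_compat_l; [apply Rabs_pos |].
  assert (Hxy : 0 < (1 + x ^ 2) * (1 + y ^ 2)) by now apply Rmult_lt_0_compat.
  unfold Rdiv. rewrite Rabs_mult, Rabs_inv, (Rabs_pos_eq ((1 + x ^ 2) * (1 + y ^ 2))) by lra.
  apply Rmult_le_reg_r with ((1 + x ^ 2) * (1 + y ^ 2)); [exact Hxy |].
  replace (Rabs (x + y) * / ((1 + x ^ 2) * (1 + y ^ 2)) * ((1 + x ^ 2) * (1 + y ^ 2)))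
    with (Rabs (x + y)) by (field; split; lra).
  rewrite Rmult_1_l.
  assert (H : 1 + x ^ 2 + y ^ 2 <= (1 + x ^ 2) * (1 + y ^ 2))
    by (pose proof (Rmult_le_pos _ _ (pow2_ge_0 x) (pow2_ge_0 y)); nra).
  apply Rabs_le. pose proof (pow2_ge_0 (x - 1)). pose proof (pow2_ge_0 (y - 1)).
  pose proof (pow2_ge_0 (x + 1)). pose proof (pow2_ge_0 (y + 1)). split; nra.
Qed.

Lemma atan_quotient_lip (a b a' b' : R) : Rabs (atan_quotient a b - atan_quotient a' b') <= Rabs (a - a') + Rabs (b - b').
Proof.
  unfold atan_quotient.
  rewrite <- (RInt_minus (V := R_CompleteNormedModule)) by apply ex_RInt_atan_quotient.
  replace (Rabs (a - a') + Rabs (b - b')) with ((1 - 0) * (Rabs (a - a') + Rabs (b - b'))) by ring.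
  apply abs_RInt_le_const; [lra | apply (ex_RInt_minus (V := R_NormedModule)); apply ex_RInt_atan_quotient |].
  intros s Hs. eapply Rle_trans; [apply inv_one_plus_sqr_lip |].
  replace (b + s * (a - b) - (b' + s * (a' - b'))) with (s * (a - a') + (1 - s) * (b - b')) by ring.
  eapply Rle_trans; [apply Rabs_triang |].
  rewrite !Rabs_mult, (Rabs_pos_eq s), (Rabs_pos_eq (1 - s)) by lra.
  pose proof (Rabs_pos (a - a')). pose proof (Rabs_pos (b - b')). nra.
Qed.

Lemma atan_lip (x y : R) : Rabs (atan x - atan y) <= Rabs (x - y).
Proof.
  rewrite atan_minus, Rabs_mult, (Rabs_pos_eq (atan_quotient x y)) by apply atan_quotient_ge_0.
  pose proof (atan_quotient_le_1 x y). pose proof (Rabs_pos (x - y)). nra.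
Qed.

(** For bounded slopes the flux [atan] controls the slope. This brings estimates of flux increments
    back to estimates of slope increments. *)
Lemma atan_colip (x y l : R) : Rabs x <= l -> Rabs y <= l ->
  Rabs (x - y) <= (1 + l ^ 2) * Rabs (atan x - atan y).
Proof.
  intros Hx Hy. rewrite atan_minus, Rabs_mult, (Rabs_pos_eq (atan_quotient x y)) by apply atan_quotient_ge_0.
  pose proof (atan_quotient_ge x y l Hx Hy) as H. pose proof (one_plus_sqr_pos l) as Hl.
  apply (Rmult_le_compat_l (1 + l ^ 2)) in H; [| lra]. rewrite Rinv_r in H by lra.
  pose proof (Rabs_pos (x - y)). nra.
Qed.

Section Doubling.

Variables (h rho a0 C M G W theta : R) (N : nat) (w al e : nat -> R -> R).
Hypotheses (Hh : 0 < h) (Hhr : 2 * h <= rho) (Ha0 : 0 < a0) (HC : 0 <= C) (HCr : 2 * C * rho <= a0)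
  (HW : 0 <= W) (HMW : 4 * W <= M) (Htheta : 0 < theta)
  (HM : G + W / theta <= M * a0 / rho ^ 2)
  (HN : INR N * (h ^ 2 / 4) <= theta).
Hypothesis Hal : forall i y, (i < N)%nat -> a0 <= al i y <= 1.
Hypothesis Hal' : forall i y, (i < N)%nat -> Rabs (al i y - al i (y - h)) <= C * h.
Hypothesis He : forall i y, (i < N)%nat -> Rabs (e i y) <= h ^ 2 / 4 * G.
Hypothesis HwW : forall i y, (i <= N)%nat -> Rabs (w i y) <= W.
Hypothesis Hw : forall i y, (i < N)%nat -> w (S i) y =
  w i y + / 4 * (al i y * (w i (y + h) - w i y) - al i (y - h) * (w i y - w i (y - h))) + e i y.

(** The parabola in the distance [r] is concave enough to absorb the variation of the coefficients
    and the source, and equals [M] at [r = rho], above any oscillation [2 * W]. The second term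
    starts at [2 * W], so that no initial modulus of continuity is needed, and has decayed to 0 when
    the elapsed time is [theta]. *)
Let phi (i : nat) (r : R) : R :=
  M * (2 * rho * r - r ^ 2) / rho ^ 2 + 2 * W * (1 - INR i * (h ^ 2 / 4) / theta).

(* Two copies of the random walk behind the linear recursion are coupled so
   that only one of them moves at a time; then nearest neighbours cannot cross. *)
Lemma doubling : forall i, (i <= N)%nat -> forall y j, INR j * h <= rho ->
  w i (y + INR j * h) - w i y <= phi i (INR j * h).
Proof.
  assert (Hrho : 0 < rho) by lra.
  assert (Hrho2 : 0 < rho ^ 2) by nra.
  assert (Htime : forall i, (i <= N)%nat -> 0 <= 1 - INR i * (h ^ 2 / 4) / theta).
  { intros i Hi. apply le_INR in Hi.
    apply Rmult_le_reg_r with theta; [lra |].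
    replace ((1 - INR i * (h ^ 2 / 4) / theta) * theta) with (theta - INR i * (h ^ 2 / 4)) by (field; lra).
    assert (0 <= h ^ 2 / 4) by nra. nra. }
  assert (Hgap : forall i y y', (i <= N)%nat -> w i y - w i y' <= 2 * W).
  { intros i y y' Hi. pose proof (HwW i y Hi) as H1. pose proof (HwW i y' Hi) as H2.
    apply Rabs_le_between in H1. apply Rabs_le_between in H2. lra. }
  assert (Hpar : forall r, 0 <= r <= rho + h -> 0 <= M * (2 * rho * r - r ^ 2) / rho ^ 2).
  { intros r Hr. apply Rmult_le_pos; [| left; now apply Rinv_0_lt_compat].
    apply Rmult_le_pos; nra. }
  induction i as [| i IH]; intros Hi y j Hj.
  - unfold phi. simpl (INR 0). pose proof (Hgap 0%nat (y + INR j * h) y Hi).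
    assert (0 <= INR j * h) by (apply Rmult_le_pos; [apply pos_INR | lra]).
    pose proof (Hpar (INR j * h) ltac:(lra)). lra.
  - destruct j as [| j].
    { unfold phi. simpl (INR 0). rewrite !Rmult_0_l, Rplus_0_r, Rminus_diag.
      pose proof (Hpar 0 ltac:(lra)) as H. pose proof (Htime (S i) Hi). nra. }
    assert (Hi' : (i <= N)%nat) by lia. assert (Hi2 : (i < N)%nat) by lia.
    specialize (IH Hi').
    set (r := INR (S j) * h) in *.
    assert (Hrj : INR j * h = r - h) by (unfold r; rewrite S_INR; ring).
    assert (Hr0 : h <= r).
    { assert (0 <= INR j * h) by (apply Rmult_le_pos; [apply pos_INR | lra]). lra. }
    (* The induction hypothesis stops at distance [rho], which [r + h] exceeds by at most
       [h <= rho / 2]. There the parabola is still at least [3 * M / 4 >= 3 * W], more than the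
       oscillation. *)
    assert (Hplus : forall z, w i (z + (r + h)) - w i z <= phi i (r + h)).
    { intros z. destruct (Rle_lt_dec (r + h) rho) as [H | H].
      - specialize (IH z (S (S j))). replace (INR (S (S j)) * h) with (r + h) in IH
          by (unfold r; rewrite (S_INR (S j)); ring). auto.
      - unfold phi. pose proof (Hgap i (z + (r + h)) z Hi'). pose proof (Htime i Hi').
        assert (M * (3 / 4) <= M * (2 * rho * (r + h) - (r + h) ^ 2) / rho ^ 2).
        { unfold Rdiv at 2. rewrite Rmult_assoc. apply Rmult_le_compat_l; [lra |].
          apply Rmult_le_reg_r with (rho ^ 2); [exact Hrho2 |].
          rewrite Rmult_assoc, Rinv_l, Rmult_1_r by lra. nra. }
        nra. }
    assert (Hminus : forall z, w i (z + (r - h)) - w i z <= phi i (r - h)).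
    { intros z. rewrite <- Hrj. apply IH. lra. }
    pose proof (IH y (S j) Hj) as D0. fold r in D0.
    pose proof (Hplus y) as D1. replace (y + (r + h)) with (y + r + h) in D1 by ring.
    pose proof (Hminus y) as D2. replace (y + (r - h)) with (y + r - h) in D2 by ring.
    pose proof (Hminus (y + h)) as D3. replace (y + h + (r - h)) with (y + r) in D3 by ring.
    pose proof (Hplus (y - h)) as D4. replace (y - h + (r + h)) with (y + r) in D4 by ring.
    rewrite !(Hw i) by exact Hi2.
    pose proof (Hal i (y + r) Hi2) as A1. pose proof (Hal i (y + r - h) Hi2) as A2.
    pose proof (Hal i y Hi2) as A3. pose proof (Hal i (y - h) Hi2) as A4.
    pose proof (Hal' i (y + r) Hi2) as B1. pose proof (Hal' i y Hi2) as B2.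
    pose proof (He i (y + r) Hi2) as E1. pose proof (He i y Hi2) as E2.
    apply Rabs_le_between in B1. apply Rabs_le_between in B2.
    apply Rabs_le_between in E1. apply Rabs_le_between in E2.
    set (p := al i (y + r)) in *. set (q := al i (y + r - h)) in *.
    set (pz := al i y) in *. set (qz := al i (y - h)) in *.
    set (w0 := w i (y + r)) in *. set (w1 := w i y) in *.
    set (wp := w i (y + r + h)) in *. set (wm := w i (y + r - h)) in *.
    set (wp1 := w i (y + h)) in *. set (wm1 := w i (y - h)) in *.
    (* One step averages five pairs: both points stay, or exactly one of them moves by [h]. The four
       moving weights are at most [1 / 4] each, so the weight of staying is nonnegative. *)
    apply Rle_trans with
      ((1 - (p + q + pz + qz) / 4) * phi i r + (p + qz) / 4 * phi i (r + h)
       + (q + pz) / 4 * phi i (r - h) + 2 * (h ^ 2 / 4 * G)).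
    { replace (w0 + / 4 * (p * (wp - w0) - q * (w0 - wm)) + e i (y + r) -
        (w1 + / 4 * (pz * (wp1 - w1) - qz * (w1 - wm1)) + e i y))
      with ((1 - (p + q + pz + qz) / 4) * (w0 - w1) + p / 4 * (wp - w1) + q / 4 * (wm - w1)
        + pz / 4 * (w0 - wp1) + qz / 4 * (w0 - wm1) + (e i (y + r) - e i y)) by field.
      assert ((1 - (p + q + pz + qz) / 4) * (w0 - w1) <= (1 - (p + q + pz + qz) / 4) * phi i r)
        by (apply Rmult_le_compat_l; lra).
      assert (p / 4 * (wp - w1) <= p / 4 * phi i (r + h)) by (apply Rmult_le_compat_l; lra).
      assert (q / 4 * (wm - w1) <= q / 4 * phi i (r - h)) by (apply Rmult_le_compat_l; lra).
      assert (pz / 4 * (w0 - wp1) <= pz / 4 * phi i (r - h)) by (apply Rmult_le_compat_l; lra).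
      assert (qz / 4 * (w0 - wm1) <= qz / 4 * phi i (r + h)) by (apply Rmult_le_compat_l; lra).
      lra. }
    assert (Hphi : phi (S i) r = phi i r - 2 * (h ^ 2 / 4) * (W / theta)).
    { unfold phi. rewrite S_INR. field. lra. }
    rewrite Hphi.
    assert (Hp : phi i (r + h) = phi i r + M / rho ^ 2 * (2 * h * (rho - r) - h ^ 2))
      by (unfold phi; field; lra).
    assert (Hm : phi i (r - h) = phi i r + M / rho ^ 2 * (- 2 * h * (rho - r) - h ^ 2))
      by (unfold phi; field; lra).
    rewrite Hp, Hm.
    set (m := M / rho ^ 2) in *.
    assert (Hm0 : 0 <= m) by (unfold m, Rdiv; apply Rmult_le_pos; [lra | left; now apply Rinv_0_lt_compat]).
    replace (M * a0 / rho ^ 2) with (m * a0) in HM by (unfold m; field; lra).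
    (* The drift, due to coefficients that change by at most [C * h] over one cell, costs at most
       [C * rho * h ^ 2 <= a0 / 2 * h ^ 2]; the concavity of the parabola earns [a0 * h ^ 2]. The
       half that is left pays for [G] and for the decay rate [W / theta]. *)
    assert (Hkey : ((p - q) + (qz - pz)) / 4 * (2 * h * (rho - r)) - (p + q + pz + qz) / 4 * h ^ 2
      <= - (a0 / 2) * h ^ 2).
    { assert (((p - q) + (qz - pz)) / 4 * (2 * h * (rho - r)) <= 2 * (C * h) / 4 * (2 * h * (rho - r))).
      { apply Rmult_le_compat_r; [| lra]. apply Rmult_le_pos; lra. }
      assert (2 * (C * h) / 4 * (2 * h * (rho - r)) <= C * h ^ 2 * rho).
      { replace (2 * (C * h) / 4 * (2 * h * (rho - r))) with (C * h ^ 2 * (rho - r)) by field.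
        apply Rmult_le_compat_l; [| lra]. apply Rmult_le_pos; [lra | nra]. }
      assert (C * h ^ 2 * rho <= a0 / 2 * h ^ 2).
      { replace (C * h ^ 2 * rho) with (C * rho * h ^ 2) by ring.
        apply Rmult_le_compat_r; [nra | lra]. }
      assert (a0 * h ^ 2 <= (p + q + pz + qz) / 4 * h ^ 2).
      { apply Rmult_le_compat_r; [nra | lra]. }
      lra. }
    apply (Rmult_le_compat_l m) in Hkey; [| exact Hm0].
    assert (H2 : h ^ 2 / 4 * (G + W / theta) <= h ^ 2 / 4 * (m * a0)) by (apply Rmult_le_compat_l; nra).
    lra.
Qed.

End Doubling.

Lemma exp_mono (x y : R) : x <= y -> exp x <= exp y.
Proof. intros [H | ->]; [left; now apply exp_increasing | apply Rle_refl]. Qed.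

Section Scheme.

Variables (f g : R -> R) (c0 F L K Tm : R).
Hypotheses (Hc0 : 0 <= c0) (HF : 0 <= F) (HL : 0 <= L) (HK : 0 <= K) (HT : 0 <= Tm).
Hypothesis Hf : forall x y, Rabs (f x - f y) <= c0 * Rabs (x - y).
Hypothesis HfF : forall x, Rabs (f x) <= F.
Hypothesis Hg : forall x y, Rabs (g x - g y) <= L * Rabs (x - y).
Hypothesis Hg2 : forall x h, Rabs (g (x + h) + g (x - h) - 2 * g x) <= K * h ^ 2.

(** Explicit Euler step for [u_t = (atan u_y)_y - f u] with time step [h ^ 2 / 4]. Monotonicity
    alone would allow [h ^ 2 / 2]; the smaller step is what the coupling of two points in [doubling]
    requires. The step acts on functions on all of [R], so it commutes with every translation. *)
Definition step (h : R) (v : R -> R) (y : R) : R :=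
  v y + h / 4 * (atan ((v (y + h) - v y) / h) - atan ((v y - v (y - h)) / h))
    - h ^ 2 / 4 * f (v y).

Fixpoint scheme (h : R) (n : nat) : R -> R :=
  match n with O => g | S n => step h (scheme h n) end.

Definition space_quotient (h : R) (n : nat) (y : R) : R := (scheme h n (y + h) - scheme h n y) / h.
Definition time_quotient (h : R) (n : nat) (y : R) : R := (scheme h (S n) y - scheme h n y) / (h ^ 2 / 4).

Lemma sch_S (h : R) (n : nat) (y : R) : scheme h (S n) y =
  scheme h n y + h / 4 * (atan (space_quotient h n y) - atan (space_quotient h n (y - h))) - h ^ 2 / 4 * f (scheme h n y).
Proof. simpl. unfold step, space_quotient. replace (y - h + h) with y by ring. reflexivity. Qed.

(** Apart from the reaction term, the new difference at [y] is a convex combination of old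
    differences at [y - h], [y] and [y + h], with weights from [atan_quotient]. Slope and time
    bounds both follow, by comparing the scheme with its own translates. *)
Lemma step_contract (h : R) (a b : R -> R) (M : R) : 0 < h ->
  (forall y, Rabs (a y - b y) <= M) ->
  forall y, Rabs (step h a y - step h b y) <= (1 + h ^ 2 / 4 * c0) * M.
Proof.
  intros Hh HM y. unfold step.
  set (d1 := atan_quotient ((a (y + h) - a y) / h) ((b (y + h) - b y) / h)).
  set (d2 := atan_quotient ((a y - a (y - h)) / h) ((b y - b (y - h)) / h)).
  assert (E1 : atan ((a (y + h) - a y) / h) = atan ((b (y + h) - b y) / h)
    + d1 * ((a (y + h) - b (y + h)) - (a y - b y)) / h).
  { pose proof (atan_minus ((a (y + h) - a y) / h) ((b (y + h) - b y) / h)) as H.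
    fold d1 in H.
    replace (d1 * ((a (y + h) - b (y + h)) - (a y - b y)) / h) with
     (d1 * ((a (y + h) - a y) / h - (b (y + h) - b y) / h)) by (field; lra). lra. }
  assert (E2 : atan ((a y - a (y - h)) / h) = atan ((b y - b (y - h)) / h)
    + d2 * ((a y - b y) - (a (y - h) - b (y - h))) / h).
  { pose proof (atan_minus ((a y - a (y - h)) / h) ((b y - b (y - h)) / h)) as H.
    fold d2 in H.
    replace (d2 * ((a y - b y) - (a (y - h) - b (y - h))) / h) with
     (d2 * ((a y - a (y - h)) / h - (b y - b (y - h)) / h)) by (field; lra). lra. }
  rewrite E1, E2.
  pose proof (atan_quotient_ge_0 ((a (y + h) - a y) / h) ((b (y + h) - b y) / h)) as P1.
  pose proof (atan_quotient_le_1 ((a (y + h) - a y) / h) ((b (y + h) - b y) / h)) as P2.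
  pose proof (atan_quotient_ge_0 ((a y - a (y - h)) / h) ((b y - b (y - h)) / h)) as P3.
  pose proof (atan_quotient_le_1 ((a y - a (y - h)) / h) ((b y - b (y - h)) / h)) as P4.
  fold d1 in P1, P2. fold d2 in P3, P4.
  pose proof (HM y) as H0. pose proof (HM (y + h)) as Hp. pose proof (HM (y - h)) as Hm.
  pose proof (Rle_trans _ _ _ (Hf (a y) (b y)) (Rmult_le_compat_l c0 _ _ Hc0 H0)) as Hff.
  set (x0 := a y - b y) in *. set (xp := a (y + h) - b (y + h)) in *.
  set (xm := a (y - h) - b (y - h)) in *. set (ff := f (a y) - f (b y)) in *.
  match goal with |- Rabs ?X <= _ => replace X with
    (((1 - d1 / 4 - d2 / 4) * x0 + d1 / 4 * xp + d2 / 4 * xm) - h ^ 2 / 4 * ff)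
    by (unfold x0, xp, xm, ff; field; lra) end.
  assert (Hconv : Rabs ((1 - d1 / 4 - d2 / 4) * x0 + d1 / 4 * xp + d2 / 4 * xm) <= M).
  { apply Rabs_le. apply Rabs_le_between in H0. apply Rabs_le_between in Hp.
    apply Rabs_le_between in Hm. split; nra. }
  assert (Hff2 : Rabs (h ^ 2 / 4 * ff) <= h ^ 2 / 4 * (c0 * M)).
  { rewrite Rabs_mult, (Rabs_pos_eq (h ^ 2 / 4)) by nra. apply Rmult_le_compat_l; nra. }
  apply Rabs_le_between in Hconv. apply Rabs_le_between in Hff2. apply Rabs_le. split; lra.
Qed.

(** The margin 1 beyond [Tm] covers lattice times that overshoot and the one extra step taken by
    time quotients. *)
Let E := exp (c0 * (Tm + 1)).

Lemma growth_le (h : R) (n : nat) : 0 < h -> INR n * (h ^ 2 / 4) <= Tm + 1 ->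
  (1 + h ^ 2 / 4 * c0) ^ n <= E.
Proof.
  intros Hh Hn.
  assert (H : 0 <= h ^ 2 / 4) by nra.
  apply Rle_trans with (exp (h ^ 2 / 4 * c0) ^ n).
  - apply pow_incr. split; [nra | apply exp_ineq1_le].
  - assert (He : exp (h ^ 2 / 4 * c0) ^ n = exp (INR n * (h ^ 2 / 4 * c0))).
    { clear Hn. induction n as [| n IH]; [simpl; rewrite Rmult_0_l, exp_0; reflexivity |].
      rewrite S_INR, <- tech_pow_Rmult, IH, <- exp_plus. f_equal. ring. }
    rewrite He. unfold E. apply exp_mono. nra.
Qed.

Lemma growth_const_ge_1 : 1 <= E.
Proof.
  unfold E. apply Rle_trans with (exp 0); [rewrite exp_0; lra |].
  apply exp_mono, Rmult_le_pos; lra.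
Qed.

(** The translate of the scheme by [z] is the scheme for the translated data, so the Lipschitz
    constant of [g] grows only through [step_contract]. *)
Lemma sch_lip_aux (h : R) (n : nat) (z : R) : 0 < h ->
  forall y, Rabs (scheme h n (y + z) - scheme h n y) <= (1 + h ^ 2 / 4 * c0) ^ n * (L * Rabs z).
Proof.
  intros Hh. induction n as [| n IH]; intros y.
  - simpl. rewrite Rmult_1_l. eapply Rle_trans; [apply Hg |]. right. f_equal. f_equal. ring.
  - pose proof (step_contract h (fun x => scheme h n (x + z)) (scheme h n) _ Hh IH y) as H.
    simpl. eapply Rle_trans; [| rewrite Rmult_assoc; exact H].
    right. f_equal. f_equal. unfold step.
    replace (y + z + h) with (y + h + z) by ring. replace (y + z - h) with (y - h + z) by ring.
    reflexivity.
Qed.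

Lemma scheme_lip (h : R) (n : nat) (y z : R) : 0 < h -> INR n * (h ^ 2 / 4) <= Tm + 1 ->
  Rabs (scheme h n z - scheme h n y) <= E * L * Rabs (z - y).
Proof.
  intros Hh Hn. pose proof (sch_lip_aux h n (z - y) Hh y) as H.
  replace (y + (z - y)) with z in H by ring.
  eapply Rle_trans; [exact H |]. rewrite Rmult_assoc. apply Rmult_le_compat_r; [| now apply growth_le].
  pose proof (Rabs_pos (z - y)). nra.
Qed.

(** The scheme is compared with itself one step later. The size of the first step, and only that,
    uses the second differences of [g]. *)
Lemma sch_time_aux (h : R) (n : nat) : 0 < h ->
  forall y, Rabs (scheme h (S n) y - scheme h n y) <= (1 + h ^ 2 / 4 * c0) ^ n * (h ^ 2 / 4 * (K + F)).
Proof.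
  intros Hh. induction n as [| n IH]; intros y.
  - rewrite sch_S. unfold space_quotient. simpl scheme. simpl pow. rewrite Rmult_1_l.
    replace (y - h + h) with y by ring.
    replace (g y + h / 4 * (atan ((g (y + h) - g y) / h) - atan ((g y - g (y - h)) / h)) - h * (h * 1) / 4 * f (g y) - g y)
     with (h / 4 * (atan ((g (y + h) - g y) / h) - atan ((g y - g (y - h)) / h)) + - (h ^ 2 / 4 * f (g y))) by (simpl; field).
    eapply Rle_trans; [apply Rabs_triang |]. rewrite Rabs_Ropp, !Rabs_mult.
    rewrite (Rabs_pos_eq (h / 4)), (Rabs_pos_eq (h ^ 2 / 4)) by nra.
    assert (H1 : Rabs (atan ((g (y + h) - g y) / h) - atan ((g y - g (y - h)) / h)) <= K * h).
    { eapply Rle_trans; [apply atan_lip |].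
      replace ((g (y + h) - g y) / h - (g y - g (y - h)) / h) with
        ((g (y + h) + g (y - h) - 2 * g y) / h) by (field; lra).
      unfold Rdiv. rewrite Rabs_mult, (Rabs_pos_eq (/ h)) by (left; now apply Rinv_0_lt_compat).
      apply Rmult_le_reg_r with h; [exact Hh |]. rewrite Rmult_assoc, Rinv_l, Rmult_1_r by lra.
      eapply Rle_trans; [apply Hg2 |]. right. ring. }
    assert (h / 4 * Rabs (atan ((g (y + h) - g y) / h) - atan ((g y - g (y - h)) / h)) <= h / 4 * (K * h))
      by (apply Rmult_le_compat_l; lra).
    assert (h ^ 2 / 4 * Rabs (f (g y)) <= h ^ 2 / 4 * F) by (apply Rmult_le_compat_l; [nra | apply HfF]).
    simpl in *. lra.
  - pose proof (step_contract h (scheme h (S n)) (scheme h n) _ Hh IH y) as H.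
    simpl pow. rewrite Rmult_assoc. exact H.
Qed.

Definition time_bound := E * (K + F).
Definition slope_bound := E * L.
(** Read off from the scheme: a flux increment over one cell is [h] times time quotient plus
    reaction, and [atan_colip] undoes the arctangent at the price [1 + slope_bound ^ 2]. *)
Definition curvature_bound := (1 + slope_bound ^ 2) * (time_bound + F).

Lemma time_bound_ge_0 : 0 <= time_bound.
Proof. unfold time_bound. pose proof growth_const_ge_1. nra. Qed.

Lemma slope_bound_ge_0 : 0 <= slope_bound.
Proof. unfold slope_bound. pose proof growth_const_ge_1. nra. Qed.

Lemma curvature_bound_ge_0 : 0 <= curvature_bound.
Proof. unfold curvature_bound. pose proof time_bound_ge_0. pose proof (one_plus_sqr_pos slope_bound). nra. Qed.

Lemma dt_bound (h : R) (n : nat) (y : R) : 0 < h -> INR n * (h ^ 2 / 4) <= Tm + 1 ->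
  Rabs (time_quotient h n y) <= time_bound.
Proof.
  intros Hh Hn. pose proof (sch_time_aux h n Hh y) as H.
  assert (0 < h ^ 2 / 4) by nra.
  unfold time_quotient, Rdiv at 1. rewrite Rabs_mult, Rabs_inv, (Rabs_pos_eq (h ^ 2 / 4)) by lra.
  apply Rmult_le_reg_r with (h ^ 2 / 4); [lra |].
  rewrite Rmult_assoc, Rinv_l, Rmult_1_r by lra.
  eapply Rle_trans; [exact H |]. unfold time_bound.
  rewrite (Rmult_assoc E), (Rmult_comm (K + F)).
  apply Rmult_le_compat_r; [apply Rmult_le_pos; lra | now apply growth_le].
Qed.

Lemma sch_time (h : R) (n m : nat) (y : R) : 0 < h -> (n <= m)%nat ->
  INR m * (h ^ 2 / 4) <= Tm + 1 ->
  Rabs (scheme h m y - scheme h n y) <= time_bound * (INR (m - n) * (h ^ 2 / 4)).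
Proof.
  intros Hh Hnm. induction Hnm as [| m Hnm IH]; intros Hm.
  - rewrite Rminus_diag, Nat.sub_diag, Rabs_R0. simpl. lra.
  - assert (0 < h ^ 2 / 4) by nra. rewrite S_INR in Hm.
    specialize (IH ltac:(nra)).
    replace (S m - n)%nat with (S (m - n)) by lia. rewrite S_INR.
    replace (scheme h (S m) y - scheme h n y) with
      (time_quotient h m y * (h ^ 2 / 4) + (scheme h m y - scheme h n y)) by (unfold time_quotient; field; lra).
    eapply Rle_trans; [apply Rabs_triang |]. rewrite Rabs_mult, (Rabs_pos_eq (h ^ 2 / 4)) by lra.
    pose proof (dt_bound h m y Hh ltac:(nra)). nra.
Qed.

Lemma dp_bound (h : R) (n : nat) (y : R) : 0 < h -> INR n * (h ^ 2 / 4) <= Tm + 1 ->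
  Rabs (space_quotient h n y) <= slope_bound.
Proof.
  intros Hh Hn. pose proof (scheme_lip h n y (y + h) Hh Hn) as H.
  unfold space_quotient, Rdiv. rewrite Rabs_mult, (Rabs_pos_eq (/ h)) by (left; now apply Rinv_0_lt_compat).
  apply Rmult_le_reg_r with h; [exact Hh |]. rewrite Rmult_assoc, Rinv_l, Rmult_1_r by lra.
  replace (y + h - y) with h in H by ring. rewrite (Rabs_pos_eq h) in H by lra. exact H.
Qed.

Lemma flux_step (h : R) (n : nat) (y : R) : 0 < h ->
  atan (space_quotient h n (y + h)) - atan (space_quotient h n y) = h * (time_quotient h n (y + h) + f (scheme h n (y + h))).
Proof.
  intros Hh. pose proof (sch_S h n (y + h)) as H. replace (y + h - h) with y in H by ring.
  unfold time_quotient. rewrite H. field. lra.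
Qed.

Lemma dp_step (h : R) (n : nat) (y : R) : 0 < h -> INR n * (h ^ 2 / 4) <= Tm + 1 ->
  Rabs (space_quotient h n (y + h) - space_quotient h n y) <= curvature_bound * h.
Proof.
  intros Hh Hn.
  eapply Rle_trans; [apply (atan_colip _ _ slope_bound); now apply dp_bound |].
  rewrite flux_step, Rabs_mult, (Rabs_pos_eq h) by lra.
  pose proof (Rabs_triang (time_quotient h n (y + h)) (f (scheme h n (y + h)))) as H.
  pose proof (dt_bound h n (y + h) Hh Hn). pose proof (HfF (scheme h n (y + h))).
  unfold curvature_bound. rewrite Rmult_assoc, (Rmult_comm (time_bound + F)). apply Rmult_le_compat_l; [left; apply one_plus_sqr_pos |].
  apply Rmult_le_compat_l; lra.
Qed.

Lemma dp_lattice (h : R) (n j : nat) (y : R) : 0 < h -> INR n * (h ^ 2 / 4) <= Tm + 1 ->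
  Rabs (space_quotient h n (y + INR j * h) - space_quotient h n y) <= curvature_bound * (INR j * h).
Proof.
  intros Hh Hn. induction j as [| j IH].
  - simpl. rewrite Rmult_0_l, Rplus_0_r, Rminus_diag, Rabs_R0. lra.
  - pose proof (dp_step h n (y + INR j * h) Hh Hn) as H.
    rewrite S_INR. replace (y + (INR j + 1) * h) with (y + INR j * h + h) by ring.
    replace (space_quotient h n (y + INR j * h + h) - space_quotient h n y) with
     ((space_quotient h n (y + INR j * h + h) - space_quotient h n (y + INR j * h)) + (space_quotient h n (y + INR j * h) - space_quotient h n y)) by ring.
    eapply Rle_trans; [apply Rabs_triang |]. lra.
Qed.

Lemma sch_taylor (h : R) (n j : nat) (y : R) : 0 < h -> INR n * (h ^ 2 / 4) <= Tm + 1 ->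
  Rabs (scheme h n (y + INR j * h) - scheme h n y - INR j * h * space_quotient h n y) <= curvature_bound * (INR j * h) ^ 2.
Proof.
  intros Hh Hn. pose proof curvature_bound_ge_0 as HB. induction j as [| j IH].
  - simpl. rewrite Rmult_0_l, Rplus_0_r, Rmult_0_l, Rminus_diag, Rminus_0_r, Rabs_R0. lra.
  - pose proof (dp_lattice h n j y Hh Hn) as H. pose proof (pos_INR j) as Hj.
    rewrite S_INR. replace (y + (INR j + 1) * h) with (y + INR j * h + h) by ring.
    replace (scheme h n (y + INR j * h + h) - scheme h n y - (INR j + 1) * h * space_quotient h n y) with
     ((scheme h n (y + INR j * h) - scheme h n y - INR j * h * space_quotient h n y)
      + h * (space_quotient h n (y + INR j * h) - space_quotient h n y)) by (unfold space_quotient; field; lra).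
    eapply Rle_trans; [apply Rabs_triang |]. rewrite Rabs_mult, (Rabs_pos_eq h) by lra.
    apply (Rmult_le_compat_l h) in H; [| lra].
    assert (0 <= curvature_bound * h ^ 2 * (INR j + 1)) by (apply Rmult_le_pos; [apply Rmult_le_pos; [lra | nra] | lra]).
    nra.
Qed.

(** The scheme differentiated in time: a linear recursion in divergence form, exactly of the shape
    treated by [doubling], whose coefficients are Lipschitz by [dp_step] and bounded below because
    slopes are bounded. *)
Lemma dt_rec (h : R) (n : nat) (y : R) : 0 < h ->
  time_quotient h (S n) y = time_quotient h n y +
    / 4 * (atan_quotient (space_quotient h (S n) y) (space_quotient h n y) * (time_quotient h n (y + h) - time_quotient h n y)
         - atan_quotient (space_quotient h (S n) (y - h)) (space_quotient h n (y - h)) * (time_quotient h n y - time_quotient h n (y - h)))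
    + (f (scheme h n y) - f (scheme h (S n) y)).
Proof.
  intros Hh.
  pose proof (atan_minus (space_quotient h (S n) y) (space_quotient h n y)) as A1.
  pose proof (atan_minus (space_quotient h (S n) (y - h)) (space_quotient h n (y - h))) as A2.
  assert (E1 : space_quotient h (S n) y - space_quotient h n y = h / 4 * (time_quotient h n (y + h) - time_quotient h n y))
    by (unfold space_quotient, time_quotient; field; lra).
  assert (E2 : space_quotient h (S n) (y - h) - space_quotient h n (y - h) = h / 4 * (time_quotient h n y - time_quotient h n (y - h))).
  { unfold space_quotient, time_quotient. replace (y - h + h) with y by ring. field. lra. }
  rewrite E1 in A1. rewrite E2 in A2.
  assert (H2 : time_quotient h (S n) y = (h / 4 * (atan (space_quotient h (S n) y) - atan (space_quotient h (S n) (y - h)))) / (h ^ 2 / 4) - f (scheme h (S n) y)).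
  { unfold time_quotient at 1. rewrite (sch_S h (S n)). field. lra. }
  assert (H1 : time_quotient h n y = (h / 4 * (atan (space_quotient h n y) - atan (space_quotient h n (y - h)))) / (h ^ 2 / 4) - f (scheme h n y)).
  { unfold time_quotient at 1. rewrite (sch_S h n). field. lra. }
  replace (time_quotient h (S n) y) with (time_quotient h n y + (time_quotient h (S n) y - time_quotient h n y)) by ring.
  rewrite H2 at 1. rewrite H1 at 2.
  replace (atan (space_quotient h (S n) y)) with (atan (space_quotient h n y) + atan_quotient (space_quotient h (S n) y) (space_quotient h n y) * (h / 4 * (time_quotient h n (y + h) - time_quotient h n y))) by lra.
  replace (atan (space_quotient h (S n) (y - h))) with (atan (space_quotient h n (y - h)) + atan_quotient (space_quotient h (S n) (y - h)) (space_quotient h n (y - h)) * (h / 4 * (time_quotient h n y - time_quotient h n (y - h)))) by lra.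
  field. lra.
Qed.

(** Time quotients become Lipschitz in space after any positive time [theta], although initially
    they are merely bounded. This is the interior estimate on which all further regularity rests. *)
Lemma dt_lattice (theta : R) : 0 < theta -> exists Lam h1, 0 <= Lam /\ 0 < h1 <= 1 /\
  forall h n y j, 0 < h <= h1 -> theta <= INR n * (h ^ 2 / 4) <= Tm ->
  Rabs (time_quotient h n (y + INR j * h) - time_quotient h n y) <= Lam * (INR j * h).
Proof.
  intros Hth. pose proof time_bound_ge_0 as HW. pose proof curvature_bound_ge_0 as HB.
  set (a0 := / (1 + slope_bound ^ 2)).
  assert (Ha0 : 0 < a0) by (apply Rinv_0_lt_compat, one_plus_sqr_pos).
  set (C := 2 * curvature_bound). set (G := c0 * time_bound).
  set (rho := a0 / (2 * C + 1)).
  assert (Hrho : 0 < rho) by (apply Rdiv_lt_0_compat; unfold C; lra).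
  assert (HCr : 2 * C * rho <= a0).
  { unfold rho. apply Rmult_le_reg_r with (2 * C + 1); [unfold C; lra |].
    replace (2 * C * (a0 / (2 * C + 1)) * (2 * C + 1)) with (2 * C * a0) by (field; unfold C; lra). nra. }
  assert (HG : 0 <= G + time_bound / theta).
  { assert (0 <= time_bound / theta) by (unfold Rdiv; apply Rmult_le_pos; [lra | left; now apply Rinv_0_lt_compat]).
    unfold G. nra. }
  (* [doubling] places two lower bounds on [M], by the oscillation and by source plus decay; their
     sum meets both. *)
  set (M := 4 * time_bound + (G + time_bound / theta) * rho ^ 2 / a0).
  assert (HM0 : 0 <= (G + time_bound / theta) * rho ^ 2 / a0).
  { unfold Rdiv at 1. apply Rmult_le_pos; [apply Rmult_le_pos; nra | left; now apply Rinv_0_lt_compat]. }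
  assert (HM1 : 4 * time_bound <= M) by (unfold M; lra).
  assert (HM2 : G + time_bound / theta <= M * a0 / rho ^ 2).
  { unfold M. replace ((4 * time_bound + (G + time_bound / theta) * rho ^ 2 / a0) * a0 / rho ^ 2) with
     (G + time_bound / theta + 4 * time_bound * a0 / rho ^ 2) by (field; split; lra).
    assert (0 <= 4 * time_bound * a0 / rho ^ 2); [| lra].
    unfold Rdiv. apply Rmult_le_pos; [nra | left; apply Rinv_0_lt_compat; nra]. }
  set (h1 := Rmin 1 (rho / 2)).
  assert (Hh1 : 0 < h1 <= 1) by (unfold h1; split; [apply Rmin_glb_lt; lra | apply Rmin_l]).
  assert (Hdiv : forall a b, 0 <= a -> 0 < b -> 0 <= a / b).
  { intros a b Ha Hb. apply Rmult_le_pos; [lra | left; now apply Rinv_0_lt_compat]. }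
  (* The three terms are the initial slope of the parabola, the trivial bound at distances beyond
     [rho], and the part of the decaying term that survives because a whole number of steps falls
     short of [theta] by less than one step. *)
  exists (2 * M / rho + 2 * time_bound / rho + time_bound / theta), h1.
  assert (P1 : 0 <= 2 * M / rho) by (apply Hdiv; lra).
  assert (P2 : 0 <= 2 * time_bound / rho) by (apply Hdiv; lra).
  assert (P3 : 0 <= time_bound / theta) by (apply Hdiv; lra).
  split; [lra | split; [exact Hh1 |]].
  intros h n y j [Hh Hhh] [Hn1 Hn2].
  assert (Hhr : 2 * h <= rho) by (pose proof (Rmin_r 1 (rho / 2)); fold h1 in H; lra).
  assert (Hh2 : 0 < h ^ 2 / 4) by nra. assert (Hh3 : h ^ 2 / 4 <= / 4) by nra.
  assert (Hjh : 0 <= INR j * h) by (apply Rmult_le_pos; [apply pos_INR | lra]).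
  destruct j as [| j].
  { simpl. rewrite Rmult_0_l, Rplus_0_r, Rminus_diag, Rabs_R0. lra. }
  destruct (Rle_lt_dec (INR (S j) * h) rho) as [Hsmall | Hbig].
  2:{ apply Rle_trans with (2 * time_bound).
      - pose proof (dt_bound h n (y + INR (S j) * h) Hh ltac:(lra)) as H1.
        pose proof (dt_bound h n y Hh ltac:(lra)) as H2.
        unfold Rminus. eapply Rle_trans; [apply Rabs_triang |]. rewrite Rabs_Ropp. lra.
      - assert (2 * time_bound <= 2 * time_bound / rho * (INR (S j) * h)).
        { replace (2 * time_bound) with (2 * time_bound / rho * rho) at 1 by (field; lra).
          apply Rmult_le_compat_l; lra. }
        nra. }
  (* [N] steps fit into the time [theta]; the recursion is started at step [n - N], so that the
     decaying term has almost vanished at step [n]. *)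
  destruct (nfloor_ex (theta / (h ^ 2 / 4))) as [N [HN1 HN2]]; [left; now apply Rdiv_lt_0_compat |].
  assert (HNa : INR N * (h ^ 2 / 4) <= theta).
  { apply (Rmult_le_compat_r (h ^ 2 / 4)) in HN1; [| lra].
    replace (theta / (h ^ 2 / 4) * (h ^ 2 / 4)) with theta in HN1 by (field; lra). exact HN1. }
  assert (HNb : theta < INR N * (h ^ 2 / 4) + h ^ 2 / 4).
  { apply (Rmult_lt_compat_r (h ^ 2 / 4)) in HN2; [| lra].
    replace (theta / (h ^ 2 / 4) * (h ^ 2 / 4)) with theta in HN2 by (field; lra). lra. }
  assert (HNn : (N <= n)%nat).
  { apply INR_le. apply Rmult_le_reg_r with (h ^ 2 / 4); lra. }
  set (n0 := (n - N)%nat).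
  assert (Hidx : forall i, (i <= N)%nat -> INR (n0 + i) * (h ^ 2 / 4) <= Tm).
  { intros i Hi. assert (INR (n0 + i) <= INR n) by (apply le_INR; unfold n0; lia). nra. }
  assert (Hidx1 : forall i, (i <= N)%nat -> INR (S (n0 + i)) * (h ^ 2 / 4) <= Tm + 1).
  { intros i Hi. rewrite S_INR. pose proof (Hidx i Hi). nra. }
  (* [doubling] bounds differences from above only; applying it to the recursion and to its negative
     gives the absolute value. *)
  assert (Hd : forall sg, sg = 1 \/ sg = -1 ->
    sg * time_quotient h n (y + INR (S j) * h) - sg * time_quotient h n y <= (2 * M / rho + time_bound / theta) * (INR (S j) * h)).
  { intros sg Hsg.
    assert (Hsa : Rabs sg = 1).
    { destruct Hsg as [-> | ->]; [apply Rabs_R1 |].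
      rewrite Rabs_left by lra. ring. }
    pose proof (doubling h rho a0 C M G time_bound theta N
      (fun i y => sg * time_quotient h (n0 + i) y)
      (fun i y => atan_quotient (space_quotient h (S (n0 + i)) y) (space_quotient h (n0 + i) y))
      (fun i y => sg * (f (scheme h (n0 + i) y) - f (scheme h (S (n0 + i)) y)))
      Hh Hhr Ha0 ltac:(unfold C; lra) HCr HW HM1 Hth HM2 HNa) as Hdoub.
    cbv beta in Hdoub.
    lapply Hdoub; clear Hdoub; [intros Hdoub |].
    2:{ intros i z Hi. split; [| apply atan_quotient_le_1]. apply atan_quotient_ge; apply dp_bound; auto.
      + apply Hidx1. lia.
      + pose proof (Hidx i ltac:(lia)). lra. }
    lapply Hdoub; clear Hdoub; [intros Hdoub |].
    2:{ intros i z Hi. eapply Rle_trans; [apply atan_quotient_lip |].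
      pose proof (dp_step h (S (n0 + i)) (z - h) Hh (Hidx1 i ltac:(lia))) as D1.
      pose proof (dp_step h (n0 + i) (z - h) Hh ltac:(pose proof (Hidx i ltac:(lia)); lra)) as D2.
      replace (z - h + h) with z in D1, D2 by ring. unfold C. lra. }
    lapply Hdoub; clear Hdoub; [intros Hdoub |].
    2:{ intros i z Hi. rewrite Rabs_mult, Hsa, Rmult_1_l. eapply Rle_trans; [apply Hf |].
      pose proof (sch_time h (n0 + i) (S (n0 + i)) z Hh ltac:(lia) (Hidx1 i ltac:(lia))) as D.
      replace (S (n0 + i) - (n0 + i))%nat with 1%nat in D by lia. simpl INR in D.
      rewrite Rabs_minus_sym in D. unfold G.
      apply (Rmult_le_compat_l c0) in D; [| lra]. lra. }
    lapply Hdoub; clear Hdoub; [intros Hdoub |].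
    2:{ intros i z Hi. rewrite Rabs_mult, Hsa, Rmult_1_l. apply dt_bound; auto.
      pose proof (Hidx i Hi). lra. }
    lapply Hdoub; clear Hdoub; [intros Hdoub |].
    2:{ intros i z Hi. replace (n0 + S i)%nat with (S (n0 + i)) by lia.
      rewrite (dt_rec h (n0 + i) z Hh). ring. }
    pose proof (Hdoub N (le_n N) y (S j) Hsmall) as Hres. clear Hdoub.
    replace (n0 + N)%nat with n in Hres by (unfold n0; lia).
        eapply Rle_trans; [exact Hres |].
        set (r := INR (S j) * h) in *.
        assert (Hrh : h <= r).
        { unfold r. rewrite S_INR. pose proof (pos_INR j). nra. }
        assert (M * (2 * rho * r - r ^ 2) / rho ^ 2 <= 2 * M / rho * r).
        { replace (2 * M / rho * r) with (M * (2 * rho * r) / rho ^ 2) by (field; lra).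
          unfold Rdiv. apply Rmult_le_compat_r; [left; apply Rinv_0_lt_compat; nra |].
          apply Rmult_le_compat_l; nra. }
        assert (2 * time_bound * (1 - INR N * (h ^ 2 / 4) / theta) <= time_bound / theta * r).
        { replace (2 * time_bound * (1 - INR N * (h ^ 2 / 4) / theta)) with
            (time_bound / theta * (2 * (theta - INR N * (h ^ 2 / 4)))) by (field; lra).
          apply Rmult_le_compat_l; [lra |]. nra. }
        lra. }
  pose proof (Hd 1 (or_introl eq_refl)) as H1. pose proof (Hd (-1) (or_intror eq_refl)) as H2.
  apply Rabs_le. split; nra.
Qed.

(** Summation of [flux_step] over [j] cells: each summand differs from the one at [y] by a Lipschitz
    error, from [dt_lattice] for the time quotient and from [scheme_lip] for the reaction. *)
Lemma flux_taylor (theta : R) : 0 < theta -> exists C h1, 0 <= C /\ 0 < h1 <= 1 /\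
  forall h n y j, 0 < h <= h1 -> theta <= INR n * (h ^ 2 / 4) <= Tm ->
  Rabs (atan (space_quotient h n (y + INR j * h)) - atan (space_quotient h n y)
        - INR j * h * (time_quotient h n y + f (scheme h n y))) <= C * (INR j * h) ^ 2.
Proof.
  intros Hth. destruct (dt_lattice theta Hth) as [Lam [h1 [HLam [Hh1 H]]]].
  pose proof slope_bound_ge_0 as HL1.
  exists (Lam + c0 * slope_bound), h1. split; [nra | split; [exact Hh1 |]].
  intros h n y j Hh Hn. induction j as [| j IH].
  - simpl. rewrite Rmult_0_l, Rplus_0_r, Rmult_0_l, Rminus_diag, Rminus_0_r, Rabs_R0. nra.
  - pose proof (flux_step h n (y + INR j * h) ltac:(lra)) as Hs.
    pose proof (H h n y (S j) Hh Hn) as D. pose proof (pos_INR j) as Hj.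
    replace (y + INR j * h + h) with (y + INR (S j) * h) in Hs by (rewrite S_INR; ring).
    pose proof (Hf (scheme h n (y + INR (S j) * h)) (scheme h n y)) as D2.
    pose proof (scheme_lip h n y (y + INR (S j) * h) ltac:(lra) ltac:(lra)) as D3. fold slope_bound in D3.
    replace (y + INR (S j) * h - y) with (INR (S j) * h) in D3 by ring.
    assert (Hr : 0 <= INR (S j) * h) by (apply Rmult_le_pos; [apply pos_INR | lra]).
    rewrite (Rabs_pos_eq (INR (S j) * h)) in D3 by lra.
    apply (Rmult_le_compat_l c0) in D3; [| lra].
    match goal with |- Rabs ?X <= _ => replace X with
     ((atan (space_quotient h n (y + INR j * h)) - atan (space_quotient h n y) - INR j * h * (time_quotient h n y + f (scheme h n y)))
      + h * ((time_quotient h n (y + INR (S j) * h) - time_quotient h n y) + (f (scheme h n (y + INR (S j) * h)) - f (scheme h n y)))) end.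
    2:{ rewrite <- (Rplus_minus (atan (space_quotient h n (y + INR j * h))) (atan (space_quotient h n (y + INR (S j) * h)))).
        rewrite Hs, S_INR. ring. }
    eapply Rle_trans; [apply Rabs_triang |]. rewrite Rabs_mult, (Rabs_pos_eq h) by lra.
    assert (D4 : Rabs ((time_quotient h n (y + INR (S j) * h) - time_quotient h n y) + (f (scheme h n (y + INR (S j) * h)) - f (scheme h n y)))
      <= (Lam + c0 * slope_bound) * (INR (S j) * h)).
    { eapply Rle_trans; [apply Rabs_triang |]. lra. }
    apply (Rmult_le_compat_l h) in D4; [| lra].
    rewrite S_INR in *.
    assert (0 <= (Lam + c0 * slope_bound) * (INR j * h * h)).
    { apply Rmult_le_pos; [nra |]. apply Rmult_le_pos; [apply Rmult_le_pos; lra | lra]. }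
    nra.
Qed.

End Scheme.

(** * Derivatives from second-order Taylor estimates *)

Lemma is_derive_approx (f : R -> R) (x l : R) :
  (forall eps, 0 < eps -> exists d, 0 < d /\ forall h, Rabs h < d ->
     Rabs (f (x + h) - f x - h * l) <= eps * Rabs h) -> is_derive f x l.
Proof.
  intros H. apply is_derive_Reals. intros eps Heps.
  destruct (H (eps / 2) ltac:(lra)) as [d [Hd Hd']].
  exists (mkposreal d Hd). intros h Hh0 Hh. simpl in Hh. specialize (Hd' h Hh).
  assert (Hp : 0 < Rabs h) by now apply Rabs_pos_lt.
  replace ((f (x + h) - f x) / h - l) with ((f (x + h) - f x - h * l) / h) by (field; exact Hh0).
  unfold Rdiv. rewrite Rabs_mult, Rabs_inv.
  apply Rmult_lt_reg_r with (Rabs h); [exact Hp |].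
  rewrite Rmult_assoc, Rinv_l, Rmult_1_r by lra. nra.
Qed.

(** The point [z + 2 * d] is reached in one stride and in two. The linear terms disagree by
    [d * (G (z + d) - G z)], the errors add up to [4 + 1 + 1] times [C * d ^ 2]. *)
Lemma taylor_lip (F G : R -> R) (C : R) :
  (forall z d, 0 < d -> Rabs (F (z + d) - F z - d * G z) <= C * d ^ 2) ->
  forall z d, 0 < d -> Rabs (G (z + d) - G z) <= 6 * C * d.
Proof.
  intros H z d Hd.
  pose proof (H z d Hd) as H1. pose proof (H (z + d) d Hd) as H2.
  pose proof (H z (2 * d) ltac:(lra)) as H3.
  replace (z + d + d) with (z + 2 * d) in H2 by ring.
  apply Rabs_le_between in H1. apply Rabs_le_between in H2. apply Rabs_le_between in H3.
  apply Rmult_le_reg_l with d; [exact Hd |].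
  rewrite <- (Rabs_pos_eq d) at 1 by lra. rewrite <- Rabs_mult.
  apply Rabs_le. split; nra.
Qed.

(** The expansion is given for forward increments. A backward one is expanded at the other end
    point, and [taylor_lip] moves [G] back, whence [7 = 1 + 6]. *)
Lemma taylor_is_derive (F G : R -> R) (C : R) :
  (forall z d, 0 < d -> Rabs (F (z + d) - F z - d * G z) <= C * d ^ 2) ->
  forall z : R, is_derive F z (G z).
Proof.
  intros H z. pose proof (taylor_lip F G C H) as HG.
  assert (HC : 0 <= C).
  { pose proof (H z 1 Rlt_0_1) as H1. pose proof (Rabs_pos (F (z + 1) - F z - 1 * G z)). lra. }
  apply is_derive_approx. intros eps Heps.
  exists (eps / (7 * C + 1)). split; [apply Rdiv_lt_0_compat; lra |].
  intros h Hh.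
  assert (Hb : (7 * C + 1) * Rabs h <= eps).
  { left. apply (Rmult_lt_compat_l (7 * C + 1)) in Hh; [| lra].
    replace ((7 * C + 1) * (eps / (7 * C + 1))) with eps in Hh by (field; lra). exact Hh. }
  pose proof (Rabs_pos h) as Hh0.
  assert (Hm : Rabs (F (z + h) - F z - h * G z) <= 7 * C * Rabs h ^ 2).
  { destruct (Rtotal_order h 0) as [Hn | [-> | Hp]].
    - pose proof (H (z + h) (- h) ltac:(lra)) as H1. pose proof (HG (z + h) (- h) ltac:(lra)) as H2.
      replace (z + h + - h) with z in H1, H2 by ring. rewrite (Rabs_left h) by lra.
      replace (F (z + h) - F z - h * G z) with
        (- (F z - F (z + h) - - h * G (z + h)) + - h * (G z - G (z + h))) by ring.
      eapply Rle_trans; [apply Rabs_triang |].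
      rewrite Rabs_Ropp, Rabs_mult, (Rabs_pos_eq (- h)) by lra. nra.
    - rewrite Rplus_0_r, Rmult_0_l, Rminus_diag, Rminus_0_r, Rabs_R0. lra.
    - pose proof (H z h Hp) as H1. rewrite (Rabs_pos_eq h) by lra. nra. }
  nra.
Qed.

(** [G] is a uniform limit of difference quotients of [F] with a fixed spatial increment, and
    therefore inherits joint continuity without any time regularity of its own. *)
Lemma taylor_continuity_2d (F G : R -> R -> R) (C y t r : R) : 0 < r ->
  (forall z s d, Rabs (s - t) < r -> 0 < d -> Rabs (F (z + d) s - F z s - d * G z s) <= C * d ^ 2) ->
  (forall z, continuity_2d_pt F z t) -> continuity_2d_pt G y t.
Proof.
  intros Hr H HF eps.
  assert (HC : 0 <= C).
  { pose proof (H y t 1 ltac:(rewrite Rminus_diag, Rabs_R0; exact Hr) Rlt_0_1) as H1.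
    pose proof (Rabs_pos (F (y + 1) t - F y t - 1 * G y t)). lra. }
  pose proof (cond_pos eps) as He.
  set (d := eps / (4 * C + 1)).
  assert (Hd : 0 < d) by (apply Rdiv_lt_0_compat; lra).
  assert (HCd : (4 * C + 1) * d = eps) by (unfold d; field; lra).
  assert (He' : 0 < d * eps / 8) by (apply Rdiv_lt_0_compat; [apply Rmult_lt_0_compat |]; lra).
  destruct (HF y (mkposreal _ He')) as [d1 H1]. destruct (HF (y + d) (mkposreal _ He')) as [d2 H2].
  simpl in H1, H2.
  assert (Hm : 0 < Rmin r (Rmin d1 d2)).
  { repeat apply Rmin_glb_lt; [exact Hr | apply cond_pos | apply cond_pos]. }
  exists (mkposreal _ Hm). simpl. intros z s Hz Hs.
  pose proof (Rmin_l r (Rmin d1 d2)). pose proof (Rmin_r r (Rmin d1 d2)).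
  pose proof (Rmin_l d1 d2). pose proof (Rmin_r d1 d2).
  specialize (H1 z s ltac:(lra) ltac:(lra)).
  specialize (H2 (z + d) s ltac:(replace (z + d - (y + d)) with (z - y) by ring; lra) ltac:(lra)).
  pose proof (H z s d ltac:(lra) Hd) as T1.
  pose proof (H y t d ltac:(rewrite Rminus_diag, Rabs_R0; exact Hr) Hd) as T2.
  apply Rabs_def2 in H1. apply Rabs_def2 in H2.
  apply Rabs_le_between in T1. apply Rabs_le_between in T2.
  apply Rmult_lt_reg_l with d; [exact Hd |].
  rewrite <- (Rabs_pos_eq d) at 1 by lra. rewrite <- Rabs_mult.
  apply Rabs_def1; nra.
Qed.

(** * The limit of the scheme as the mesh tends to zero *)

Section Existence.

Variables (f g : R -> R) (c0 F L K Tm : R).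
Hypotheses (Hc0 : 0 <= c0) (HF : 0 <= F) (HL : 0 <= L) (HK : 0 <= K) (HT : 0 < Tm).
Hypothesis Hf : forall x y, Rabs (f x - f y) <= c0 * Rabs (x - y).
Hypothesis HfF : forall x, Rabs (f x) <= F.
Hypothesis Hg : forall x y, Rabs (g x - g y) <= L * Rabs (x - y).
Hypothesis Hg2 : forall x h, Rabs (g (x + h) + g (x - h) - 2 * g x) <= K * h ^ 2.

Let HT0 : 0 <= Tm. Proof. lra. Qed.

Local Notation sch := (scheme f g).
Local Notation dp := (space_quotient f g).
Local Notation dt := (time_quotient f g).
Local Notation W1 := (time_bound c0 F K Tm).
Local Notation L1 := (slope_bound c0 L Tm).
Local Notation B1 := (curvature_bound c0 F L K Tm).

Let W1_pos : 0 <= W1. Proof. now apply time_bound_ge_0. Qed.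
Let L1_pos : 0 <= L1. Proof. now apply slope_bound_ge_0. Qed.
Let B1_pos : 0 <= B1. Proof. now apply curvature_bound_ge_0. Qed.

Let mesh (k : nat) : R := / INR (S k).
Let tau (k : nat) : R := mesh k ^ 2 / 4.

Lemma mesh_pos (k : nat) : 0 < mesh k.
Proof. apply Rinv_0_lt_compat, lt_0_INR. lia. Qed.

Lemma mesh_le_1 (k : nat) : mesh k <= 1.
Proof.
  unfold mesh. rewrite <- Rinv_1. apply Rinv_le_contravar; [lra |].
  change 1 with (INR 1). apply le_INR. lia.
Qed.

Lemma tau_pos (k : nat) : 0 < tau k.
Proof. unfold tau. pose proof (mesh_pos k). nra. Qed.

Lemma tau_le_mesh (k : nat) : tau k <= mesh k.
Proof. unfold tau. pose proof (mesh_pos k). pose proof (mesh_le_1 k). nra. Qed.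

Lemma mesh_cv : ucv mesh 0.
Proof. exact ucv_inv_succ. Qed.

Lemma ultra_mesh_lt (e : R) : 0 < e -> ultra (fun k => mesh k < e).
Proof.
  intros He. generalize (mesh_cv e He). apply ultra_imp. intros k Hk.
  rewrite Rminus_0_r, Rabs_pos_eq in Hk; [exact Hk | left; apply mesh_pos].
Qed.

Definition idx (s t : R) : nat :=
  epsilon (inhabits 0%nat) (fun n => INR n * s <= t < INR n * s + s).

Lemma idx_spec (s t : R) : 0 < s -> 0 <= t -> INR (idx s t) * s <= t < INR (idx s t) * s + s.
Proof.
  intros Hs Ht. unfold idx. apply epsilon_spec.
  destruct (nfloor_ex (t / s)) as [n [H1 H2]].
  { apply Rmult_le_pos; [exact Ht | left; now apply Rinv_0_lt_compat]. }
  exists n.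
  apply (Rmult_le_compat_r s) in H1; [| lra]. apply (Rmult_lt_compat_r s) in H2; [| lra].
  replace (t / s * s) with t in H1, H2 by (field; lra). lra.
Qed.

Lemma idx_cv (s : nat -> R) (t : R) : (forall k, 0 < s k <= mesh k) -> 0 <= t ->
  ucv (fun k => INR (idx (s k) t) * s k) t.
Proof.
  intros Hs Ht. apply ucv_squeeze with mesh; [| apply mesh_cv].
  apply ultra_all. intros k. pose proof (idx_spec (s k) t (proj1 (Hs k)) Ht). pose proof (Hs k).
  apply Rabs_le. lra.
Qed.

Lemma tidx_cv (t : R) : 0 <= t -> ucv (fun k => INR (idx (tau k) t) * tau k) t.
Proof.
  intros Ht. apply (idx_cv tau t); [| exact Ht]. intros k. split; [apply tau_pos | apply tau_le_mesh].
Qed.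

Lemma yidx_cv (d : R) : 0 <= d -> ucv (fun k => INR (idx (mesh k) d) * mesh k) d.
Proof.
  intros Hd. apply (idx_cv mesh d); [| exact Hd]. intros k. split; [apply mesh_pos | lra].
Qed.

Lemma sch_time_abs (h : R) (n m : nat) (y : R) : 0 < h ->
  INR n * (h ^ 2 / 4) <= Tm + 1 -> INR m * (h ^ 2 / 4) <= Tm + 1 ->
  Rabs (sch h m y - sch h n y) <= W1 * Rabs (INR m * (h ^ 2 / 4) - INR n * (h ^ 2 / 4)).
Proof.
  intros Hh Hn Hm.
  assert (Hw : forall n m, (n <= m)%nat -> INR m * (h ^ 2 / 4) <= Tm + 1 ->
    Rabs (sch h m y - sch h n y) <= W1 * Rabs (INR m * (h ^ 2 / 4) - INR n * (h ^ 2 / 4))).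
  { clear n m Hn Hm. intros n m Hnm Hm.
    eapply Rle_trans; [apply (sch_time f g c0 F K Tm); eauto |].
    rewrite minus_INR by exact Hnm.
    replace (INR m * (h ^ 2 / 4) - INR n * (h ^ 2 / 4)) with ((INR m - INR n) * (h ^ 2 / 4)) by ring.
    apply Rmult_le_compat_l; [exact W1_pos | apply Rle_abs]. }
  destruct (Nat.le_ge_cases n m) as [H | H]; [now apply Hw |].
  rewrite Rabs_minus_sym, (Rabs_minus_sym (INR m * _)). now apply Hw.
Qed.

(** All limits are taken along the same ultrafilter, so function, slope and time derivative are
    compatible without successive subsequences. *)
Definition sol_U (y t : R) : R := ulim (fun k => sch (mesh k) (idx (tau k) t) y).
Definition sol_P (y t : R) : R := ulim (fun k => dp (mesh k) (idx (tau k) t) y).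
Definition sol_W (y t : R) : R := ulim (fun k => dt (mesh k) (idx (tau k) t) y).

Lemma ultra_time_le (nk : nat -> nat) (t : R) : t <= Tm ->
  ucv (fun k => INR (nk k) * tau k) t -> ultra (fun k => INR (nk k) * tau k <= Tm + 1).
Proof.
  intros Ht H. generalize (H 1 Rlt_0_1). apply ultra_imp. intros k Hk.
  apply Rabs_def2 in Hk. lra.
Qed.

(** Equicontinuity makes the limit independent of how [(z, t)] is approached. Lattice offsets
    [INR j * mesh k] may therefore replace a continuous increment. *)
Lemma U_move (zk : nat -> R) (nk : nat -> nat) (z t : R) : 0 <= t <= Tm ->
  ucv zk z -> ucv (fun k => INR (nk k) * tau k) t ->
  ucv (fun k => sch (mesh k) (nk k) (zk k)) (sol_U z t).
Proof.
  intros Ht Hz Hn.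
  pose proof (tidx_cv t ltac:(lra)) as Hi.
  pose proof (ultra_time_le _ _ (proj2 Ht) Hi) as Hib.
  pose proof (ultra_time_le _ _ (proj2 Ht) Hn) as Hnb.
  assert (HU : ucv (fun k => sch (mesh k) (idx (tau k) t) z) (sol_U z t)).
  { apply ulim_cv with (Rabs (g z) + W1 * (Tm + 1)). revert Hib. apply ultra_imp. intros k Hk.
    pose proof (sch_time_abs (mesh k) 0 (idx (tau k) t) z (mesh_pos k)
      ltac:(simpl; lra) Hk) as H. fold (tau k) in H. simpl INR in H at 2.
    rewrite Rmult_0_l, Rminus_0_r, (Rabs_pos_eq (INR _ * tau k)) in H
      by (apply Rmult_le_pos; [apply pos_INR | left; apply tau_pos]).
    apply (Rmult_le_compat_l W1) in Hk; [| exact W1_pos].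
    replace (sch (mesh k) (idx (tau k) t) z) with
      ((sch (mesh k) (idx (tau k) t) z - sch (mesh k) 0 z) + g z) by (simpl; ring).
    eapply Rle_trans; [apply Rabs_triang |]. lra. }
  replace (sol_U z t) with (sol_U z t + 0) by ring.
  apply ucv_ext with (fun k => sch (mesh k) (idx (tau k) t) z +
    (sch (mesh k) (nk k) (zk k) - sch (mesh k) (idx (tau k) t) z)); [intros; ring |].
  apply ucv_plus; [exact HU |].
  apply ucv_squeeze with (fun k => L1 * Rabs (zk k - z) +
    W1 * Rabs (INR (nk k) * tau k - INR (idx (tau k) t) * tau k)).
  - generalize (ultra_and _ _ Hib Hnb). apply ultra_imp. intros k [H1 H2].
    rewrite Rminus_0_r.
    pose proof (sch_time_abs (mesh k) (idx (tau k) t) (nk k) z (mesh_pos k) H1 H2) as H3.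
    pose proof (scheme_lip f g c0 L Tm Hc0 HL Hf Hg (mesh k) (nk k) z (zk k) (mesh_pos k) H2) as H4.
    replace (sch (mesh k) (nk k) (zk k) - sch (mesh k) (idx (tau k) t) z) with
     ((sch (mesh k) (nk k) (zk k) - sch (mesh k) (nk k) z) +
      (sch (mesh k) (nk k) z - sch (mesh k) (idx (tau k) t) z)) by ring.
    eapply Rle_trans; [apply Rabs_triang |]. fold (tau k) in H3. unfold slope_bound. lra.
  - replace 0 with (L1 * Rabs (z - z) + W1 * Rabs (t - t)) by (rewrite !Rminus_diag, Rabs_R0; ring).
    apply ucv_plus; apply ucv_scal, ucv_abs, ucv_minus; auto. apply ucv_const.
Qed.

Lemma U_lip (y z t s : R) : 0 <= t <= Tm -> 0 <= s <= Tm ->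
  Rabs (sol_U y t - sol_U z s) <= L1 * Rabs (y - z) + W1 * Rabs (t - s).
Proof.
  intros Ht Hs.
  pose proof (tidx_cv t ltac:(lra)) as Hi. pose proof (tidx_cv s ltac:(lra)) as Hj.
  apply (ucv_le
    (fun k => Rabs (sch (mesh k) (idx (tau k) t) y - sch (mesh k) (idx (tau k) s) z))
    (fun k => L1 * Rabs (y - z) + W1 * Rabs (INR (idx (tau k) t) * tau k - INR (idx (tau k) s) * tau k))).
  - apply ucv_abs, ucv_minus; apply U_move; auto; apply ucv_const.
  - apply ucv_plus; [apply ucv_const | now apply ucv_scal, ucv_abs, ucv_minus].
  - generalize (ultra_and _ _ (ultra_time_le _ _ (proj2 Ht) Hi) (ultra_time_le _ _ (proj2 Hs) Hj)).
    apply ultra_imp. intros k [H1 H2].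
    pose proof (sch_time_abs (mesh k) (idx (tau k) s) (idx (tau k) t) z (mesh_pos k) H2 H1) as H3.
    pose proof (scheme_lip f g c0 L Tm Hc0 HL Hf Hg (mesh k) (idx (tau k) t) z y (mesh_pos k) H1) as H4.
    fold (tau k) in H3.
    replace (sch (mesh k) (idx (tau k) t) y - sch (mesh k) (idx (tau k) s) z) with
     ((sch (mesh k) (idx (tau k) t) y - sch (mesh k) (idx (tau k) t) z) +
      (sch (mesh k) (idx (tau k) t) z - sch (mesh k) (idx (tau k) s) z)) by ring.
    eapply Rle_trans; [apply Rabs_triang |]. unfold slope_bound. lra.
Qed.

Lemma P_move_aux (zk : nat -> R) (nk : nat -> nat) (z t : R) : 0 <= t <= Tm ->
  ucv zk z -> ucv (fun k => INR (nk k) * tau k) t ->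
  exists p, ucv (fun k => dp (mesh k) (nk k) (zk k)) p /\ Rabs p <= L1 /\
    forall d, 0 < d -> Rabs (sol_U (z + d) t - sol_U z t - d * p) <= B1 * d ^ 2.
Proof.
  intros Ht Hz Hn.
  pose proof (ultra_time_le _ _ (proj2 Ht) Hn) as Hnb.
  assert (Hb : ultra (fun k => Rabs (dp (mesh k) (nk k) (zk k)) <= L1)).
  { revert Hnb. apply ultra_imp. intros k Hk. apply dp_bound; auto. apply mesh_pos. }
  pose proof (ulim_cv _ _ Hb) as Hp.
  eexists. split; [exact Hp | split].
  { apply (ucv_le (fun k => Rabs (dp (mesh k) (nk k) (zk k))) (fun _ => L1));
    [now apply ucv_abs | apply ucv_const | exact Hb]. }
  intros d Hd.
  pose proof (yidx_cv d ltac:(lra)) as Hj.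
  apply (ucv_le
    (fun k => Rabs (sch (mesh k) (nk k) (zk k + INR (idx (mesh k) d) * mesh k) - sch (mesh k) (nk k) (zk k)
       - INR (idx (mesh k) d) * mesh k * dp (mesh k) (nk k) (zk k)))
    (fun k => B1 * (INR (idx (mesh k) d) * mesh k) ^ 2)).
  - apply ucv_abs, ucv_minus; [apply ucv_minus; apply U_move; auto; now apply ucv_plus |].
    apply ucv_mult; auto.
  - apply (ucv_cont (fun x => B1 * x ^ 2)); [| exact Hj].
    apply (ex_derive_continuous (fun x => B1 * x ^ 2)). auto_derive. exact I.
  - revert Hnb. apply ultra_imp. intros k Hk. apply sch_taylor; auto. apply mesh_pos.
Qed.

(** Every limit of slopes is the first Taylor coefficient of [sol_U] at [z]. Two candidates differ
    by at most [2 * B1 * d] for every [d], so the limit does not depend on the approach. *)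
Lemma P_move (zk : nat -> R) (nk : nat -> nat) (z t : R) : 0 <= t <= Tm ->
  ucv zk z -> ucv (fun k => INR (nk k) * tau k) t ->
  ucv (fun k => dp (mesh k) (nk k) (zk k)) (sol_P z t).
Proof.
  intros Ht Hz Hn.
  destruct (P_move_aux zk nk z t Ht Hz Hn) as [p [Hp [_ Hpt]]].
  destruct (P_move_aux (fun _ => z) (fun k => idx (tau k) t) z t Ht (ucv_const z) (tidx_cv t ltac:(lra)))
    as [p' [Hp' [Hb' Hpt']]].
  assert (Hlim : sol_P z t = p').
  { apply (ucv_unique (fun k => dp (mesh k) (idx (tau k) t) z)); [| exact Hp'].
    apply ulim_cv with (L1 + 1). generalize (Hp' 1 Rlt_0_1). apply ultra_imp. intros k Hk.
    apply Rabs_def2 in Hk. apply Rabs_le_between in Hb'. apply Rabs_le. lra. }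
  rewrite Hlim. replace p' with p; [exact Hp |].
  apply Rminus_diag_uniq. apply NNPP. intros Hne.
  assert (Ha : 0 < Rabs (p - p')) by now apply Rabs_pos_lt.
  set (d := Rabs (p - p') / (4 * B1 + 1)).
  assert (Hd : 0 < d) by (apply Rdiv_lt_0_compat; [exact Ha | lra]).
  pose proof (Hpt d Hd) as H1. pose proof (Hpt' d Hd) as H2.
  assert (Hd' : (4 * B1 + 1) * d = Rabs (p - p')) by (unfold d; field; lra).
  assert (H3 : d * Rabs (p - p') <= 2 * B1 * d ^ 2).
  { rewrite <- (Rabs_pos_eq d) at 1 by lra. rewrite <- Rabs_mult.
    replace (d * (p - p')) with ((sol_U (z + d) t - sol_U z t - d * p') - (sol_U (z + d) t - sol_U z t - d * p)) by ring.
    unfold Rminus at 1. eapply Rle_trans; [apply Rabs_triang |]. rewrite Rabs_Ropp. lra. }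
  nra.
Qed.

Lemma P_bound (z t : R) : 0 <= t <= Tm -> Rabs (sol_P z t) <= L1.
Proof.
  intros Ht.
  destruct (P_move_aux (fun _ => z) (fun k => idx (tau k) t) z t Ht (ucv_const z) (tidx_cv t ltac:(lra)))
    as [p [Hp [Hb _]]].
  replace (sol_P z t) with p; [exact Hb |].
  apply (ucv_unique (fun k => dp (mesh k) (idx (tau k) t) z)); [exact Hp |].
  apply P_move; auto; [apply ucv_const | apply tidx_cv; lra].
Qed.

Lemma U_taylor (z t d : R) : 0 <= t <= Tm -> 0 < d ->
  Rabs (sol_U (z + d) t - sol_U z t - d * sol_P z t) <= B1 * d ^ 2.
Proof.
  intros Ht Hd.
  destruct (P_move_aux (fun _ => z) (fun k => idx (tau k) t) z t Ht (ucv_const z) (tidx_cv t ltac:(lra)))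
    as [p [Hp [_ Hpt]]].
  replace (sol_P z t) with p; [now apply Hpt |].
  apply (ucv_unique (fun k => dp (mesh k) (idx (tau k) t) z)); [exact Hp |].
  apply P_move; auto; [apply ucv_const | apply tidx_cv; lra].
Qed.

Lemma ultra_time_ge (nk : nat -> nat) (t theta : R) : theta < t < Tm ->
  ucv (fun k => INR (nk k) * tau k) t -> ultra (fun k => theta <= INR (nk k) * tau k <= Tm).
Proof.
  intros Ht H.
  assert (Hm : 0 < Rmin (t - theta) (Tm - t)) by (apply Rmin_glb_lt; lra).
  generalize (H _ Hm). apply ultra_imp. intros k Hk. apply Rabs_def2 in Hk.
  pose proof (Rmin_l (t - theta) (Tm - t)). pose proof (Rmin_r (t - theta) (Tm - t)). lra.
Qed.

Lemma W_cv (z t : R) : 0 < t < Tm ->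
  ucv (fun k => dt (mesh k) (idx (tau k) t) z) (sol_W z t) /\ Rabs (sol_W z t) <= W1.
Proof.
  intros Ht.
  pose proof (ultra_time_le _ t ltac:(lra) (tidx_cv t ltac:(lra))) as Hi.
  assert (Hb : ultra (fun k => Rabs (dt (mesh k) (idx (tau k) t) z) <= W1)).
  { revert Hi. apply ultra_imp. intros k Hk. apply dt_bound; auto. apply mesh_pos. }
  pose proof (ulim_cv _ _ Hb) as H. split; [exact H |].
  apply (ucv_le (fun k => Rabs (dt (mesh k) (idx (tau k) t) z)) (fun _ => W1));
    [now apply ucv_abs | apply ucv_const | exact Hb].
Qed.

Lemma f_continuous (x : R) : continuous f x.
Proof.
  apply filterlim_locally. intros eps.
  exists (mkposreal (eps / (c0 + 1)) ltac:(apply Rdiv_lt_0_compat; [apply cond_pos | lra])).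
  intros y Hy. change (Rabs (f y - f x) < eps). change (Rabs (y - x) < eps / (c0 + 1)) in Hy.
  eapply Rle_lt_trans; [apply Hf |].
  apply (Rmult_lt_compat_r (c0 + 1)) in Hy; [| lra].
  replace (eps / (c0 + 1) * (c0 + 1)) with (pos eps) in Hy by (field; lra).
  pose proof (Rabs_pos (y - x)). lra.
Qed.

Lemma atan_continuous (x : R) : continuous atan x.
Proof. apply (ex_derive_continuous atan). eexists. apply is_derive_atan_comp. Qed.

Lemma P_taylor (theta : R) : 0 < theta -> exists C, 0 <= C /\ forall z t d, theta < t < Tm -> 0 < d ->
  Rabs (atan (sol_P (z + d) t) - atan (sol_P z t) - d * (sol_W z t + f (sol_U z t))) <= C * d ^ 2.
Proof.
  intros Hth.
  destruct (flux_taylor f g c0 F L K Tm Hc0 HF HL HK HT0 Hf HfF Hg Hg2 theta Hth) as [C [h1 [HC [Hh1 H]]]].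
  exists C. split; [exact HC |]. intros z t d Ht Hd.
  pose proof (tidx_cv t ltac:(lra)) as Hi. pose proof (yidx_cv d ltac:(lra)) as Hj.
  apply (ucv_le
    (fun k => Rabs (atan (dp (mesh k) (idx (tau k) t) (z + INR (idx (mesh k) d) * mesh k))
        - atan (dp (mesh k) (idx (tau k) t) z)
        - INR (idx (mesh k) d) * mesh k * (dt (mesh k) (idx (tau k) t) z + f (sch (mesh k) (idx (tau k) t) z))))
    (fun k => C * (INR (idx (mesh k) d) * mesh k) ^ 2)).
  - apply ucv_abs, ucv_minus; [apply ucv_minus |].
    + apply (ucv_cont atan); [apply atan_continuous |]. apply P_move; auto; [lra |].
      apply ucv_plus; [apply ucv_const | exact Hj].
    + apply (ucv_cont atan); [apply atan_continuous |]. apply P_move; auto; [lra | apply ucv_const].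
    + apply ucv_mult; [exact Hj |]. apply ucv_plus; [apply W_cv; lra |].
      apply (ucv_cont f); [apply f_continuous |]. apply U_move; auto; [lra | apply ucv_const].
  - apply (ucv_cont (fun x => C * x ^ 2)); [| exact Hj].
    apply (ex_derive_continuous (fun x => C * x ^ 2)). auto_derive. exact I.
  - generalize (ultra_and _ _ (ultra_time_ge _ t theta Ht Hi) (ultra_mesh_lt h1 (proj1 Hh1))).
    apply ultra_imp. intros k [H1 H2]. apply H; [split; [apply mesh_pos | lra] | exact H1].
Qed.

(** Interpolation: values move little in time, and over the distance [e] they determine the slope up
    to an error of order [e]. With [e] of order [sqrt delta] this is a Hoelder modulus in time. *)
Lemma dp_time (h e delta : R) (n m i : nat) (z : R) : 0 < h -> e = INR i * h -> 0 < e ->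
  INR n * (h ^ 2 / 4) <= Tm + 1 -> INR m * (h ^ 2 / 4) <= Tm + 1 ->
  Rabs (INR m * (h ^ 2 / 4) - INR n * (h ^ 2 / 4)) <= delta ->
  e * Rabs (dp h m z - dp h n z) <= 2 * W1 * delta + 2 * B1 * e ^ 2.
Proof.
  intros Hh He He0 Hn Hm Hd.
  pose proof (sch_time_abs h n m z Hh Hn Hm) as S1.
  pose proof (sch_time_abs h n m (z + e) Hh Hn Hm) as S2.
  apply (Rmult_le_compat_l W1) in Hd; [| exact W1_pos].
  pose proof (sch_taylor f g c0 F L K Tm Hc0 HF HL HK HT0 Hf HfF Hg Hg2 h n i z Hh Hn) as T1.
  pose proof (sch_taylor f g c0 F L K Tm Hc0 HF HL HK HT0 Hf HfF Hg Hg2 h m i z Hh Hm) as T2.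
  rewrite <- He in T1, T2.
  rewrite <- (Rabs_pos_eq e) at 1 by lra. rewrite <- Rabs_mult.
  apply Rabs_le_between in S1. apply Rabs_le_between in S2.
  apply Rabs_le_between in T1. apply Rabs_le_between in T2.
  apply Rabs_le. split; lra.
Qed.

Lemma lattice_half (h d : R) : 0 < h <= d / 2 -> exists j : nat, d / 2 <= INR j * h <= d.
Proof.
  intros Hh. exists (idx h d). pose proof (idx_spec h d ltac:(lra) ltac:(lra)). lra.
Qed.

(** The same interpolation one level higher: the time quotient plus reaction is the Taylor
    coefficient of the flux, whose continuity in time comes from [dp_time]. *)
Lemma dt_time (theta eps : R) : 0 < theta -> 0 < eps -> exists delta h1, 0 < delta /\ 0 < h1 /\
  forall h n m z, 0 < h <= h1 -> theta <= INR n * (h ^ 2 / 4) <= Tm ->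
    theta <= INR m * (h ^ 2 / 4) <= Tm ->
    Rabs (INR m * (h ^ 2 / 4) - INR n * (h ^ 2 / 4)) <= delta ->
    Rabs (dt h m z - dt h n z) <= eps.
Proof.
  intros Hth Heps.
  destruct (flux_taylor f g c0 F L K Tm Hc0 HF HL HK HT0 Hf HfF Hg Hg2 theta Hth) as [C [h1 [HC [Hh1 H]]]].
  (* For a lattice distance [d] in [[d0 / 2, d0]] the Taylor errors use [d * eps / 4]. The sizes of
     [e0] and [delta] keep each of the two flux changes below [eps * d0 / 8], together at most
     [d * eps / 2], and the reaction takes the last quarter. *)
  set (d0 := eps / (8 * C + 1)).
  assert (Hd0 : 0 < d0) by (apply Rdiv_lt_0_compat; lra).
  assert (Hd0' : 8 * C * d0 <= eps).
  { assert ((8 * C + 1) * d0 = eps) by (unfold d0; field; lra). nra. }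
  set (e0 := eps * d0 / (32 * B1 + 1)).
  assert (Hed : 0 < eps * d0) by now apply Rmult_lt_0_compat.
  assert (He0 : 0 < e0) by (apply Rdiv_lt_0_compat; lra).
  assert (He0' : 32 * B1 * e0 <= eps * d0).
  { assert ((32 * B1 + 1) * e0 = eps * d0) by (unfold e0; field; lra). nra. }
  set (delta := Rmin (eps * d0 * e0 / (64 * W1 + 1)) (eps / (4 * c0 * W1 + 1))).
  assert (Hc : 0 <= c0 * W1) by now apply Rmult_le_pos.
  assert (Hede : 0 < eps * d0 * e0) by now apply Rmult_lt_0_compat.
  assert (Hdelta : 0 < delta) by (apply Rmin_glb_lt; apply Rdiv_lt_0_compat; lra).
  assert (Hdl1 : 64 * W1 * delta <= eps * d0 * e0).
  { assert (delta <= eps * d0 * e0 / (64 * W1 + 1)) by apply Rmin_l.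
    apply (Rmult_le_compat_l (64 * W1 + 1)) in H0; [| lra].
    replace ((64 * W1 + 1) * (eps * d0 * e0 / (64 * W1 + 1))) with (eps * d0 * e0) in H0 by (field; lra). lra. }
  assert (Hdl2 : 4 * (c0 * W1) * delta <= eps).
  { assert (delta <= eps / (4 * c0 * W1 + 1)) by apply Rmin_r.
    apply (Rmult_le_compat_l (4 * c0 * W1 + 1)) in H0; [| lra].
    replace ((4 * c0 * W1 + 1) * (eps / (4 * c0 * W1 + 1))) with eps in H0 by (field; lra). lra. }
  exists delta, (Rmin h1 (Rmin (d0 / 2) (e0 / 2))).
  split; [exact Hdelta | split; [repeat apply Rmin_glb_lt; lra |]].
  intros h n m z [Hh Hhm] Hn Hm Hnm.
  assert (h <= h1) by (eapply Rle_trans; [exact Hhm | apply Rmin_l]).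
  assert (h <= d0 / 2) by (eapply Rle_trans; [exact Hhm | eapply Rle_trans; [apply Rmin_r | apply Rmin_l]]).
  assert (h <= e0 / 2) by (eapply Rle_trans; [exact Hhm | eapply Rle_trans; [apply Rmin_r | apply Rmin_r]]).
  destruct (lattice_half h d0 ltac:(lra)) as [j Hj]. destruct (lattice_half h e0 ltac:(lra)) as [i Hi].
  set (d := INR j * h) in *. set (e := INR i * h) in *.
  assert (HQ : forall x, Rabs (atan (dp h m x) - atan (dp h n x)) <= eps * d0 / 8).
  { intros x. eapply Rle_trans; [apply atan_lip |].
    pose proof (dp_time h e delta n m i x Hh eq_refl ltac:(lra) ltac:(lra) ltac:(lra) Hnm) as Q.
    apply Rmult_le_reg_l with e; [lra |]. eapply Rle_trans; [exact Q |].
    assert (2 * B1 * e ^ 2 <= eps * d0 / 16 * e).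
    { replace (2 * B1 * e ^ 2) with (2 * B1 * e * e) by ring. apply Rmult_le_compat_r; [lra |]. nra. }
    assert (2 * W1 * delta <= eps * d0 / 16 * e).
    { apply Rle_trans with (eps * d0 * e0 / 32); [lra |].
      replace (eps * d0 * e0 / 32) with (eps * d0 / 16 * (e0 / 2)) by field.
      apply Rmult_le_compat_l; lra. }
    lra. }
  pose proof (H h n z j ltac:(lra) Hn) as T1. pose proof (H h m z j ltac:(lra) Hm) as T2. fold d in T1, T2.
  pose proof (HQ z) as Q1. pose proof (HQ (z + d)) as Q2.
  pose proof (sch_time_abs h n m z Hh ltac:(lra) ltac:(lra)) as S1.
  pose proof (Hf (sch h m z) (sch h n z)) as F1.
  assert (F2 : Rabs (f (sch h m z) - f (sch h n z)) <= eps / 4).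
  { eapply Rle_trans; [exact F1 |]. apply Rle_trans with (c0 * (W1 * delta)); [| lra].
    apply Rmult_le_compat_l; [lra |]. eapply Rle_trans; [exact S1 |]. apply Rmult_le_compat_l; lra. }
  apply Rmult_le_reg_l with d; [lra |].
  rewrite <- (Rabs_pos_eq d) at 1 by lra. rewrite <- Rabs_mult.
  apply Rabs_le_between in T1. apply Rabs_le_between in T2. apply Rabs_le_between in Q1.
  apply Rabs_le_between in Q2. apply Rabs_le_between in F2.
  assert (Hdd : 2 * (C * d ^ 2) <= d * (eps / 4)).
  { replace (2 * (C * d ^ 2)) with (d * (2 * C * d)) by ring. apply Rmult_le_compat_l; [lra |]. nra. }
  assert (Hdf : - (d * (eps / 4)) <= d * (f (sch h m z) - f (sch h n z)) <= d * (eps / 4)) by nra.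
  assert (Hq : eps * d0 / 8 <= d * (eps / 4)) by nra.
  apply Rabs_le. split; lra.
Qed.

Lemma sch_telescope (h eps w0 : R) (n m : nat) (z : R) : 0 < h -> (n <= m)%nat ->
  (forall i, (n <= i <= m)%nat -> Rabs (dt h i z - w0) <= eps) ->
  Rabs (sch h m z - sch h n z - (INR m * (h ^ 2 / 4) - INR n * (h ^ 2 / 4)) * w0)
    <= eps * (INR m * (h ^ 2 / 4) - INR n * (h ^ 2 / 4)).
Proof.
  intros Hh Hnm. induction Hnm as [| m Hnm IH]; intros H.
  - rewrite !Rminus_diag, Rmult_0_l, Rminus_diag, Rabs_R0. lra.
  - assert (Ht : 0 < h ^ 2 / 4) by nra.
    specialize (IH ltac:(intros i Hi; apply H; lia)). specialize (H m ltac:(lia)).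
    rewrite S_INR.
    replace (sch h (S m) z - sch h n z - ((INR m + 1) * (h ^ 2 / 4) - INR n * (h ^ 2 / 4)) * w0) with
     ((sch h m z - sch h n z - (INR m * (h ^ 2 / 4) - INR n * (h ^ 2 / 4)) * w0) + h ^ 2 / 4 * (dt h m z - w0))
      by (unfold time_quotient; field; lra).
    eapply Rle_trans; [apply Rabs_triang |]. rewrite Rabs_mult, (Rabs_pos_eq (h ^ 2 / 4)) by lra. nra.
Qed.

(** An increment of the scheme in time is a sum of time quotients, all of them within [eps] of the
    one at [t] by [dt_time], uniformly in the mesh. *)
Lemma U_is_derive_t (z t : R) : 0 < t < Tm -> is_derive (fun s => sol_U z s) t (sol_W z t).
Proof.
  intros Ht. apply is_derive_approx. intros eps Heps.
  destruct (dt_time (t / 4) eps ltac:(lra) Heps) as [delta [h1 [Hdelta [Hh1 H]]]].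
  set (r := Rmin (delta / 2) (Rmin (t / 2) (Tm - t))).
  assert (Hr : 0 < r) by (unfold r; repeat apply Rmin_glb_lt; lra).
  assert (Hr1 : r <= delta / 2) by apply Rmin_l.
  assert (Hr2 : r <= t / 2) by (eapply Rle_trans; [apply Rmin_r | apply Rmin_l]).
  assert (Hr3 : r <= Tm - t) by (eapply Rle_trans; [apply Rmin_r | apply Rmin_r]).
  exists r. split; [exact Hr |]. intros x Hx. apply Rabs_def2 in Hx.
  assert (Hgen : forall t1 t2, t / 2 < t1 -> t1 <= t2 -> t2 < Tm -> t2 - t1 <= delta / 2 -> t1 <= t <= t2 ->
    Rabs (sol_U z t2 - sol_U z t1 - (t2 - t1) * sol_W z t) <= eps * (t2 - t1)).
  { intros t1 t2 H1 H2 H3 H4 H5.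
    pose proof (tidx_cv t1 ltac:(lra)) as I1. pose proof (tidx_cv t2 ltac:(lra)) as I2.
    pose proof (tidx_cv t ltac:(lra)) as I0.
    apply (ucv_le
      (fun k => Rabs (sch (mesh k) (idx (tau k) t2) z - sch (mesh k) (idx (tau k) t1) z
         - (INR (idx (tau k) t2) * tau k - INR (idx (tau k) t1) * tau k) * dt (mesh k) (idx (tau k) t) z))
      (fun k => eps * (INR (idx (tau k) t2) * tau k - INR (idx (tau k) t1) * tau k))).
    - apply ucv_abs, ucv_minus; [apply ucv_minus; apply U_move; auto; try lra; apply ucv_const |].
      apply ucv_mult; [now apply ucv_minus | now apply W_cv].
    - now apply ucv_scal, ucv_minus.
    - generalize (ultra_and _ _ (ultra_mesh_lt h1 Hh1)
        (ultra_and _ _ (ultra_mesh_lt (delta / 2) ltac:(lra)) (ultra_mesh_lt (t / 4) ltac:(lra)))).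
      apply ultra_imp. intros k [K1 [K2 K3]].
      pose proof (tau_pos k) as Tp. pose proof (tau_le_mesh k) as Tm'.
      pose proof (idx_spec (tau k) t1 Tp ltac:(lra)) as S1.
      pose proof (idx_spec (tau k) t2 Tp ltac:(lra)) as S2.
      pose proof (idx_spec (tau k) t Tp ltac:(lra)) as S0.
      assert (Hmono : forall a b, 0 <= a <= b -> (idx (tau k) a <= idx (tau k) b)%nat).
      { intros a b Hab. pose proof (idx_spec (tau k) a Tp ltac:(lra)) as Sa.
        pose proof (idx_spec (tau k) b Tp ltac:(lra)) as Sb.
        apply Nat.lt_succ_r, INR_lt. rewrite S_INR. nra. }
      apply (sch_telescope (mesh k)); [apply mesh_pos | apply Hmono; lra |].
      intros i [Hi1 Hi2]. apply le_INR in Hi1. apply le_INR in Hi2.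
      apply (Rmult_le_compat_r (tau k)) in Hi1; [| lra]. apply (Rmult_le_compat_r (tau k)) in Hi2; [| lra].
      apply H; [split; [apply mesh_pos | lra] | | |]; fold (tau k).
      + lra.
      + lra.
      + apply Rabs_le. lra. }
  destruct (Rle_lt_dec 0 x) as [Hx0 | Hx0].
  - pose proof (Hgen t (t + x) ltac:(lra) ltac:(lra) ltac:(lra) ltac:(lra) ltac:(lra)) as G.
    replace (t + x - t) with x in G by ring. rewrite (Rabs_pos_eq x) by lra. exact G.
  - pose proof (Hgen (t + x) t ltac:(lra) ltac:(lra) ltac:(lra) ltac:(lra) ltac:(lra)) as G.
    replace (t - (t + x)) with (- x) in G by ring. rewrite (Rabs_left x) by lra.
    rewrite <- Rabs_Ropp.
    replace (- (sol_U z (t + x) - sol_U z t - x * sol_W z t)) with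
      (sol_U z t - sol_U z (t + x) - - x * sol_W z t) by ring. exact G.
Qed.

Lemma U_is_derive_y (z t : R) : 0 <= t <= Tm -> is_derive (fun y => sol_U y t) z (sol_P z t).
Proof.
  intros Ht. apply (taylor_is_derive (fun y => sol_U y t) (fun y => sol_P y t) B1).
  intros y d Hd. now apply U_taylor.
Qed.

(** Only the flux [atan (sol_P)] has a Taylor expansion; the slope is recovered by composing with
    [tan]. *)
Lemma P_is_derive_y (z t : R) : 0 < t < Tm ->
  is_derive (fun y => sol_P y t) z ((1 + sol_P z t ^ 2) * (sol_W z t + f (sol_U z t))).
Proof.
  intros Ht. destruct (P_taylor (t / 2) ltac:(lra)) as [C [HC H]].
  assert (Ha : is_derive (fun y => atan (sol_P y t)) z (sol_W z t + f (sol_U z t))).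
  { apply (taylor_is_derive (fun y => atan (sol_P y t)) (fun y => sol_W y t + f (sol_U y t)) C).
    intros y d Hd. apply H; lra. }
  apply (is_derive_ext (fun y => tan (atan (sol_P y t)))); [intros y; apply tan_atan |].
  rewrite Rmult_comm.
  apply (is_derive_comp tan (fun y => atan (sol_P y t)) z); [| exact Ha].
  rewrite <- (tan_atan (sol_P z t)) at 2. rewrite Rplus_comm.
  apply is_derive_tan. pose proof (atan_bound (sol_P z t)).
  apply Rgt_not_eq, cos_gt_0; lra.
Qed.

Lemma U_continuity_2d (z t : R) : 0 < t < Tm -> continuity_2d_pt sol_U z t.
Proof.
  intros Ht eps. pose proof (cond_pos eps) as He.
  assert (Hm : 0 < Rmin (eps / (L1 + W1 + 1)) (Rmin t (Tm - t))).
  { repeat apply Rmin_glb_lt; try lra. apply Rdiv_lt_0_compat; lra. }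
  exists (mkposreal _ Hm). simpl. intros y s Hy Hs.
  pose proof (Rmin_l (eps / (L1 + W1 + 1)) (Rmin t (Tm - t))).
  pose proof (Rmin_r (eps / (L1 + W1 + 1)) (Rmin t (Tm - t))).
  pose proof (Rmin_l t (Tm - t)). pose proof (Rmin_r t (Tm - t)).
  pose proof (Rabs_def2 _ _ Hs).
  eapply Rle_lt_trans; [apply U_lip; lra |].
  set (q := eps / (L1 + W1 + 1)) in *.
  assert (Hq : (L1 + W1 + 1) * q = eps) by (unfold q; field; lra).
  pose proof (Rabs_pos (y - z)). pose proof (Rabs_pos (s - t)).
  assert (0 < q) by lra. nra.
Qed.

Lemma P_continuity_2d (z t : R) : 0 < t < Tm -> continuity_2d_pt sol_P z t.
Proof.
  intros Ht.
  apply (taylor_continuity_2d sol_U sol_P B1 z t (Rmin t (Tm - t))).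
  - apply Rmin_glb_lt; lra.
  - intros y s d Hs Hd. apply Rabs_def2 in Hs.
    pose proof (Rmin_l t (Tm - t)). pose proof (Rmin_r t (Tm - t)).
    apply U_taylor; lra.
  - intros y. now apply U_continuity_2d.
Qed.

(** [sol_W] plus the reaction is the Taylor coefficient of the flux, so its joint continuity follows
    from that of [sol_P]. *)
Lemma W_continuity_2d (z t : R) : 0 < t < Tm -> continuity_2d_pt sol_W z t.
Proof.
  intros Ht. destruct (P_taylor (t / 2) ltac:(lra)) as [C [HC H]].
  apply continuity_2d_pt_ext with (fun y s => (sol_W y s + f (sol_U y s)) - f (sol_U y s)); [intros; ring |].
  apply continuity_2d_pt_minus.
  - apply (taylor_continuity_2d (fun y s => atan (sol_P y s)) (fun y s => sol_W y s + f (sol_U y s)) C z t (Rmin (t / 2) (Tm - t))).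
    + apply Rmin_glb_lt; lra.
    + intros y s d Hs Hd. apply Rabs_def2 in Hs.
      pose proof (Rmin_l (t / 2) (Tm - t)). pose proof (Rmin_r (t / 2) (Tm - t)).
      apply H; lra.
    + intros y. apply continuity_1d_2d_pt_comp; [| now apply P_continuity_2d].
      apply continuity_pt_filterlim, atan_continuous.
  - apply continuity_1d_2d_pt_comp; [| now apply U_continuity_2d].
    apply continuity_pt_filterlim, f_continuous.
Qed.

Theorem truncated_existence : exists (U : R -> R -> R) (C : R),
  (forall y, U y 0 = g y) /\
  (forall y z t s, 0 <= t <= Tm -> 0 <= s <= Tm -> Rabs (U y t - U z s) <= C * (Rabs (y - z) + Rabs (t - s))) /\
  (forall y t, 0 < t < Tm -> C21_at U y t /\
     u_t U y t = u_yy U y t / (1 + u_y U y t ^ 2) - f (U y t) /\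
     Rabs (u_y U y t) <= C /\ Rabs (u_yy U y t) <= C).
Proof.
  set (C := L1 + W1 + (1 + L1 ^ 2) * (W1 + F)).
  assert (HC0 : 0 <= (1 + L1 ^ 2) * (W1 + F)) by (pose proof (one_plus_sqr_pos L1); nra).
  exists sol_U, C. split; [| split].
  - intros y. apply (ucv_unique (fun k => sch (mesh k) 0 y)); [| exact (ucv_const (g y))].
    apply (U_move (fun _ => y) (fun _ => 0%nat)); [lra | apply ucv_const |].
    apply ucv_ext with (fun _ => 0); [intros; simpl; ring | apply ucv_const].
  - intros y z t s Ht Hs. eapply Rle_trans; [now apply U_lip |].
    pose proof (Rabs_pos (y - z)). pose proof (Rabs_pos (t - s)). unfold C. nra.
  - intros y t Ht.
    assert (Et : forall z s, 0 < s < Tm -> u_t sol_U z s = sol_W z s)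
      by (intros z s Hs; now apply is_derive_unique, U_is_derive_t).
    assert (Ey : forall z s, 0 < s < Tm -> u_y sol_U z s = sol_P z s)
      by (intros z s Hs; apply is_derive_unique, U_is_derive_y; lra).
    assert (Eyy : forall z s, 0 < s < Tm -> u_yy sol_U z s = (1 + sol_P z s ^ 2) * (sol_W z s + f (sol_U z s))).
    { intros z s Hs. unfold u_yy. simpl. rewrite (Derive_ext _ (fun x => sol_P x s)).
      - now apply is_derive_unique, P_is_derive_y.
      - intros x. now apply Ey. }
    assert (Hloc : forall Q : R -> R -> Prop, (forall z s, 0 < s < Tm -> Q z s) -> locally_2d Q y t).
    { intros Q HQ. assert (Hm : 0 < Rmin t (Tm - t)) by (apply Rmin_glb_lt; lra).
      exists (mkposreal _ Hm). simpl. intros z s _ Hs. apply Rabs_def2 in Hs.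
      pose proof (Rmin_l t (Tm - t)). pose proof (Rmin_r t (Tm - t)). apply HQ; lra. }
    rewrite Et, Ey, Eyy by exact Ht.
    pose proof (P_bound y t ltac:(lra)) as PB. destruct (W_cv y t Ht) as [_ WB].
    split; [| split; [| split]].
    + repeat split.
      * eexists. now apply U_is_derive_t.
      * eexists. apply U_is_derive_y. lra.
      * apply (ex_derive_ext (fun z => sol_P z t)); [intros z; symmetry; now apply Ey |].
        eexists. now apply P_is_derive_y.
      * apply (continuity_2d_pt_filterlim (u_t sol_U)).
        apply continuity_2d_pt_ext_loc with sol_W; [| now apply W_continuity_2d].
        apply Hloc. intros z s Hs. symmetry. now apply Et.
      * apply (continuity_2d_pt_filterlim (u_y sol_U)).
        apply continuity_2d_pt_ext_loc with sol_P; [| now apply P_continuity_2d].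
        apply Hloc. intros z s Hs. symmetry. now apply Ey.
      * apply (continuity_2d_pt_filterlim (u_yy sol_U)).
        apply continuity_2d_pt_ext_loc with (fun z s => (1 + sol_P z s * sol_P z s) * (sol_W z s + f (sol_U z s))).
        -- apply Hloc. intros z s Hs. rewrite Eyy by exact Hs. simpl. now rewrite Rmult_1_r.
        -- apply continuity_2d_pt_mult.
           ++ apply continuity_2d_pt_plus; [apply continuity_2d_pt_const |].
              apply continuity_2d_pt_mult; now apply P_continuity_2d.
           ++ apply continuity_2d_pt_plus; [now apply W_continuity_2d |].
              apply continuity_1d_2d_pt_comp; [| now apply U_continuity_2d].
              apply continuity_pt_filterlim, f_continuous.
    + field. pose proof (one_plus_sqr_pos (sol_P y t)). lra.
    + unfold C. lra.
    + rewrite Rabs_mult, (Rabs_pos_eq (1 + sol_P y t ^ 2)) by (left; apply one_plus_sqr_pos).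
      apply Rle_trans with ((1 + L1 ^ 2) * (W1 + F)); [| unfold C; lra].
      apply Rmult_le_compat; [left; apply one_plus_sqr_pos | apply Rabs_pos | |].
      * apply Rplus_le_compat_l. rewrite <- (pow2_abs (sol_P y t)). apply pow_incr.
        split; [apply Rabs_pos | exact PB].
      * eapply Rle_trans; [apply Rabs_triang |]. pose proof (HfF (sol_U y t)). lra.
Qed.

End Existence.

(** * Continuity on rectangles and calculus of jets *)

Lemma cont_rect_const (c a b t0 t1 : R) : cont_rect (fun _ _ => c) a b t0 t1.
Proof.
  intros y t _ _ e He. exists 1. split; [lra |]. intros. now rewrite Rminus_diag, Rabs_R0.
Qed.

Lemma cont_rect_y (g : R -> R) (a b t0 t1 : R) :
  (forall y, a <= y <= b -> continuous g y) -> cont_rect (fun y _ => g y) a b t0 t1.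
Proof.
  intros Hg y t Hy _ e He.
  destruct (proj1 (filterlim_locally _ _) (Hg y Hy) (mkposreal e He)) as [d Hd].
  exists d. split; [apply cond_pos |]. intros z s _ _ Hz _. now apply Hd.
Qed.

Lemma cont_rect_t (g : R -> R) (a b t0 t1 : R) :
  (forall t, t0 <= t <= t1 -> continuous g t) -> cont_rect (fun _ t => g t) a b t0 t1.
Proof.
  intros Hg y t _ Ht e He.
  destruct (proj1 (filterlim_locally _ _) (Hg t Ht) (mkposreal e He)) as [d Hd].
  exists d. split; [apply cond_pos |]. intros z s _ _ _ Hs. now apply Hd.
Qed.

Lemma cont_rect_comp2 (F : R -> R -> R) (u v : R -> R -> R) (a b t0 t1 : R) :
  (forall x y, continuity_2d_pt F x y) -> cont_rect u a b t0 t1 -> cont_rect v a b t0 t1 ->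
  cont_rect (fun y t => F (u y t) (v y t)) a b t0 t1.
Proof.
  intros HF Hu Hv y t Hy Ht e He.
  destruct (HF (u y t) (v y t) (mkposreal e He)) as [d Hd]. simpl in Hd.
  destruct (Hu y t Hy Ht d (cond_pos d)) as [d1 [H1 H1']].
  destruct (Hv y t Hy Ht d (cond_pos d)) as [d2 [H2 H2']].
  exists (Rmin d1 d2). split; [now apply Rmin_glb_lt |].
  intros z s Hz Hs Hzy Hst. pose proof (Rmin_l d1 d2). pose proof (Rmin_r d1 d2).
  apply Hd; [apply H1' | apply H2']; auto; lra.
Qed.

Lemma cont_rect_minus (u v : R -> R -> R) (a b t0 t1 : R) :
  cont_rect u a b t0 t1 -> cont_rect v a b t0 t1 -> cont_rect (fun y t => u y t - v y t) a b t0 t1.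
Proof.
  apply (cont_rect_comp2 Rminus). intros x y.
  apply (continuity_2d_pt_minus (fun x _ => x) (fun _ y => y));
    [apply continuity_2d_pt_id1 | apply continuity_2d_pt_id2].
Qed.

Lemma cont_rect_plus (u v : R -> R -> R) (a b t0 t1 : R) :
  cont_rect u a b t0 t1 -> cont_rect v a b t0 t1 -> cont_rect (fun y t => u y t + v y t) a b t0 t1.
Proof.
  apply (cont_rect_comp2 Rplus). intros x y.
  apply (continuity_2d_pt_plus (fun x _ => x) (fun _ y => y));
    [apply continuity_2d_pt_id1 | apply continuity_2d_pt_id2].
Qed.

Lemma cont_rect_mult (u v : R -> R -> R) (a b t0 t1 : R) :
  cont_rect u a b t0 t1 -> cont_rect v a b t0 t1 -> cont_rect (fun y t => u y t * v y t) a b t0 t1.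
Proof.
  apply (cont_rect_comp2 Rmult). intros x y.
  apply (continuity_2d_pt_mult (fun x _ => x) (fun _ y => y));
    [apply continuity_2d_pt_id1 | apply continuity_2d_pt_id2].
Qed.

Lemma jet_intro (u : R -> R -> R) (u1 : R -> R) (y t d q r : R) : 0 < r ->
  is_derive (fun s => u y s) t d ->
  (forall z, Rabs (z - y) < r -> is_derive (fun x => u x t) z (u1 z)) ->
  is_derive u1 y q -> jet u y t d (u1 y) q.
Proof.
  intros Hr Hd Hu1 Hq. split; [| split; [| split]].
  - exact Hd.
  - exists (mkposreal r Hr). simpl. intros z Hz. exists (u1 z). now apply Hu1.
  - apply is_derive_unique, Hu1. rewrite Rminus_diag, Rabs_R0. exact Hr.
  - apply (is_derive_ext_loc u1); [| exact Hq]. exists (mkposreal r Hr). intros z Hz.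
    symmetry. apply is_derive_unique, Hu1. exact Hz.
Qed.

Lemma jet_derive_loc (u : R -> R -> R) (y t d p q : R) : jet u y t d p q ->
  exists r, 0 < r /\ (forall z, Rabs (z - y) < r -> is_derive (fun x => u x t) z (Derive (fun x => u x t) z)).
Proof.
  intros [_ [[r Hr] _]]. exists r. split; [apply cond_pos |]. intros z Hz. now apply Derive_correct, Hr.
Qed.

Lemma jet_lin (a b : R) (u v : R -> R -> R) (y t d p q d' p' q' : R) :
  jet u y t d p q -> jet v y t d' p' q' ->
  jet (fun z s => a * u z s + b * v z s) y t (a * d + b * d') (a * p + b * p') (a * q + b * q').
Proof.
  intros Hu Hv.
  destruct (jet_derive_loc _ _ _ _ _ _ Hu) as [r [Hr Hur]].
  destruct (jet_derive_loc _ _ _ _ _ _ Hv) as [r' [Hr' Hvr]].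
  destruct Hu as [H1 [_ [H2 H3]]]. destruct Hv as [H1' [_ [H2' H3']]].
  rewrite <- H2, <- H2'.
  apply (jet_intro _ (fun z => a * Derive (fun x => u x t) z + b * Derive (fun x => v x t) z) y t _ _ (Rmin r r')).
  - now apply Rmin_glb_lt.
  - apply (is_derive_plus (fun s => a * u y s) (fun s => b * v y s)); now apply is_derive_scal.
  - intros z Hz. pose proof (Rmin_l r r'). pose proof (Rmin_r r r').
    apply (is_derive_plus (fun x => a * u x t) (fun x => b * v x t)); apply is_derive_scal;
      [apply Hur | apply Hvr]; lra.
  - apply (is_derive_plus (fun z => a * Derive (fun x => u x t) z) (fun z => b * Derive (fun x => v x t) z));
      now apply is_derive_scal.
Qed.

Lemma jet_ext (u v : R -> R -> R) (y t d p q : R) :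
  (forall z s, u z s = v z s) -> jet u y t d p q -> jet v y t d p q.
Proof.
  intros E [H1 [[r Hr] [H2 H3]]]. split; [| split; [| split]].
  - apply (is_derive_ext (fun s => u y s)); auto.
  - exists r. intros z Hz. apply (ex_derive_ext (fun x => u x t)); auto.
  - rewrite <- H2. apply Derive_ext. auto.
  - apply (is_derive_ext (fun z => Derive (fun x => u x t) z)); [| exact H3].
    intros z. apply Derive_ext. auto.
Qed.

(** The factor [exp (- lam * t)] turns [d < lam * phi] into strict decrease, which accommodates a
    Lipschitz reaction term. *)
Lemma max_principle_exp (lam : R) (phi : R -> R -> R) (a b t0 t1 : R) :
  cont_rect phi a b t0 t1 ->
  (forall y, a <= y <= b -> phi y t0 < 0) ->
  (forall t, t0 <= t <= t1 -> phi a t < 0 /\ phi b t < 0) ->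
  (forall y t, a < y < b -> t0 < t <= t1 -> 0 <= phi y t ->
     exists d p q, jet phi y t d p q /\ (p = 0 -> q <= 0 -> d < lam * phi y t)) ->
  forall y t, a <= y <= b -> t0 <= t <= t1 -> phi y t < 0.
Proof.
  intros Hc Hi Hl Hint y t Hy Ht.
  assert (He : forall s, 0 < exp (- lam * s)) by (intros; apply exp_pos).
  enough (H : exp (- lam * t) * phi y t < 0).
  { specialize (He t). nra. }
  revert y t Hy Ht.
  apply (max_principle (fun y t => exp (- lam * t) * phi y t) a b t0 t1).
  - apply (cont_rect_mult (fun _ t => exp (- lam * t)) phi); [| exact Hc].
    apply (cont_rect_t (fun t => exp (- lam * t))). intros t _.
    apply (ex_derive_continuous (fun t => exp (- lam * t))). auto_derive. exact I.
  - intros y Hy. specialize (Hi y Hy). specialize (He t0). nra.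
  - intros t Ht. specialize (Hl t Ht). specialize (He t). split; nra.
  - intros y t Hy Ht Hp.
    assert (Hp' : 0 <= phi y t) by (specialize (He t); nra).
    destruct (Hint y t Hy Ht Hp') as [d [p [q [Hj Hneg]]]].
    destruct (jet_derive_loc _ _ _ _ _ _ Hj) as [r [Hr Hur]].
    destruct Hj as [H1 [_ [H2 H3]]].
    exists (exp (- lam * t) * (d - lam * phi y t)), (exp (- lam * t) * p), (exp (- lam * t) * q).
    split.
    + rewrite <- H2.
      apply (jet_intro _ (fun z => exp (- lam * t) * Derive (fun x => phi x t) z) y t _ _ r Hr).
      * replace (exp (- lam * t) * (d - lam * phi y t)) with
          (- lam * exp (- lam * t) * phi y t + exp (- lam * t) * d) by ring.
        apply (is_derive_mult (fun s => exp (- lam * s)) (fun s => phi y s)); [| exact H1 |].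
        -- auto_derive; [exact I | ring].
        -- intros; apply Rmult_comm.
      * intros z Hz. apply is_derive_scal. now apply Hur.
      * now apply is_derive_scal.
    + intros Ep Eq. specialize (He t).
      assert (d < lam * phi y t) by (apply Hneg; nra). nra.
Qed.

(** * Comparison without growth conditions *)

Definition cont_on (u : R -> R -> R) (T : R) : Prop :=
  forall y t, 0 <= t < T -> forall eps, 0 < eps ->
  exists d, 0 < d /\ forall z s, 0 <= s -> Rabs (z - y) < d -> Rabs (s - t) < d ->
    Rabs (u z s - u y t) < eps.

Lemma cont_on_rect (u : R -> R -> R) (T a b t0 t1 : R) : cont_on u T -> 0 <= t0 -> t1 < T ->
  cont_rect u a b t0 t1.
Proof.
  intros H H0 H1 y t Hy Ht e He. destruct (H y t ltac:(lra) e He) as [d [Hd Hd']].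
  exists d. split; [exact Hd |]. intros z s Hz Hs H2 H3. apply Hd'; lra.
Qed.

(* [log_barrier r] blows up at [y = - r] and [y = r], and yet, as for the grim reaper,
   [log_barrier'' / (1 + log_barrier'^2) <= 2 / r]. *)
Definition log_barrier (r y : R) : R := - r * ln (1 - (y / r) ^ 2).
Definition log_barrier1 (r y : R) : R := 2 * (y / r) / (1 - (y / r) ^ 2).
Definition log_barrier2 (r y : R) : R := 2 / r * (1 + (y / r) ^ 2) / (1 - (y / r) ^ 2) ^ 2.

Lemma div_sqr_lt_1 (r y : R) : 0 < r -> Rabs y < r -> (y / r) ^ 2 < 1.
Proof.
  intros Hr Hy. apply Rabs_def2 in Hy.
  assert (Hs : y / r < 1 /\ -1 < y / r).
  { split; apply (Rmult_lt_reg_r r); auto; unfold Rdiv; rewrite Rmult_assoc, Rinv_l; lra. }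
  nra.
Qed.

Lemma log_barrier_derive (r y : R) : 0 < r -> Rabs y < r ->
  is_derive (log_barrier r) y (log_barrier1 r y) /\ is_derive (log_barrier1 r) y (log_barrier2 r y).
Proof.
  intros Hr Hy. pose proof (div_sqr_lt_1 r y Hr Hy) as H.
  assert (Hne : r <> 0) by lra.
  assert (Hne2 : r ^ 2 - y ^ 2 <> 0).
  { intros E. assert (y ^ 2 = r ^ 2) by lra.
    replace ((y / r) ^ 2) with (y ^ 2 / r ^ 2) in H by (field; exact Hne).
    rewrite H0 in H. unfold Rdiv in H. rewrite Rinv_r in H; nra. }
  unfold log_barrier, log_barrier1, log_barrier2. split; auto_derive.
  - simpl in H. repeat split; lra.
  - field. simpl in *. repeat split; auto; lra.
  - simpl in H. repeat split; lra.
  - field. simpl in *. repeat split; auto; lra.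
Qed.

Lemma ln_ge (s : R) : s < 1 -> s <= - ln (1 - s).
Proof.
  intros Hs. pose proof (exp_ineq1_le (- s)) as H.
  assert (ln (1 - s) <= - s); [| lra].
  rewrite <- (ln_exp (- s)). apply ln_le; lra.
Qed.

Lemma log_barrier_ge (r y : R) : 0 < r -> Rabs y < r -> r * (y / r) ^ 2 <= log_barrier r y.
Proof.
  intros Hr Hy. pose proof (ln_ge _ (div_sqr_lt_1 r y Hr Hy)). unfold log_barrier. nra.
Qed.

Lemma log_barrier_le (r y : R) : 0 < r -> 2 * y ^ 2 <= r ^ 2 -> log_barrier r y <= 2 * y ^ 2 / r.
Proof.
  intros Hr Hy. set (s := (y / r) ^ 2).
  assert (Hs : 0 <= s <= / 2).
  { split; [apply pow2_ge_0 |]. unfold s. apply (Rmult_le_reg_r (r ^ 2)); [nra |].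
    replace ((y / r) ^ 2 * r ^ 2) with (y ^ 2) by (field; lra). lra. }
  assert (H : - ln (1 - s) <= 2 * s).
  { rewrite <- ln_Rinv by lra.
    apply Rle_trans with (/ (1 - s) - 1).
    - assert (0 < / (1 - s)) by (apply Rinv_0_lt_compat; lra).
      pose proof (exp_ineq1_le (/ (1 - s) - 1)) as H0.
      rewrite <- (ln_exp (/ (1 - s) - 1)). apply ln_le; lra.
    - apply (Rmult_le_reg_r (1 - s)); [lra |].
      replace ((/ (1 - s) - 1) * (1 - s)) with s by (field; lra). nra. }
  unfold log_barrier. fold s. replace (2 * y ^ 2 / r) with (r * (2 * s)) by (unfold s; field; lra). nra.
Qed.

(** The barrier satisfies [log_barrier2 * (1 + (y / r) ^ 2) = 2 / r * (1 + log_barrier1 ^ 2)], so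
    the weight of its own slope tames its second derivative. A bounded additional slope [p] and a
    factor [k >= 1] change that weight by at most [2 * (1 + C ^ 2)]. *)
Lemma log_barrier_curvature (r y k p C : R) : 0 < r -> Rabs y < r -> 1 <= k -> Rabs p <= C ->
  k * log_barrier2 r y / (1 + (p + k * log_barrier1 r y) ^ 2) <= 4 * (1 + C ^ 2) * k / r.
Proof.
  intros Hr Hy Hk Hp. pose proof (div_sqr_lt_1 r y Hr Hy) as H.
  set (x := y / r) in *. set (g1 := log_barrier1 r y).
  assert (Hd : 0 < 1 - x ^ 2) by lra.
  assert (Hg2 : log_barrier2 r y * (1 + x ^ 2) = 2 / r * (1 + g1 ^ 2)).
  { unfold g1, log_barrier1, log_barrier2. fold x. field. split; lra. }
  assert (Hir : 0 < / r) by now apply Rinv_0_lt_compat.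
  assert (Hg2' : 0 <= log_barrier2 r y <= 2 / r * (1 + g1 ^ 2)).
  { assert (0 <= 2 / r * (1 + g1 ^ 2)).
      { apply Rmult_le_pos; [unfold Rdiv; lra | left; apply one_plus_sqr_pos]. }
    pose proof (pow2_ge_0 x). nra. }
  pose proof (one_plus_sqr_pos (p + k * g1)) as Hq.
  apply (Rmult_le_reg_r (1 + (p + k * g1) ^ 2)); [exact Hq |].
  unfold Rdiv at 1. rewrite Rmult_assoc, Rinv_l, Rmult_1_r by lra.
  assert (Hpc : p ^ 2 <= C ^ 2).
  { rewrite <- (pow2_abs p). apply pow_incr. split; [apply Rabs_pos | exact Hp]. }
  assert (H1 : 1 + g1 ^ 2 <= 2 * (1 + C ^ 2) * (1 + (p + k * g1) ^ 2)).
  { assert (1 + g1 ^ 2 <= 1 + (k * g1) ^ 2).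
    { replace ((k * g1) ^ 2) with (k ^ 2 * g1 ^ 2) by ring.
      assert (1 <= k ^ 2) by nra. pose proof (pow2_ge_0 g1).
      pose proof (Rmult_le_compat_r (g1 ^ 2) 1 (k ^ 2) ltac:(lra) ltac:(lra)). lra. }
    assert (1 + (k * g1) ^ 2 <= 2 * (1 + p ^ 2) * (1 + (p + k * g1) ^ 2)).
    { set (w := p + k * g1) in *. replace (k * g1) with (w - p) by (unfold w; ring).
      pose proof (pow2_ge_0 (w + p)). pose proof (Rmult_le_pos _ _ (pow2_ge_0 w) (pow2_ge_0 p)). nra. }
    assert (2 * (1 + p ^ 2) * (1 + (p + k * g1) ^ 2) <= 2 * (1 + C ^ 2) * (1 + (p + k * g1) ^ 2)).
    { apply Rmult_le_compat_r; lra. }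
    lra. }
  apply Rle_trans with (k * (2 / r * (1 + g1 ^ 2))); [apply Rmult_le_compat_l; lra |].
  replace (4 * (1 + C ^ 2) * k / r * (1 + (p + k * g1) ^ 2)) with
    (k * (2 / r * (2 * (1 + C ^ 2) * (1 + (p + k * g1) ^ 2)))) by (field; lra).
  apply Rmult_le_compat_l; [lra |]. apply Rmult_le_compat_l; [| exact H1].
  unfold Rdiv. lra.
Qed.

(** The barrier changes the coefficient [1 / (1 + p ^ 2)] by at most a multiple of this minimum,
    which has to be absorbed by the barrier itself. Near the centre [2 * |x| <= r * x ^ 2 + / r]
    with [x = y / r]; elsewhere the barrier is at least [r / 4]. *)
Lemma log_barrier1_min (r y : R) : 1 <= r -> Rabs y < r ->
  Rmin 1 (Rabs (log_barrier1 r y)) <= 4 * (log_barrier r y + / r).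
Proof.
  intros Hr Hy. pose proof (log_barrier_ge r y ltac:(lra) Hy) as HG.
  pose proof (div_sqr_lt_1 r y ltac:(lra) Hy) as H.
  assert (Hir : 0 < / r) by (apply Rinv_0_lt_compat; lra).
  set (x := y / r) in *.
  destruct (Rle_lt_dec (x ^ 2) (/ 4)) as [Hs | Hs].
  - eapply Rle_trans; [apply Rmin_r |].
    assert (H1 : Rabs (log_barrier1 r y) <= 8 / 3 * Rabs x).
    { unfold log_barrier1. fold x. unfold Rdiv at 1. rewrite Rabs_mult, Rabs_mult, (Rabs_pos_eq 2) by lra.
      rewrite Rabs_inv, (Rabs_pos_eq (1 - x ^ 2)) by lra.
      apply (Rmult_le_reg_r (1 - x ^ 2)); [lra |]. rewrite Rmult_assoc, Rinv_l, Rmult_1_r by lra.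
      pose proof (Rabs_pos x). nra. }
    assert (H2 : 2 * Rabs x <= r * x ^ 2 + / r).
    { rewrite <- (pow2_abs x). set (w := Rabs x).
      assert (E : r * w ^ 2 + / r - 2 * w = / r * (r * w - 1) ^ 2) by (field; lra).
      pose proof (Rmult_le_pos _ _ (Rlt_le _ _ Hir) (pow2_ge_0 (r * w - 1))). lra. }
    pose proof (Rabs_pos x). lra.
  - eapply Rle_trans; [apply Rmin_l |]. nra.
Qed.

Definition subsol_at (f : R -> R) (u : R -> R -> R) (y t : R) : Prop :=
  exists d p q, jet u y t d p q /\ d <= q / (1 + p ^ 2) - f (u y t).

Definition bounded_supersol_at (f : R -> R) (C : R) (u : R -> R -> R) (y t : R) : Prop :=
  exists d p q, jet u y t d p q /\ q / (1 + p ^ 2) - f (u y t) <= d /\ Rabs p <= C /\ Rabs q <= C.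

Lemma le_of_arbitrarily_small (a b K : R) : (forall r, K <= r -> 1 <= r -> a <= b + K / r) -> a <= b.
Proof.
  intros H. apply le_epsilon. intros e He.
  set (r := Rmax (Rmax K 1) (Rabs K / e)).
  assert (H1 : K <= r) by (eapply Rle_trans; [apply Rmax_l | apply Rmax_l]).
  assert (H2 : 1 <= r) by (eapply Rle_trans; [apply Rmax_r | apply Rmax_l]).
  assert (H3 : Rabs K / e <= r) by apply Rmax_r.
  eapply Rle_trans; [apply (H r H1 H2) |].
  assert (K / r <= e); [| lra].
  apply (Rmult_le_reg_r r); [lra |]. unfold Rdiv. rewrite Rmult_assoc, Rinv_l, Rmult_1_r by lra.
  apply (Rmult_le_compat_r e) in H3; [| lra].
  replace (Rabs K / e * e) with (Rabs K) in H3 by (field; lra). pose proof (Rle_abs K). lra.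
Qed.

(** At a maximum of [u - S] minus the penalty [exp (A * t) * (log_barrier r y + / r)], the slope of
    [u] is that of [S] plus a known term, so only the derivatives of [S] need bounds; then [r] tends
    to infinity. The end [lo] is either minus infinity or finite, the latter for reflections. *)
Theorem comparison (f : R -> R) (c0 C T : R) (lo : Rbar) (u S : R -> R -> R) :
  0 <= c0 -> (forall x y, Rabs (f x - f y) <= c0 * Rabs (x - y)) ->
  cont_on u T -> cont_on S T ->
  (forall (y t : R), Rbar_lt lo y -> 0 < t < T -> subsol_at f u y t) ->
  (forall (y t : R), Rbar_lt lo y -> 0 < t < T -> bounded_supersol_at f C S y t) ->
  (forall y : R, Rbar_le lo y -> u y 0 <= S y 0) ->
  (forall l t, lo = Finite l -> 0 <= t < T -> u l t <= S l t) ->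
  forall (y t : R), Rbar_le lo y -> 0 <= t < T -> u y t <= S y t.
Proof.
  intros Hc0 Hf Hcu HcS Hu HS Hinit Hlat y0 tau Hy0 Htau.
  (* In this order the summands absorb the curvature of the barrier, the change of the coefficient
     in front of [q2], the reaction term, and provide strictness. *)
  set (A := 4 * (1 + C ^ 2) + 4 * Rabs C + c0 + 1).
  assert (HA : 0 <= A) by (unfold A; pose proof (pow2_ge_0 C); pose proof (Rabs_pos C); lra).
  set (K := exp (A * tau) * (2 * y0 ^ 2 + 1) + 2 * Rabs y0 + 1).
  pose proof (exp_pos (A * tau)) as He0.
  apply (le_of_arbitrarily_small _ _ K). intros r HKr Hr1.
  assert (Hy0r : 2 * Rabs y0 + 1 <= r).
  { unfold K in HKr. assert (0 <= exp (A * tau) * (2 * y0 ^ 2 + 1)) by (apply Rmult_le_pos; [lra | pose proof (pow2_ge_0 y0); lra]). lra. }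
  pose proof (Rabs_pos y0) as Hay.
  assert (Hir : 0 < / r) by (apply Rinv_0_lt_compat; lra).
  enough (Hpen : u y0 tau <= S y0 tau + exp (A * tau) * (log_barrier r y0 + / r)).
  { eapply Rle_trans; [exact Hpen |]. apply Rplus_le_compat_l.
    assert (Hl : log_barrier r y0 <= 2 * y0 ^ 2 / r).
    { apply log_barrier_le; [lra |]. rewrite <- (pow2_abs y0).
      pose proof (pow_incr (2 * Rabs y0) r 2 ltac:(lra)). rewrite Rpow_mult_distr in H. nra. }
    apply Rle_trans with (exp (A * tau) * (2 * y0 ^ 2 + 1) / r).
    - replace (exp (A * tau) * (2 * y0 ^ 2 + 1) / r) with (exp (A * tau) * (2 * y0 ^ 2 / r + / r)) by (field; lra).
      apply Rmult_le_compat_l; lra.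
    - unfold Rdiv. apply Rmult_le_compat_r; [lra |]. unfold K. lra. }
  assert (Hcd : cont_rect (fun y t => u y t - S y t) (- r) r 0 tau).
  { apply cont_rect_minus; apply cont_on_rect with T; auto; lra. }
  destruct (rect_max _ (- r) r 0 tau ltac:(lra) ltac:(lra) Hcd) as [ym [tm [_ [_ Hmax]]]].
  set (Mx := u ym tm - S ym tm) in *.
  pose proof (div_sqr_lt_1 r y0 ltac:(lra) ltac:(lra)) as Hx0. set (x0 := y0 / r) in *.
  (* Chosen so that the barrier equals [r * m = |Mx| + 1 + log_barrier r y0] at [rho]: it beats the
     maximum [Mx] of [u - S] over the whole strip, and [rho] lies beyond [|y0|]. *)
  set (m := (Rabs Mx + 1) / r - ln (1 - x0 ^ 2)).
  assert (Hm0 : 0 < (Rabs Mx + 1) / r).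
  { apply Rdiv_lt_0_compat; [pose proof (Rabs_pos Mx); lra | lra]. }
  assert (Hln0 : 0 <= - ln (1 - x0 ^ 2)).
  { eapply Rle_trans; [apply (pow2_ge_0 x0) | now apply ln_ge]. }
  assert (Hem : exp (- m) < 1 - x0 ^ 2).
  { rewrite <- (exp_ln (1 - x0 ^ 2)) by lra. apply exp_increasing. unfold m. lra. }
  pose proof (exp_pos (- m)) as Hem0. pose proof (pow2_ge_0 x0) as Hx00.
  set (rho := r * sqrt (1 - exp (- m))).
  assert (Hsq : sqrt (1 - exp (- m)) ^ 2 = 1 - exp (- m)) by (apply pow2_sqrt; lra).
  assert (Hsp : 0 <= sqrt (1 - exp (- m))) by apply sqrt_pos.
  assert (Hrho_r : rho < r).
  { unfold rho. assert (sqrt (1 - exp (- m)) < 1) by nra. nra. }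
  assert (Hyrho : Rabs y0 < rho).
  { apply Rnot_le_lt. intros Hn.
    assert (rho ^ 2 <= Rabs y0 ^ 2).
    { apply pow_incr. split; [unfold rho; nra | exact Hn]. }
    rewrite pow2_abs in H. unfold rho in H. rewrite Rpow_mult_distr, Hsq in H.
    assert (y0 ^ 2 = r ^ 2 * x0 ^ 2) by (unfold x0; field; lra).
    assert (0 < r ^ 2) by nra. nra. }
  assert (Hrho0 : 0 < rho) by lra.
  assert (HGrho : forall y, y = rho \/ y = - rho -> Mx < log_barrier r y).
  { intros y Hy. unfold log_barrier.
    replace ((y / r) ^ 2) with (sqrt (1 - exp (- m)) ^ 2).
    2:{ destruct Hy as [-> | ->]; unfold rho; field; lra. }
    rewrite Hsq. replace (1 - (1 - exp (- m))) with (exp (- m)) by ring. rewrite ln_exp.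
    pose proof (Rle_abs Mx). unfold m.
    replace (- r * - ((Rabs Mx + 1) / r - ln (1 - x0 ^ 2))) with
      (Rabs Mx + 1 + r * - ln (1 - x0 ^ 2)) by (field; lra).
    assert (0 <= r * - ln (1 - x0 ^ 2)) by (apply Rmult_le_pos; lra). lra. }
  assert (Hexp1 : forall t, 0 <= t -> 1 <= exp (A * t)).
  { intros t Ht. pose proof (exp_ineq1_le (A * t)). nra. }
  assert (HG0 : forall y, Rabs y < r -> 0 <= log_barrier r y).
  { intros y Hy. eapply Rle_trans; [| apply log_barrier_ge; auto; lra].
    apply Rmult_le_pos; [lra | apply pow2_ge_0]. }
  set (phi := fun y t => u y t - S y t - exp (A * t) * (log_barrier r y + / r)).
  assert (Ha : exists a : R, - rho <= a /\ Rbar_le lo a /\ a <= y0 /\ (a = - rho \/ lo = Finite a)).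
  { apply Rabs_def2 in Hyrho.
    destruct lo as [l | |]; [simpl in * | exfalso; exact Hy0 | ].
    - destruct (Rle_lt_dec l (- rho)).
      + exists (- rho). repeat split; try lra; simpl; try lra. 
      + exists l. repeat split; simpl; try lra. now right.
    - exists (- rho). repeat split; try lra; simpl; auto. }
  destruct Ha as [a [Ha1 [Ha2 [Ha3 Ha4]]]].
  apply Rabs_def2 in Hyrho.
  enough (Hphi : phi y0 tau < 0) by (unfold phi in Hphi; lra).
  assert (Hside : forall y t, 0 <= t <= tau -> y = rho \/ y = - rho -> phi y t < 0).
  { intros y t Ht Hy. pose proof (HGrho y Hy) as H1. pose proof (Hexp1 t ltac:(lra)) as H2.
    assert (Hyr : -r <= y <= r) by (destruct Hy as [-> | ->]; lra).
    pose proof (Hmax y t Hyr Ht) as H3. fold Mx in H3. unfold phi.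
    assert (Hyr2 : Rabs y < r) by (apply Rabs_def1; destruct Hy as [-> | ->]; lra).
    pose proof (HG0 y Hyr2). nra. }
  assert (Hge : forall y : R, a <= y -> Rbar_le lo y).
  { intros y Hy. apply Rbar_le_trans with (Finite a); [exact Ha2 | exact Hy]. }
  assert (Hpos : forall y t, Rabs y < r -> 0 <= t -> 0 < exp (A * t) * (log_barrier r y + / r)).
  { intros y t Hy Ht. apply Rmult_lt_0_compat; [apply exp_pos |]. pose proof (HG0 y Hy). lra. }
  apply (max_principle_exp c0 phi a rho 0 tau); try lra.
  - apply cont_rect_minus; [apply cont_rect_minus; apply cont_on_rect with T; auto; lra |].
    apply (cont_rect_mult (fun _ t => exp (A * t)) (fun y _ => log_barrier r y + / r)).
    + apply (cont_rect_t (fun t => exp (A * t))). intros t _.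
      apply (ex_derive_continuous (fun t => exp (A * t))). auto_derive. exact I.
    + apply (cont_rect_y (fun y => log_barrier r y + / r)). intros y Hy.
      apply (continuous_plus (log_barrier r) (fun _ => / r)); [| apply continuous_const].
      apply (ex_derive_continuous (log_barrier r)). exists (log_barrier1 r y). refine (proj1 (log_barrier_derive r y _ _)); [lra |].
      apply Rabs_def1; lra.
  - intros y Hy. unfold phi. pose proof (Hinit y (Hge y (proj1 Hy))).
    pose proof (Hpos y 0 ltac:(apply Rabs_def1; lra) ltac:(lra)). lra.
  - intros t Ht. split; [| apply Hside; auto].
    destruct Ha4 as [Ha4 | Ha4]; [apply Hside; auto |].
    pose proof (Hlat a t Ha4 ltac:(lra)). unfold phi.
    pose proof (Hpos a t ltac:(apply Rabs_def1; lra) ltac:(lra)). lra.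
  - intros y t Hy Ht Hp.
    assert (Hlo : Rbar_lt lo y).
    { apply Rbar_le_lt_trans with (Finite a); [exact Ha2 | simpl; lra]. }
    destruct (Hu y t Hlo ltac:(lra)) as [d1 [p1 [q1 [J1 E1]]]].
    destruct (HS y t Hlo ltac:(lra)) as [d2 [p2 [q2 [J2 [E2 [B1 B2]]]]]].
    set (k := exp (A * t)) in *.
    assert (Hk : 1 <= k) by (apply Hexp1; lra).
    assert (Hyr : Rabs y < r) by (apply Rabs_def1; lra).
    assert (JB : jet (fun z s => exp (A * s) * (log_barrier r z + / r)) y t
      (A * k * (log_barrier r y + / r)) (k * log_barrier1 r y) (k * log_barrier2 r y)).
    { apply (jet_intro _ (fun z => k * log_barrier1 r z) y t _ _ (r - Rabs y)); [lra | | |].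
      - auto_derive; [exact I | unfold k; ring].
      - intros z Hz. apply is_derive_scal.
        replace (log_barrier1 r z) with (log_barrier1 r z + 0) by ring.
        apply (is_derive_plus (log_barrier r) (fun _ => / r)); [| exact (is_derive_const (/ r) z)].
        refine (proj1 (log_barrier_derive r z _ _)); [lra |].
        replace z with ((z - y) + y) by ring. pose proof (Rabs_triang (z - y) y). lra.
      - apply is_derive_scal. refine (proj2 (log_barrier_derive r y _ _)); auto; lra. }
    pose proof (jet_lin 1 (-1) _ _ _ _ _ _ _ _ _ _ (jet_lin 1 (-1) _ _ _ _ _ _ _ _ _ _ J1 J2) JB) as J.
    eexists _, _, _. split; [eapply jet_ext; [| exact J]; intros; unfold phi; ring |].
    intros Ep Eq.
    assert (Ep1 : p1 = p2 + k * log_barrier1 r y) by lra.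
    assert (Eq1 : q1 <= q2 + k * log_barrier2 r y) by lra.
    pose proof (HG0 y Hyr) as HG.
    assert (HCC : Rabs C = C) by (apply Rabs_pos_eq; pose proof (Rabs_pos p2); lra).
    pose proof (log_barrier_curvature r y k p2 C ltac:(lra) Hyr Hk B1) as Q1. rewrite <- Ep1 in Q1.
    pose proof (log_barrier1_min r y Hr1 Hyr) as Q2.
    pose proof (one_plus_sqr_pos p1) as P1. pose proof (one_plus_sqr_pos p2) as P2.
    (* The second derivative of [S] carries the weight of the wrong slope [p1]. The change of weight
       is at most 1 and at most [k * |log_barrier1|], and [q2] is bounded. *)
    assert (Q3 : q2 * (/ (1 + p1 ^ 2) - / (1 + p2 ^ 2)) <= C * (k * (4 * (log_barrier r y + / r)))).
    { eapply Rle_trans; [apply Rle_abs |]. rewrite Rabs_mult.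
      apply Rmult_le_compat; try apply Rabs_pos; [exact B2 |].
      apply Rle_trans with (Rmin 1 (k * Rabs (log_barrier1 r y))).
      - apply Rmin_glb.
        + assert (forall p, 0 < / (1 + p ^ 2) <= 1).
          { intros p. split; [apply Rinv_0_lt_compat, one_plus_sqr_pos |].
            rewrite <- Rinv_1 at 2. apply Rinv_le_contravar; [lra |]. pose proof (pow2_ge_0 p). lra. }
          pose proof (H p1). pose proof (H p2). apply Rabs_le. lra.
        + eapply Rle_trans; [apply inv_one_plus_sqr_lip |]. rewrite Ep1.
          replace (p2 + k * log_barrier1 r y - p2) with (k * log_barrier1 r y) by ring.
          rewrite Rabs_mult, (Rabs_pos_eq k); lra.
      - apply Rle_trans with (k * Rmin 1 (Rabs (log_barrier1 r y))).
        + unfold Rmin at 2. destruct (Rle_dec 1 (Rabs (log_barrier1 r y))).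
          * eapply Rle_trans; [apply Rmin_l | lra].
          * apply Rmin_r.
        + apply Rmult_le_compat_l; lra. }
    assert (Q4 : q1 / (1 + p1 ^ 2) <= q2 / (1 + p1 ^ 2) + k * log_barrier2 r y / (1 + p1 ^ 2)).
    { unfold Rdiv. rewrite <- Rmult_plus_distr_r. apply Rmult_le_compat_r; [| exact Eq1].
      left. now apply Rinv_0_lt_compat. }
    assert (Q5 : f (S y t) - f (u y t) <= c0 * (u y t - S y t)).
    { eapply Rle_trans; [apply Rle_abs |]. eapply Rle_trans; [apply Hf |].
      apply Rmult_le_compat_l; [exact Hc0 |]. rewrite Rabs_minus_sym, Rabs_pos_eq; [lra |].
      unfold phi in Hp. fold k in Hp. nra. }
    assert (Hphi2 : u y t - S y t = phi y t + k * (log_barrier r y + / r)) by (unfold phi, k; ring).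
    rewrite Hphi2 in Q5.
    set (G := log_barrier r y) in *.
    replace (4 * (1 + C ^ 2) * k / r) with (4 * (1 + C ^ 2) * (k * / r)) in Q1 by (field; lra).
    assert (Hkr : 0 < k * / r) by (apply Rmult_lt_0_compat; lra).
    assert (HkG : 0 <= k * G) by (apply Rmult_le_pos; lra).
    unfold Rdiv in *.
    assert (HCp : 0 <= 4 * (1 + C ^ 2)) by (pose proof (pow2_ge_0 C); lra).
    assert (HE : A * k * (G + / r) = (4 * (1 + C ^ 2)) * (k * / r) + C * (k * (4 * (G + / r)))
       + c0 * (k * (G + / r)) + (4 * (1 + C ^ 2)) * (k * G) + k * G + k * / r)
      by (unfold A; rewrite HCC; ring).
    assert (0 <= (4 * (1 + C ^ 2)) * (k * G)) by (apply Rmult_le_pos; lra).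
    lra.
Qed.

(** The substitution of [- S] for the subsolution and [- u] for the supersolution, with reaction
    [- f (- x)], exchanges the roles. *)
Theorem comparison_bounded_sub (f : R -> R) (c0 C T : R) (u S : R -> R -> R) :
  0 <= c0 -> (forall x y, Rabs (f x - f y) <= c0 * Rabs (x - y)) ->
  cont_on u T -> cont_on S T ->
  (forall y t, 0 < t < T -> exists d p q, jet u y t d p q /\ d <= q / (1 + p ^ 2) - f (u y t)
     /\ Rabs p <= C /\ Rabs q <= C) ->
  (forall y t, 0 < t < T -> exists d p q, jet S y t d p q /\ q / (1 + p ^ 2) - f (S y t) <= d) ->
  (forall y, u y 0 <= S y 0) ->
  forall y t, 0 <= t < T -> u y t <= S y t.
Proof.
  intros Hc0 Hf Hcu HcS Hu HS Hinit y t Ht.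
  assert (Hneg : forall v y t d p q, jet v y t d p q -> jet (fun z s => - v z s) y t (- d) (- p) (- q)).
  { intros v z s d p q J. pose proof (jet_lin (-1) 0 _ _ _ _ _ _ _ _ _ _ J J) as J'.
    replace (- d) with (-1 * d + 0 * d) by ring. replace (- p) with (-1 * p + 0 * p) by ring.
    replace (- q) with (-1 * q + 0 * q) by ring.
    eapply jet_ext; [| exact J']. intros; simpl; ring. }
  assert (Hcn : forall v, cont_on v T -> cont_on (fun z s => - v z s) T).
  { intros v Hv z s Hs e He. destruct (Hv z s Hs e He) as [d [Hd Hd']].
    exists d. split; [exact Hd |]. intros x r Hr H1 H2. specialize (Hd' x r Hr H1 H2).
    replace (- v x r - - v z s) with (- (v x r - v z s)) by ring. now rewrite Rabs_Ropp. }
  enough (H : - S y t <= - u y t) by lra.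
  apply (comparison (fun x => - f (- x)) c0 C T m_infty (fun z s => - S z s) (fun z s => - u z s)); auto.
  - intros a b. replace (- f (- a) - - f (- b)) with (f (- b) - f (- a)) by ring.
    eapply Rle_trans; [apply Hf |]. right. f_equal. f_equal. ring.
  - intros z s _ Hs. destruct (HS z s Hs) as [d [p [q [J E]]]].
    exists (- d), (- p), (- q). split; [now apply Hneg |]. rewrite Ropp_involutive.
    replace ((- p) ^ 2) with (p ^ 2) by ring. unfold Rdiv in *. lra.
  - intros z s _ Hs. destruct (Hu z s Hs) as [d [p [q [J [E [B1 B2]]]]]].
    exists (- d), (- p), (- q). split; [now apply Hneg |]. rewrite Ropp_involutive, !Rabs_Ropp.
    replace ((- p) ^ 2) with (p ^ 2) by ring. unfold Rdiv in *. repeat split; auto; lra.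
  - intros z _. pose proof (Hinit z). lra.
  - intros l s Hl. discriminate.
  - exact I.
Qed.

(** * Barriers and the finite-time case *)

Lemma C21_jet (u : R -> R -> R) (y t : R) : (forall z, C21_at u z t) ->
  jet u y t (u_t u y t) (u_y u y t) (u_yy u y t).
Proof.
  intros H. apply (jet_intro u (fun z => u_y u z t) y t _ _ 1 Rlt_0_1).
  - apply Derive_correct, (H y).
  - intros z _. apply Derive_correct, (H z).
  - apply Derive_correct, (H y).
Qed.

Lemma jet_sqr (u : R -> R -> R) (y t d p q : R) : jet u y t d p q ->
  jet (fun z s => u z s ^ 2) y t (2 * u y t * d) (2 * u y t * p) (2 * p ^ 2 + 2 * u y t * q).
Proof.
  intros Hj. destruct (jet_derive_loc _ _ _ _ _ _ Hj) as [r [Hr Hur]].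
  destruct Hj as [H1 [_ [H2 H3]]]. rewrite <- H2.
  assert (Hsq : forall (g : R -> R) (x l : R), is_derive g x l -> is_derive (fun z => g z ^ 2) x (2 * g x * l)).
  { intros g x l Hg. replace (2 * g x * l) with (INR 2 * l * g x ^ pred 2) by (simpl; ring).
    now apply is_derive_pow. }
  apply (jet_intro _ (fun z => 2 * u z t * Derive (fun x => u x t) z) y t _ _ r Hr).
  - now apply Hsq.
  - intros z Hz. now apply (Hsq (fun x => u x t)), Hur.
  - replace (2 * Derive (fun x => u x t) y ^ 2 + 2 * u y t * q) with
      (2 * Derive (fun x => u x t) y * Derive (fun x => u x t) y + 2 * u y t * q) by ring.
    apply (is_derive_mult (fun z => 2 * u z t) (fun z => Derive (fun x => u x t) z)); [| exact H3 |].
    + apply is_derive_scal. apply Hur. rewrite Rminus_diag, Rabs_R0. exact Hr.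
    + intros; apply Rmult_comm.
Qed.

Definition mcf_on (T : R) (u : R -> R -> R) : Prop :=
  cont_on u T /\ (forall y t, 0 <= t < T -> 0 < u y t) /\
  (forall y t, 0 < t < T -> C21_at u y t /\
     u_t u y t = u_yy u y t / (1 + u_y u y t ^ 2) - 1 / u y t).

Lemma mcf_on_jet (T : R) (u : R -> R -> R) (y t : R) : mcf_on T u -> 0 < t < T ->
  exists p q, jet u y t (q / (1 + p ^ 2) - 1 / u y t) p q.
Proof.
  intros [_ [_ H]] Ht. exists (u_y u y t), (u_yy u y t).
  rewrite <- (proj2 (H y t Ht)). apply C21_jet. intros z. now apply H.
Qed.

(** A sphere centred at [yc] on the axis shrinks with squared radius [C - 4 * (t - t1)]. Written for
    [u ^ 2] the barrier is a polynomial, and outside the sphere the claim is trivial. *)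
Lemma sphere_lower (T t1 C yc : R) (u : R -> R -> R) : mcf_on T u -> 0 <= t1 ->
  (forall y, C - (y - yc) ^ 2 <= u y t1 ^ 2) ->
  forall y t, t1 <= t < T -> C - (y - yc) ^ 2 - 4 * (t - t1) <= u y t ^ 2.
Proof.
  intros Hu Ht1 Hinit y t Ht. apply Rnot_lt_le. intros Hlt.
  set (gap := C - (y - yc) ^ 2 - 4 * (t - t1) - u y t ^ 2).
  (* Lowering the sphere by [e] and speeding up its shrinking by [e] makes all inequalities strict,
     and uses up only half of the gap by time [t]. *)
  set (e := gap / (2 * (1 + (t - t1)))).
  assert (He : 0 < e) by (apply Rdiv_lt_0_compat; unfold gap; lra).
  assert (He' : e * (1 + (t - t1)) = gap / 2) by (unfold e; field; lra).
  set (r := Rabs C + Rabs (y - yc) + 1).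
  pose proof (Rabs_pos C). pose proof (Rle_abs C). pose proof (Rabs_pos (y - yc)).
  assert (Hr2 : C < r ^ 2) by (unfold r; nra).
  set (phi := fun z s => (C - e - (z - yc) ^ 2 + (- (4 + e)) * (s - t1)) - u z s ^ 2).
  enough (Hphi : phi y t < 0) by (unfold phi in Hphi; unfold gap in *; lra).
  assert (Hyr : yc - r <= y <= yc + r).
  { assert (Hab : Rabs (y - yc) <= r) by (unfold r; lra). apply Rabs_le_between in Hab. lra. }
  apply (max_principle phi (yc - r) (yc + r) t1 t); try lra.
  - apply (cont_rect_minus (fun z s => C - e - (z - yc) ^ 2 + (- (4 + e)) * (s - t1)) (fun z s => u z s ^ 2)).
    + apply (cont_rect_plus (fun z _ => C - e - (z - yc) ^ 2) (fun _ s => (- (4 + e)) * (s - t1))).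
      * apply (cont_rect_y (fun z => C - e - (z - yc) ^ 2)). intros z _.
        apply (ex_derive_continuous (fun z => C - e - (z - yc) ^ 2)). auto_derive. exact I.
      * apply (cont_rect_t (fun s => (- (4 + e)) * (s - t1))). intros s _.
        apply (ex_derive_continuous (fun s => (- (4 + e)) * (s - t1))). auto_derive. exact I.
    + assert (Hc : cont_rect u (yc - r) (yc + r) t1 t).
      { apply cont_on_rect with T; [apply Hu | exact Ht1 | lra]. }
      pose proof (cont_rect_mult _ _ _ _ _ _ Hc Hc) as Hcc.
      intros z s Hz Hs. simpl. setoid_rewrite Rmult_1_r. now apply Hcc.
  - intros z Hz. unfold phi. specialize (Hinit z). lra.
  - intros s Hs. assert (0 <= (4 + e) * (s - t1)) by (apply Rmult_le_pos; lra).
    unfold phi. split.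
    + pose proof (pow2_ge_0 (u (yc - r) s)). replace (yc - r - yc) with (- r) by ring. nra.
    + pose proof (pow2_ge_0 (u (yc + r) s)). replace (yc + r - yc) with r by ring. nra.
  - intros z s Hz Hs _.
    assert (Hs' : 0 < s < T) by lra.
    destruct (mcf_on_jet T u z s Hu Hs') as [p [q J]].
    assert (Hpos : 0 < u z s) by (apply Hu; lra).
    apply jet_sqr in J.
    assert (JB : jet (fun z s => C - e - (z - yc) ^ 2 + (- (4 + e)) * (s - t1)) z s (- (4 + e)) (- 2 * (z - yc)) (- 2)).
    { apply (jet_intro _ (fun z => - 2 * (z - yc)) z s _ _ 1 Rlt_0_1).
      - auto_derive; [exact I | ring].
      - intros x _. auto_derive; [exact I | ring].
      - auto_derive; [exact I | ring]. }
    pose proof (jet_lin 1 (-1) _ _ _ _ _ _ _ _ _ _ JB J) as JJ.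
    eexists _, _, _. split; [eapply jet_ext; [| exact JJ]; intros; unfold phi; ring |].
    intros _ Hq.
    set (w := u z s) in *.
    assert (Hwq : - (1 + p ^ 2) <= w * q) by lra.
    pose proof (one_plus_sqr_pos p) as Hp.
    assert (- 1 <= w * q / (1 + p ^ 2)).
    { apply (Rmult_le_reg_r (1 + p ^ 2)); [exact Hp |]. unfold Rdiv.
      rewrite Rmult_assoc, Rinv_l; lra. }
    replace (2 * w * (q / (1 + p ^ 2) - 1 / w)) with (2 * (w * q / (1 + p ^ 2)) - 2) by (field; split; lra).
    lra.
Qed.

(** At a first contact [u * u_yy <= k - u_y ^ 2], so [u ^ 2] grows at most at the rate [2 * k - 2].
    For [k < 1] the rate [mu] may be negative and the neck closes. *)
Lemma hyperboloid_upper (T Y t0 t1 A k mu : R) (u : R -> R -> R) : mcf_on T u -> 0 <= t0 -> t1 < T ->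
  0 <= k -> 2 * k - 2 < mu ->
  (forall y, - Y <= y <= Y -> u y t0 ^ 2 < A + k * y ^ 2) ->
  (forall t, t0 <= t <= t1 -> u (- Y) t ^ 2 < A + k * Y ^ 2 + mu * (t - t0) /\
     u Y t ^ 2 < A + k * Y ^ 2 + mu * (t - t0)) ->
  forall y t, - Y <= y <= Y -> t0 <= t <= t1 -> u y t ^ 2 < A + k * y ^ 2 + mu * (t - t0).
Proof.
  intros Hu Ht0 Ht1 Hk Hmu Hinit Hlat y t Hy Ht.
  set (phi := fun z s => u z s ^ 2 - (A + k * z ^ 2 + mu * (s - t0))).
  enough (Hphi : phi y t < 0) by (unfold phi in Hphi; lra).
  apply (max_principle phi (- Y) Y t0 t1); auto.
  - apply (cont_rect_minus (fun z s => u z s ^ 2) (fun z s => A + k * z ^ 2 + mu * (s - t0))).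
    + assert (Hc : cont_rect u (- Y) Y t0 t1).
      { apply cont_on_rect with T; [apply Hu | exact Ht0 | exact Ht1]. }
      pose proof (cont_rect_mult _ _ _ _ _ _ Hc Hc) as Hcc.
      intros z s Hz Hs. simpl. setoid_rewrite Rmult_1_r. now apply Hcc.
    + apply (cont_rect_plus (fun z _ => A + k * z ^ 2) (fun _ s => mu * (s - t0))).
      * apply (cont_rect_y (fun z => A + k * z ^ 2)). intros z _.
        apply (ex_derive_continuous (fun z => A + k * z ^ 2)). auto_derive. exact I.
      * apply (cont_rect_t (fun s => mu * (s - t0))). intros s _.
        apply (ex_derive_continuous (fun s => mu * (s - t0))). auto_derive. exact I.
  - intros z Hz. unfold phi. specialize (Hinit z Hz). lra.
  - intros s Hs. unfold phi. replace ((- Y) ^ 2) with (Y ^ 2) by ring. specialize (Hlat s Hs). lra.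
  - intros z s Hz Hs _.
    assert (Hs' : 0 < s < T) by lra.
    destruct (mcf_on_jet T u z s Hu Hs') as [p [q J]].
    assert (Hpos : 0 < u z s) by (apply Hu; lra).
    apply jet_sqr in J.
    assert (JB : jet (fun z s => A + k * z ^ 2 + mu * (s - t0)) z s mu (2 * k * z) (2 * k)).
    { apply (jet_intro _ (fun z => 2 * k * z) z s _ _ 1 Rlt_0_1).
      - auto_derive; [exact I | ring].
      - intros x _. auto_derive; [exact I | ring].
      - auto_derive; [exact I | ring]. }
    pose proof (jet_lin 1 (-1) _ _ _ _ _ _ _ _ _ _ J JB) as JJ.
    eexists _, _, _. split; [eapply jet_ext; [| exact JJ]; intros; unfold phi; ring |].
    intros _ Hq.
    set (w := u z s) in *.
    assert (Hwq : w * q <= k - p ^ 2) by lra.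
    pose proof (one_plus_sqr_pos p) as Hp. pose proof (pow2_ge_0 p) as Hp2.
    assert (w * q / (1 + p ^ 2) <= k).
    { apply (Rmult_le_reg_r (1 + p ^ 2)); [exact Hp |]. unfold Rdiv.
      rewrite Rmult_assoc, Rinv_l by lra. nra. }
    replace (2 * w * (q / (1 + p ^ 2) - 1 / w)) with (2 * (w * q / (1 + p ^ 2)) - 2) by (field; split; lra).
    lra.
Qed.

(* The spheres used here are centred on the axis and tangent to the cone. *)
Lemma cone_lower (T gam C0 : R) (u : R -> R -> R) : mcf_on T u ->
  (forall y, gam ^ 2 * y ^ 2 - C0 <= u y 0 ^ 2) ->
  forall y t, 0 <= t < T -> gam ^ 2 * y ^ 2 - C0 - 4 * t <= u y t ^ 2.
Proof.
  intros Hu Hinit y t Ht.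
  pose proof (one_plus_sqr_pos gam) as Hg.
  (* The normal to the cone above [y] meets the axis at this point. *)
  set (yc := (1 + gam ^ 2) * y).
  pose proof (sphere_lower T 0 (yc ^ 2 * gam ^ 2 / (1 + gam ^ 2) - C0) yc u Hu (Rle_refl 0)) as H.
  assert (E : yc ^ 2 * gam ^ 2 / (1 + gam ^ 2) - (y - yc) ^ 2 = gam ^ 2 * y ^ 2).
  { unfold yc. field. lra. }
  assert (H0 : forall z, yc ^ 2 * gam ^ 2 / (1 + gam ^ 2) - C0 - (z - yc) ^ 2 <= u z 0 ^ 2).
  { intros z. eapply Rle_trans; [| apply Hinit].
    assert (E2 : gam ^ 2 * z ^ 2 + (z - yc) ^ 2 - yc ^ 2 * gam ^ 2 / (1 + gam ^ 2)
      = ((1 + gam ^ 2) * z - yc) ^ 2 / (1 + gam ^ 2)) by (field; lra).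
    assert (0 <= ((1 + gam ^ 2) * z - yc) ^ 2 / (1 + gam ^ 2)).
    { apply Rmult_le_pos; [apply pow2_ge_0 | left; now apply Rinv_0_lt_compat]. }
    lra. }
  specialize (H H0 y t Ht). lra.
Qed.

(** Far out the cone bound keeps [u] above 1 up to time [T']; on the remaining compact rectangle a
    positive continuous function has a positive minimum. *)
Lemma uniform_lower_bound (T T' gam C0 : R) (u : R -> R -> R) : mcf_on T u -> 0 < gam ->
  (forall y, gam ^ 2 * y ^ 2 - C0 <= u y 0 ^ 2) -> 0 <= T' < T ->
  exists c, 0 < c /\ forall y t, 0 <= t <= T' -> c <= u y t.
Proof.
  intros Hu Hg Hinit HT'.
  set (Y := (Rabs C0 + 4 * T' + 1) / gam ^ 2 + 1).
  assert (Hg2 : 0 < gam ^ 2) by nra.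
  assert (Hnum : 0 < Rabs C0 + 4 * T' + 1) by (pose proof (Rabs_pos C0); lra).
  assert (HY : 1 < Y) by (unfold Y; pose proof (Rdiv_lt_0_compat _ _ Hnum Hg2); lra).
  assert (HY2 : Rabs C0 + 4 * T' + 1 <= gam ^ 2 * Y ^ 2).
  { apply Rle_trans with (gam ^ 2 * Y).
    - unfold Y. rewrite Rmult_plus_distr_l.
      replace (gam ^ 2 * ((Rabs C0 + 4 * T' + 1) / gam ^ 2)) with (Rabs C0 + 4 * T' + 1) by (field; lra). lra.
    - apply Rmult_le_compat_l; [lra | nra]. }
  assert (Hc : cont_rect (fun y t => 0 - u y t) (- Y) Y 0 T').
  { apply cont_rect_minus; [apply cont_rect_const |].
    apply cont_on_rect with T; [apply Hu | lra | lra]. }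
  destruct (rect_max _ (- Y) Y 0 T' ltac:(lra) ltac:(lra) Hc) as [ym [tm [Hym [Htm Hmax]]]].
  assert (Hpos : 0 < u ym tm) by (apply Hu; lra).
  exists (Rmin 1 (u ym tm)). split; [apply Rmin_glb_lt; lra |].
  intros y t Ht.
  destruct (Rle_lt_dec (Rabs y) Y) as [H | H].
  - apply Rabs_le_between in H. specialize (Hmax y t H Ht).
    eapply Rle_trans; [apply Rmin_r | lra].
  - eapply Rle_trans; [apply Rmin_l |].
    pose proof (cone_lower T gam C0 u Hu Hinit y t ltac:(lra)) as H1.
    assert (0 < u y t) by (apply Hu; lra).
    assert (Y ^ 2 <= y ^ 2) by (rewrite <- (pow2_abs y); apply pow_incr; lra).
    assert (gam ^ 2 * Y ^ 2 <= gam ^ 2 * y ^ 2) by (apply Rmult_le_compat_l; lra).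
    pose proof (Rle_abs C0). nra.
Qed.

Lemma smooth_data (g g1 g2 : R -> R) (L K : R) :
  (forall x, is_derive g x (g1 x)) -> (forall x, is_derive g1 x (g2 x)) ->
  (forall x, Rabs (g1 x) <= L) -> (forall x, Rabs (g2 x) <= K) ->
  (forall x y, Rabs (g x - g y) <= L * Rabs (x - y)) /\
  (forall x h, Rabs (g (x + h) + g (x - h) - 2 * g x) <= 2 * K * h ^ 2).
Proof.
  intros H1 H2 HL HK.
  assert (Hgen : forall (f f' : R -> R) B, (forall x, is_derive f x (f' x)) -> (forall x, Rabs (f' x) <= B) ->
    forall x y, Rabs (f x - f y) <= B * Rabs (x - y)).
  { intros f f' B Hf HB x y. destruct (MVT_gen f y x f') as [c [_ Hc]].
    - intros z _. apply Hf.
    - intros z _. apply continuity_pt_filterlim. apply (ex_derive_continuous f). eexists. apply Hf.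
    - rewrite Hc, Rabs_mult. apply Rmult_le_compat_r; [apply Rabs_pos | apply HB]. }
  split; [now apply Hgen with g1 |].
  intros x h.
  assert (Hd : forall r : R, is_derive (fun r => g (x + r) + g (x - r) - 2 * g x) r (g1 (x + r) - g1 (x - r))).
  { intros r. auto_derive.
    - split; [eexists; apply H1 | split; [eexists; apply H1 | exact I]].
    - rewrite !(is_derive_unique _ _ _ (H1 _)). unfold Rminus. ring. }
  destruct (MVT_gen (fun r => g (x + r) + g (x - r) - 2 * g x) 0 h (fun r => g1 (x + r) - g1 (x - r))) as [c [Hc1 Hc]].
  - intros z _. apply Hd.
  - intros z _. apply continuity_pt_filterlim.
    apply (ex_derive_continuous (fun r => g (x + r) + g (x - r) - 2 * g x)). eexists. apply Hd.
  - replace (g (x + 0) + g (x - 0) - 2 * g x) with 0 in Hc by (rewrite Rplus_0_r, Rminus_0_r; ring).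
    rewrite !Rminus_0_r in Hc. rewrite Hc, Rabs_mult.
    pose proof (Hgen g1 g2 K H2 HK (x + c) (x - c)) as Hg.
    replace (x + c - (x - c)) with (2 * c) in Hg by ring. rewrite Rabs_mult, (Rabs_pos_eq 2) in Hg by lra.
    assert (Hch : Rabs c <= Rabs h).
    { unfold Rmin, Rmax in Hc1. destruct (Rle_dec 0 h); unfold Rabs; destruct (Rcase_abs c), (Rcase_abs h); lra. }
    rewrite <- (pow2_abs h). pose proof (Rabs_pos h). pose proof (Rabs_pos c).
    assert (0 <= K) by (eapply Rle_trans; [apply Rabs_pos | apply (HK 0)]).
    apply Rle_trans with (K * (2 * Rabs c) * Rabs h); [apply Rmult_le_compat_r; lra |].
    replace (2 * K * Rabs h ^ 2) with (K * (2 * Rabs h) * Rabs h) by ring.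
    apply Rmult_le_compat_r; [lra |]. apply Rmult_le_compat_l; lra.
Qed.

(* The reaction term [1 / u] is cut off below [u = c], which makes it bounded and Lipschitz. *)
Definition cutoff (c x : R) : R := / Rmax x c.

Lemma cutoff_ge (c x : R) : c <= x -> cutoff c x = 1 / x.
Proof. intros H. unfold cutoff, Rdiv. rewrite Rmax_left by lra. ring. Qed.

Lemma cutoff_bounds (c : R) : 0 < c -> 0 <= / c ^ 2 /\ 0 <= / c /\
  (forall x y, Rabs (cutoff c x - cutoff c y) <= / c ^ 2 * Rabs (x - y)) /\
  (forall x, Rabs (cutoff c x) <= / c).
Proof.
  intros Hc. assert (Hic : 0 < / c) by now apply Rinv_0_lt_compat.
  assert (Hm : forall x, 0 < / Rmax x c <= / c).
  { intros x. pose proof (Rmax_r x c). split; [apply Rinv_0_lt_compat; lra |].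
    apply Rinv_le_contravar; lra. }
  split; [left; apply Rinv_0_lt_compat; nra | split; [lra | split]].
  - intros x y. unfold cutoff. pose proof (Hm x). pose proof (Hm y).
    pose proof (Rmax_r x c). pose proof (Rmax_r y c).
    replace (/ Rmax x c - / Rmax y c) with ((/ Rmax x c * / Rmax y c) * (Rmax y c - Rmax x c)) by (field; lra).
    rewrite Rabs_mult. apply Rmult_le_compat; try apply Rabs_pos.
    + rewrite Rabs_pos_eq by (apply Rmult_le_pos; lra).
      replace (/ c ^ 2) with (/ c * / c) by (field; lra). apply Rmult_le_compat; lra.
    + unfold Rmax, Rabs. destruct (Rle_dec x c), (Rle_dec y c), (Rcase_abs (x - y)), (Rcase_abs _); lra.
  - intros x. unfold cutoff. rewrite Rabs_pos_eq; [apply Hm | left; apply Hm].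
Qed.

Definition trunc_sol (c C T : R) (U : R -> R -> R) : Prop :=
  cont_on U T /\ forall y t, 0 < t < T -> C21_at U y t /\
     u_t U y t = u_yy U y t / (1 + u_y U y t ^ 2) - cutoff c (U y t) /\
     Rabs (u_y U y t) <= C /\ Rabs (u_yy U y t) <= C.

Lemma lip_cont_on (U : R -> R -> R) (C T T1 : R) : T <= T1 ->
  (forall y z t s, 0 <= t <= T1 -> 0 <= s <= T1 -> Rabs (U y t - U z s) <= C * (Rabs (y - z) + Rabs (t - s))) ->
  cont_on U T.
Proof.
  intros HT H y t Ht e He.
  assert (Hm : 0 < Rmin (T1 - t) (e / (2 * Rabs C + 1))).
  { apply Rmin_glb_lt; [lra |]. apply Rdiv_lt_0_compat; [lra |]. pose proof (Rabs_pos C). lra. }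
  exists (Rmin (T1 - t) (e / (2 * Rabs C + 1))). split; [exact Hm |].
  intros z s Hs Hz Hst.
  pose proof (Rmin_l (T1 - t) (e / (2 * Rabs C + 1))). pose proof (Rmin_r (T1 - t) (e / (2 * Rabs C + 1))).
  pose proof (Rabs_def2 _ _ Hst).
  eapply Rle_lt_trans; [apply H; lra |].
  set (d := Rmin (T1 - t) (e / (2 * Rabs C + 1))) in *.
  pose proof (Rabs_pos C). pose proof (Rle_abs C).
  assert (Hd : (2 * Rabs C + 1) * d <= e).
  { apply (Rmult_le_compat_l (2 * Rabs C + 1)) in H1; [| lra].
    replace ((2 * Rabs C + 1) * (e / (2 * Rabs C + 1))) with e in H1 by (field; lra). exact H1. }
  pose proof (Rabs_pos (z - y)). pose proof (Rabs_pos (s - t)). nra.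
Qed.

Lemma trunc_exists (g : R -> R) (L K c T : R) : 0 < c -> 0 < T ->
  (forall x y, Rabs (g x - g y) <= L * Rabs (x - y)) ->
  (forall x h, Rabs (g (x + h) + g (x - h) - 2 * g x) <= K * h ^ 2) ->
  exists U C, (forall y, U y 0 = g y) /\ trunc_sol c C T U /\
    (forall y t s, 0 <= t <= T -> 0 <= s <= T -> Rabs (U y t - U y s) <= C * Rabs (t - s)).
Proof.
  intros Hc HT Hg Hg2. destruct (cutoff_bounds c Hc) as [B1 [B2 [B3 B4]]].
  assert (HL : 0 <= L).
  { pose proof (Hg 1 0) as H. rewrite Rminus_0_r, Rabs_R1 in H. pose proof (Rabs_pos (g 1 - g 0)). lra. }
  assert (HK : 0 <= K).
  { pose proof (Hg2 0 1) as H. pose proof (Rabs_pos (g (0 + 1) + g (0 - 1) - 2 * g 0)). lra. }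
  destruct (truncated_existence (cutoff c) g (/ c ^ 2) (/ c) L K T B1 B2 HL HK HT B3 B4 Hg Hg2)
    as [U [C [H1 [H2 H3]]]].
  exists U, C. split; [exact H1 | split; [split |]].
  - apply lip_cont_on with C T; [lra | exact H2].
  - exact H3.
  - intros y t s Ht Hs. specialize (H2 y y t s Ht Hs). rewrite Rminus_diag, Rabs_R0, Rplus_0_l in H2. exact H2.
Qed.

Lemma trunc_jet (c C T : R) (U : R -> R -> R) (y t : R) : trunc_sol c C T U -> 0 < t < T ->
  exists p q, jet U y t (q / (1 + p ^ 2) - cutoff c (U y t)) p q /\ Rabs p <= C /\ Rabs q <= C.
Proof.
  intros [_ H] Ht. exists (u_y U y t), (u_yy U y t). destruct (H y t Ht) as [_ [E [B1 B2]]].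
  rewrite <- E. split; [| split]; auto. apply C21_jet. intros z. now apply H.
Qed.

(** As long as [u] stays above [c] it also solves the cut-off equation, and [U] supplies the bounded
    derivatives. Together with [trunc_le_mcf] this identifies [U] with any classical flow having the
    same initial profile. *)
Lemma mcf_le_trunc (c C T : R) (u U : R -> R -> R) : 0 < c -> mcf_on T u -> trunc_sol c C T U ->
  (forall y t, 0 <= t < T -> c <= u y t) -> (forall y, u y 0 <= U y 0) ->
  forall y t, 0 <= t < T -> u y t <= U y t.
Proof.
  intros Hc Hu HU Hlow Hinit y t Ht. destruct (cutoff_bounds c Hc) as [B1 [B2 [B3 B4]]].
  apply (comparison (cutoff c) (/ c ^ 2) C T m_infty u U); auto; try apply Hu; try apply HU.
  - intros z s _ Hs. destruct (mcf_on_jet T u z s Hu Hs) as [p [q J]].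
    eexists _, p, q. split; [exact J |]. rewrite cutoff_ge by (apply Hlow; lra). lra.
  - intros z s _ Hs. destruct (trunc_jet c C T U z s HU Hs) as [p [q [J [Q1 Q2]]]].
    eexists _, p, q. split; [exact J |]. repeat split; auto. lra.
  - intros l s Hl. discriminate.
  - exact I.
Qed.

Lemma trunc_le_mcf (c C T : R) (u U : R -> R -> R) : 0 < c -> mcf_on T u -> trunc_sol c C T U ->
  (forall y t, 0 <= t < T -> c <= u y t) -> (forall y, U y 0 <= u y 0) ->
  forall y t, 0 <= t < T -> U y t <= u y t.
Proof.
  intros Hc Hu HU Hlow Hinit y t Ht. destruct (cutoff_bounds c Hc) as [B1 [B2 [B3 B4]]].
  apply (comparison_bounded_sub (cutoff c) (/ c ^ 2) C T U u); auto; try apply Hu; try apply HU.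
  - intros z s Hs. destruct (trunc_jet c C T U z s HU Hs) as [p [q [J [Q1 Q2]]]].
    eexists _, p, q. split; [exact J |]. repeat split; auto. lra.
  - intros z s Hs. destruct (mcf_on_jet T u z s Hu Hs) as [p [q J]].
    eexists _, p, q. split; [exact J |]. rewrite cutoff_ge by (apply Hlow; lra). lra.
Qed.

Lemma trunc_is_mcf (c C T : R) (U : R -> R -> R) : 0 < c -> trunc_sol c C T U ->
  (forall y t, 0 <= t < T -> c <= U y t) -> mcf_on T U.
Proof.
  intros Hc [H1 H2] Hlow. split; [exact H1 | split].
  - intros y t Ht. specialize (Hlow y t Ht). lra.
  - intros y t Ht. destruct (H2 y t Ht) as [H3 [H4 _]]. split; [exact H3 |].
    rewrite H4, cutoff_ge; [reflexivity |]. apply Hlow. lra.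
Qed.

Lemma trunc_sol_le (c C T T' : R) (U : R -> R -> R) : T' <= T -> trunc_sol c C T U -> trunc_sol c C T' U.
Proof.
  intros HT [H1 H2]. split.
  - intros y t Ht. apply H1. lra.
  - intros y t Ht. apply H2. lra.
Qed.

Lemma cont_on_filterlim (u : R -> R -> R) (y t : R) :
  (forall eps, 0 < eps -> exists d, 0 < d /\ forall z s, 0 <= s -> Rabs (z - y) < d -> Rabs (s - t) < d ->
    Rabs (u z s - u y t) < eps) <->
  filterlim (fun p : R * R => u (fst p) (snd p))
       (within (fun p : R * R => 0 <= snd p) (locally (y, t)))
       (locally (u y t)).
Proof.
  split.
  - intros H. apply filterlim_locally. intros eps. destruct (H eps (cond_pos eps)) as [d [Hd Hd']].
    exists (mkposreal d Hd). intros [z s] [Hz Hs] Hs0. simpl in *. now apply Hd'.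
  - intros H eps He. destruct (proj1 (filterlim_locally _ _) H (mkposreal eps He)) as [d Hd].
    exists d. split; [apply cond_pos |]. intros z s Hs Hz Hst.
    apply (Hd (z, s)); [split; simpl; assumption | exact Hs].
Qed.

Lemma mcf_solution_on (M : R * R * R -> Prop) (T : Rbar) (T' : R) (u : R -> R -> R) :
  mcf_solution M T u -> Rbar_le T' T -> mcf_on T' u.
Proof.
  intros [H1 [H2 [_ H4]]] HT.
  assert (Hlt : forall t, t < T' -> Rbar_lt t T).
  { intros t Ht. apply Rbar_lt_le_trans with (Finite T'); [exact Ht | exact HT]. }
  split; [| split].
  - intros y t Ht. apply (cont_on_filterlim u y t). apply H2; [lra | apply Hlt; lra].
  - intros y t Ht. apply H1; [lra | apply Hlt; lra].
  - intros y t Ht. apply H4; [lra | apply Hlt; lra].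
Qed.

Lemma on_mcf_solution (M : R * R * R -> Prop) (T : R) (u : R -> R -> R) :
  (forall x, M x <-> rev_surface (fun y => u y 0) x) -> mcf_on T u -> mcf_solution M T u.
Proof.
  intros HM [H1 [H2 H3]]. split; [| split; [| split]].
  - intros y t H0 Ht. apply H2. simpl in Ht. lra.
  - intros y t H0 Ht. apply cont_on_filterlim. apply H1. simpl in Ht. lra.
  - exact HM.
  - intros y t H0 Ht. apply H3. simpl in Ht. lra.
Qed.

(** The point [(y, v y, 0)] of the surface reads off the profile, since [sqrt (v y ^ 2) = v y]. *)
Lemma rev_surface_inj (v w : R -> R) : (forall y, 0 <= v y) ->
  (forall x, rev_surface v x <-> rev_surface w x) -> forall y, w y = v y.
Proof.
  intros Hv H y. destruct (H (y, v y, 0)) as [H1 _]. unfold rev_surface in H1.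
  assert (E : sqrt (v y ^ 2 + 0 ^ 2) = v y).
  { replace (v y ^ 2 + 0 ^ 2) with (v y ^ 2) by ring. now apply sqrt_pow2. }
  rewrite E in H1. symmetry. now apply H1.
Qed.

Record profile_facts (alpha : R) (ua : R -> R) : Prop := {
  profile_nonneg : forall y, 0 <= ua y;
  profile_lower : exists C0, forall y, tan alpha ^ 2 * y ^ 2 - C0 <= ua y ^ 2;
  profile_upper : exists C1, 0 < C1 /\ forall y, ua y ^ 2 <= C1 + tan alpha ^ 2 * y ^ 2;
  profile_regular : exists L K, (forall x y, Rabs (ua x - ua y) <= L * Rabs (x - y)) /\
    (forall x h, Rabs (ua (x + h) + ua (x - h) - 2 * ua x) <= K * h ^ 2) }.

Lemma smoothing_profile_facts (alpha : R) (ua : R -> R) : 0 < alpha < PI / 2 ->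
  smoothing_profile alpha ua -> profile_facts alpha ua.
Proof.
  intros Ha [[a [b [Hab [Hout Hin]]]] [beta [Hbeta [HC1 [HC2 [C HC3]]]]]].
  set (gam := tan alpha) in *.
  assert (Hg : 0 < gam) by (apply tan_gt_0; lra).
  assert (Hcase : forall y, (y <= a \/ b <= y) \/ a <= y <= b) by (intros; lra).
  assert (Hg2 : forall y, 0 <= gam ^ 2 * y ^ 2).
  { intros y. apply Rmult_le_pos; apply pow2_ge_0. }
  assert (Hsq : forall y, y <= a \/ b <= y -> ua y ^ 2 = gam ^ 2 * y ^ 2).
  { intros y Hy. rewrite (Hout y Hy), Rpow_mult_distr, pow2_abs. reflexivity. }
  assert (Hpos : forall y, b < y -> is_derive ua y gam).
  { intros y Hy. apply (is_derive_ext_loc (fun y => gam * y)).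
    - exists (mkposreal (y - b) ltac:(lra)). intros z Hz. change (Rabs (z - y) < y - b) in Hz.
      apply Rabs_def2 in Hz. rewrite Hout by lra. rewrite Rabs_pos_eq; lra.
    - auto_derive; [exact I | ring]. }
  assert (Hneg : forall y, y < a -> is_derive ua y (- gam)).
  { intros y Hy. apply (is_derive_ext_loc (fun y => - gam * y)).
    - exists (mkposreal (a - y) ltac:(lra)). intros z Hz. change (Rabs (z - y) < a - y) in Hz.
      apply Rabs_def2 in Hz. rewrite Hout by lra. rewrite Rabs_left1; lra.
    - auto_derive; [exact I | ring]. }
  assert (Hpos2 : forall y, b < y -> Derive (Derive ua) y = 0).
  { intros y Hy. rewrite (Derive_ext_loc _ (fun _ => gam)); [apply Derive_const |].
    exists (mkposreal (y - b) ltac:(lra)). intros z Hz. change (Rabs (z - y) < y - b) in Hz.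
    apply Rabs_def2 in Hz. apply is_derive_unique, Hpos. lra. }
  assert (Hneg2 : forall y, y < a -> Derive (Derive ua) y = 0).
  { intros y Hy. rewrite (Derive_ext_loc _ (fun _ => - gam)); [apply Derive_const |].
    exists (mkposreal (a - y) ltac:(lra)). intros z Hz. change (Rabs (z - y) < a - y) in Hz.
    apply Rabs_def2 in Hz. apply is_derive_unique, Hneg. lra. }
  (* The second derivative vanishes at [b + 1], where the profile is linear, so the Hoelder
     condition against that point bounds it on [[a, b]]. Integrating back from [b + 1] then bounds
     the slope by [L]. *)
  set (K := Rabs C * Rpower (b + 1 - a) beta).
  assert (HRp : 0 < Rpower (b + 1 - a) beta) by apply exp_pos.
  assert (HK0 : 0 <= K) by (unfold K; apply Rmult_le_pos; [apply Rabs_pos | lra]).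
  assert (HK : forall x, Rabs (Derive (Derive ua) x) <= K).
  { intros x. destruct (Rlt_le_dec x a) as [H | H]; [rewrite Hneg2, Rabs_R0; auto |].
    destruct (Rlt_le_dec b x) as [H' | H']; [rewrite Hpos2, Rabs_R0; auto |].
    pose proof (HC3 x (b + 1) ltac:(lra)) as H3. simpl in H3.
    change (Derive (fun x => Derive (fun x => ua x) x) x) with (Derive (Derive ua) x) in H3.
    change (Derive (fun x => Derive (fun x => ua x) x) (b + 1)) with (Derive (Derive ua) (b + 1)) in H3.
    rewrite (Hpos2 (b + 1)), Rminus_0_r in H3 by lra. eapply Rle_trans; [exact H3 |].
    unfold K. pose proof (Rle_abs C).
    assert (HRp2 : 0 < Rpower (Rabs (x - (b + 1))) beta) by apply exp_pos.
    assert (Rpower (Rabs (x - (b + 1))) beta <= Rpower (b + 1 - a) beta).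
    { apply Rle_Rpower_l; [lra |]. rewrite Rabs_left by lra. lra. }
    pose proof (Rabs_pos C). nra. }
  set (L := gam + K * (b + 1 - a)).
  assert (HKb : 0 <= K * (b + 1 - a)) by (apply Rmult_le_pos; lra).
  assert (HL : forall x, Rabs (Derive ua x) <= L).
  { intros x. destruct (Rlt_le_dec x a) as [H | H].
    { rewrite (is_derive_unique _ _ _ (Hneg x H)), Rabs_Ropp, Rabs_pos_eq; unfold L; lra. }
    destruct (Rlt_le_dec b x) as [H' | H'].
    { rewrite (is_derive_unique _ _ _ (Hpos x H')), Rabs_pos_eq; unfold L; lra. }
    destruct (MVT_gen (Derive ua) x (b + 1) (Derive (Derive ua))) as [c [_ Hc]].
    - intros z _. apply Derive_correct, HC2.
    - intros z _. apply continuity_pt_filterlim. apply (ex_derive_continuous (Derive ua)), HC2.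
    - rewrite (is_derive_unique _ _ _ (Hpos (b + 1) ltac:(lra))) in Hc.
      replace (Derive ua x) with (gam - Derive (Derive ua) c * (b + 1 - x)) by lra.
      pose proof (HK c) as Hcc. apply Rabs_le_between in Hcc. unfold L.
      apply Rabs_le. split; nra. }
  split; fold gam.
  - intros y. destruct (Hcase y) as [H | H].
    + rewrite Hout by exact H. apply Rmult_le_pos; [lra | apply Rabs_pos].
    + left. now apply Hin.
  - exists (gam ^ 2 * (a ^ 2 + b ^ 2)). intros y.
    assert (0 <= gam ^ 2 * (a ^ 2 + b ^ 2)) by (pose proof (Hg2 a); pose proof (Hg2 b); lra).
    destruct (Hcase y) as [H' | H'].
    + rewrite Hsq by exact H'. lra.
    + assert (y ^ 2 <= a ^ 2 + b ^ 2) by (pose proof (pow2_ge_0 a); pose proof (pow2_ge_0 b); destruct (Rle_lt_dec 0 y); nra).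
      assert (gam ^ 2 * y ^ 2 <= gam ^ 2 * (a ^ 2 + b ^ 2)) by (apply Rmult_le_compat_l; nra).
      pose proof (pow2_ge_0 (ua y)). lra.
  - destruct (smooth_data ua (Derive ua) (Derive (Derive ua)) L K) as [Hl _]; auto;
      [intros; now apply Derive_correct | intros; now apply Derive_correct |].
    set (m := Rabs (ua a) + L * (b - a)).
    assert (Hm : 0 <= m).
    { unfold m. pose proof (Rabs_pos (ua a)). assert (0 <= L * (b - a)) by (unfold L; apply Rmult_le_pos; lra). lra. }
    exists (m ^ 2 + 1). split; [pose proof (pow2_ge_0 m); lra |]. intros y.
    destruct (Hcase y) as [H' | H'].
    + rewrite Hsq by exact H'. pose proof (pow2_ge_0 m). lra.
    + assert (Rabs (ua y) <= m).
      { replace (ua y) with (ua a + (ua y - ua a)) by ring.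
        eapply Rle_trans; [apply Rabs_triang |]. unfold m. apply Rplus_le_compat_l.
        eapply Rle_trans; [apply Hl |]. apply Rmult_le_compat_l; [unfold L; lra |].
        rewrite Rabs_pos_eq; lra. }
      rewrite <- (pow2_abs (ua y)).
      assert (Rabs (ua y) ^ 2 <= m ^ 2) by (apply pow_incr; split; [apply Rabs_pos | exact H]).
      pose proof (Hg2 y). lra.
  - exists L, (2 * K). apply (smooth_data ua (Derive ua) (Derive (Derive ua)) L K); auto;
      intros; now apply Derive_correct.
Qed.

Lemma inf_profile_le (u : R -> R -> R) (t : R) : (forall y, 0 < u y t) ->
  0 <= inf_profile u t /\ forall y, inf_profile u t <= u y t.
Proof.
  intros Hu. unfold inf_profile.
  destruct (Glb_Rbar_correct (fun z => exists y, z = u y t)) as [H1 H2].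
  assert (H3 : Rbar_le 0 (Glb_Rbar (fun z => exists y, z = u y t))).
  { apply H2. intros z [y ->]. simpl. left. apply Hu. }
  assert (H4 : forall y, Rbar_le (Glb_Rbar (fun z => exists y, z = u y t)) (u y t)).
  { intros y. apply H1. now exists y. }
  destruct (Glb_Rbar (fun z => exists y, z = u y t)); simpl in *; try easy.
Qed.

Theorem finite_time_pinching (alpha T : R) (ua : R -> R) (M : R * R * R -> Prop) (u : R -> R -> R) :
  0 < alpha < PI / 2 -> profile_facts alpha ua -> 0 < T -> mcf_solution M T u ->
  (forall y, u y 0 = ua y) -> ~ (exists (T' : Rbar) (v : R -> R -> R),
       Rbar_lt T T' /\ mcf_solution M T' v /\ forall y t, 0 <= t -> Rbar_lt t T -> v y t = u y t) ->
  filterlim (inf_profile u) (at_left T) (locally 0).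
Proof.
  intros Ha Hua HT Hsol Hu0 Hmax.
  assert (Hg : 0 < tan alpha) by (apply tan_gt_0; lra).
  pose proof (mcf_solution_on M T T u Hsol (Rbar_le_refl T)) as Hu.
  apply filterlim_locally. intros eps. apply NNPP. intros Hn.
  pose proof (cond_pos eps) as He.
  (* Spheres of radius [eps] placed at a time later than [T - delta] still have squared radius at
     least [eps ^ 2 / 2] at time [T]. *)
  set (delta := Rmin (eps ^ 2 / 8) T).
  assert (Hdelta : 0 < delta) by (apply Rmin_glb_lt; nra).
  assert (Ht1 : exists t1, T - delta < t1 < T /\ eps <= inf_profile u t1).
  { apply NNPP. intros Hn2. apply Hn. exists (mkposreal delta Hdelta). intros t Ht HtT.
    change (Rabs (t - T) < delta) in Ht. apply Rabs_def2 in Ht.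
    assert (Hdl : delta <= T) by apply Rmin_r.
    destruct (inf_profile_le u t) as [I1 _]; [intros; apply Hu; lra |].
    change (Rabs (inf_profile u t - 0) < eps). rewrite Rminus_0_r, Rabs_pos_eq by exact I1.
    apply Rnot_le_lt. intros Hle. apply Hn2. exists t. split; [lra | exact Hle]. }
  destruct Ht1 as [t1 [Ht1 Hinf]].
  assert (Hdl : delta <= T) by apply Rmin_r. assert (Hdl2 : delta <= eps ^ 2 / 8) by apply Rmin_l.
  destruct (inf_profile_le u t1) as [_ I2]; [intros; apply Hu; lra |].
  destruct (profile_lower _ _ Hua) as [C0 HC0].
  destruct (uniform_lower_bound T t1 (tan alpha) C0 u Hu Hg) as [c1 [Hc1 Hlow1]];
    [intros y; rewrite Hu0; apply HC0 | lra |].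
  (* Half of the lower bound of [u]: the slack lets the cut-off solution fall a little after [T] and
     still exceed [c]. *)
  set (c := Rmin c1 (eps / 2) / 2).
  assert (Hm0 : 0 < Rmin c1 (eps / 2)) by (apply Rmin_glb_lt; lra).
  assert (Hc : 0 < c) by (unfold c; lra).
  assert (Hlow : forall y t, 0 <= t < T -> 2 * c <= u y t).
  { intros y t Ht. unfold c.
    pose proof (Rmin_l c1 (eps / 2)). pose proof (Rmin_r c1 (eps / 2)).
    destruct (Rle_lt_dec t t1) as [H1 | H1].
    - specialize (Hlow1 y t ltac:(lra)). lra.
    - pose proof (sphere_lower T t1 (eps ^ 2) y u Hu ltac:(lra)) as Hs.
      assert (Hs0 : forall z, eps ^ 2 - (z - y) ^ 2 <= u z t1 ^ 2).
      { intros z. specialize (I2 z). pose proof (pow2_ge_0 (z - y)).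
        assert (pos eps ^ 2 <= u z t1 ^ 2) by (apply pow_incr; lra). lra. }
      specialize (Hs Hs0 y t ltac:(lra)). rewrite Rminus_diag in Hs.
      assert (0 < u y t) by (apply Hu; lra).
      assert (eps / 2 <= u y t); [| lra]. nra. }
  destruct (profile_regular _ _ Hua) as [L [K [HL HK]]].
  destruct (trunc_exists ua L K c (T + 1) Hc ltac:(lra) HL HK) as [U [C [HU0 [HU HUt]]]].
  assert (HUu : forall y t, 0 <= t < T -> U y t = u y t).
  { intros y t Ht. pose proof (trunc_sol_le c C (T + 1) T U ltac:(lra) HU) as HU'.
    assert (Hl : forall y t, 0 <= t < T -> c <= u y t) by (intros z s Hs; specialize (Hlow z s Hs); lra).
    apply Rle_antisym.
    - apply (trunc_le_mcf c C T u U); auto. intros z. rewrite HU0, Hu0. lra.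
    - apply (mcf_le_trunc c C T u U); auto. intros z. rewrite HU0, Hu0. lra. }
  assert (HC : 0 <= C).
  { destruct HU as [_ H]. destruct (H 0 (T / 2) ltac:(lra)) as [_ [_ [H1 _]]].
    pose proof (Rabs_pos (u_y U 0 (T / 2))). lra. }
  (* From some time in [[T - r, T)] to a time before [T + r] the Lipschitz function [U] loses at
     most [2 * r * C <= c] of its margin [2 * c]. *)
  set (r := Rmin 1 (c / (2 * (C + 1)))).
  assert (Hr : 0 < r) by (apply Rmin_glb_lt; [lra | apply Rdiv_lt_0_compat; lra]).
  assert (Hr1 : r <= 1) by apply Rmin_l.
  assert (HrC : C * r <= c / 2).
  { assert (H : r <= c / (2 * (C + 1))) by apply Rmin_r.
    apply (Rmult_le_compat_l (C + 1)) in H; [| lra].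
    replace ((C + 1) * (c / (2 * (C + 1)))) with (c / 2) in H by (field; lra). nra. }
  assert (HlowU : forall y t, 0 <= t < T + r -> c <= U y t).
  { intros y t Ht. destruct (Rlt_le_dec t T) as [H | H].
    - rewrite HUu by lra. specialize (Hlow y t ltac:(lra)). lra.
    - set (s := T - Rmin (T / 2) r).
      pose proof (Rmin_l (T / 2) r). pose proof (Rmin_r (T / 2) r).
      assert (0 < Rmin (T / 2) r) by (apply Rmin_glb_lt; lra).
      pose proof (HUt y t s ltac:(lra) ltac:(unfold s; lra)) as H3.
      assert (H4 : U y s = u y s) by (apply HUu; unfold s; lra).
      pose proof (Hlow y s ltac:(unfold s; lra)) as H5.
      rewrite (Rabs_pos_eq (t - s)) in H3 by (unfold s; lra).
      apply Rabs_le_between in H3.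
      assert (C * (t - s) <= C * (2 * r)) by (apply Rmult_le_compat_l; [lra | unfold s; lra]).
      lra. }
  apply Hmax. exists (Finite (T + r)), U. split; [simpl; lra | split].
  - apply on_mcf_solution.
    + intros x. destruct Hsol as [_ [_ [H _]]]. rewrite (H x). destruct x as [[x1 x2] x3]. simpl.
      rewrite (HUu x1 0) by lra. reflexivity.
    + apply trunc_is_mcf with c C; auto. apply trunc_sol_le with (T + 1); auto. lra.
  - intros y t H1 H2. apply HUu. simpl in H2. lra.
Qed.

(** * The global solution above an eternal one *)

(** One chain rule for translations, reflections and parabolic dilations. *)
Lemma jet_affine (v : R -> R -> R) (lam m n k y t d p q : R) :
  jet v (m * y + n) (k * t) d p q ->
  jet (fun z s => lam * v (m * z + n) (k * s)) y t (lam * k * d) (lam * m * p) (lam * m ^ 2 * q).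
Proof.
  intros Hj. destruct (jet_derive_loc _ _ _ _ _ _ Hj) as [r [Hr Hvr]].
  destruct Hj as [H1 [_ [H2 H3]]]. rewrite <- H2.
  pose proof (Rabs_pos m) as Hm.
  assert (Hlin : forall (g : R -> R) (a b x l : R), is_derive g (a * x + b) l -> is_derive (fun z => g (a * z + b)) x (a * l)).
  { intros g a b x l Hg. apply (is_derive_comp g (fun z => a * z + b)); [exact Hg |]. auto_derive; [exact I | ring]. }
  apply (jet_intro _ (fun z => lam * m * Derive (fun x => v x (k * t)) (m * z + n)) y t _ _ (r / (Rabs m + 1))).
  - apply Rdiv_lt_0_compat; lra.
  - rewrite Rmult_assoc. apply is_derive_scal.
    apply (is_derive_ext (fun s => v (m * y + n) (k * s + 0))); [intros s; f_equal; ring |].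
    apply (Hlin (fun s => v (m * y + n) s)). rewrite Rplus_0_r. exact H1.
  - intros z Hz. rewrite Rmult_assoc. apply is_derive_scal.
    apply (Hlin (fun x => v x (k * t))). apply Hvr.
    replace (m * z + n - (m * y + n)) with (m * (z - y)) by ring. rewrite Rabs_mult.
    apply (Rmult_lt_compat_l (Rabs m + 1)) in Hz; [| lra].
    replace ((Rabs m + 1) * (r / (Rabs m + 1))) with r in Hz by (field; lra).
    pose proof (Rabs_pos (z - y)). lra.
  - replace (lam * m ^ 2 * q) with (lam * m * (m * q)) by ring. apply is_derive_scal.
    apply (Hlin (fun x => Derive (fun x0 => v x0 (k * t)) x)). exact H3.
Qed.

Lemma cont_on_affine (v : R -> R -> R) (lam m n k T T' : R) : 0 < k -> k * T' <= T -> cont_on v T ->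
  cont_on (fun z s => lam * v (m * z + n) (k * s)) T'.
Proof.
  intros Hk HT Hv y t Ht e He.
  assert (Hkt : 0 <= k * t < T) by nra.
  pose proof (Rabs_pos lam) as Hl. pose proof (Rabs_pos m) as Hm.
  assert (He' : 0 < e / (Rabs lam + 1)) by (apply Rdiv_lt_0_compat; lra).
  destruct (Hv (m * y + n) (k * t) Hkt _ He') as [d [Hd Hd']].
  exists (d / (Rabs m + k)). split; [apply Rdiv_lt_0_compat; lra |].
  intros z s Hs Hz Hst.
  apply (Rmult_lt_compat_l (Rabs m + k)) in Hz; [| lra]. apply (Rmult_lt_compat_l (Rabs m + k)) in Hst; [| lra].
  replace ((Rabs m + k) * (d / (Rabs m + k))) with d in Hz, Hst by (field; lra).
  pose proof (Rabs_pos (z - y)) as Hz0. pose proof (Rabs_pos (s - t)) as Hs0.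
  assert (Q : Rabs (v (m * z + n) (k * s) - v (m * y + n) (k * t)) < e / (Rabs lam + 1)).
  { apply Hd'; [nra | |].
    - replace (m * z + n - (m * y + n)) with (m * (z - y)) by ring. rewrite Rabs_mult. nra.
    - replace (k * s - k * t) with (k * (s - t)) by ring. rewrite Rabs_mult, (Rabs_pos_eq k) by lra. nra. }
  rewrite <- Rmult_minus_distr_l, Rabs_mult.
  apply (Rmult_lt_compat_l (Rabs lam + 1)) in Q; [| lra].
  replace ((Rabs lam + 1) * (e / (Rabs lam + 1))) with e in Q by (field; lra).
  pose proof (Rabs_pos (v (m * z + n) (k * s) - v (m * y + n) (k * t))). nra.
Qed.

(** The class in which comparison works from both sides: derivatives are bounded, and the cut-off is
    never active because the solution stays above [c]. *)
Definition regular_on (T : R) (V : R -> R -> R) : Prop :=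
  exists c C, 0 < c /\ trunc_sol c C T V /\ forall y t, 0 <= t < T -> c <= V y t.

Definition bounded_below_on (T : R) (u : R -> R -> R) : Prop :=
  exists c, 0 < c /\ forall y t, 0 <= t < T -> c <= u y t.

Lemma regular_on_mcf (T : R) (V : R -> R -> R) : regular_on T V -> mcf_on T V.
Proof. intros [c [C [Hc [HV Hl]]]]. now apply trunc_is_mcf with c C. Qed.

Lemma regular_on_bounded (T : R) (V : R -> R -> R) : regular_on T V -> bounded_below_on T V.
Proof. intros [c [C [Hc [HV Hl]]]]. now exists c. Qed.

Lemma regular_jet (T : R) (V : R -> R -> R) : regular_on T V -> exists C, forall y t, 0 < t < T ->
  exists p q, jet V y t (q / (1 + p ^ 2) - 1 / V y t) p q /\ Rabs p <= C /\ Rabs q <= C.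
Proof.
  intros [c [C [Hc [HV Hl]]]]. exists C. intros y t Ht.
  destruct (trunc_jet c C T V y t HV Ht) as [p [q H]]. exists p, q.
  rewrite cutoff_ge in H; [exact H |]. apply Hl. lra.
Qed.

Lemma jet_le_regular (T : R) (lo : Rbar) (u V : R -> R -> R) : regular_on T V ->
  cont_on u T -> bounded_below_on T u ->
  (forall y t, 0 < t < T -> exists p q, jet u y t (q / (1 + p ^ 2) - 1 / u y t) p q) ->
  (forall y : R, Rbar_le lo y -> u y 0 <= V y 0) ->
  (forall l t, lo = Finite l -> 0 <= t < T -> u l t <= V l t) ->
  forall (y t : R), Rbar_le lo y -> 0 <= t < T -> u y t <= V y t.
Proof.
  intros HV Hu [c1 [Hc1 Hl1]] HJ. destruct (regular_jet T V HV) as [C HC].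
  destruct (regular_on_bounded T V HV) as [c2 [Hc2 Hl2]].
  set (c := Rmin c1 c2). assert (Hc : 0 < c) by now apply Rmin_glb_lt.
  assert (Ha : forall y t, 0 <= t < T -> c <= u y t).
  { intros y t Ht. eapply Rle_trans; [apply Rmin_l | now apply Hl1]. }
  assert (Hb : forall y t, 0 <= t < T -> c <= V y t).
  { intros y t Ht. eapply Rle_trans; [apply Rmin_r | now apply Hl2]. }
  destruct (cutoff_bounds c Hc) as [B1 [B2 [B3 B4]]].
  apply (comparison (cutoff c) (/ c ^ 2) C T lo u V); auto.
  - apply (regular_on_mcf T V HV).
  - intros y t _ Ht. destruct (HJ y t Ht) as [p [q J]]. eexists _, p, q. split; [exact J |].
    rewrite cutoff_ge by (apply Ha; lra). lra.
  - intros y t _ Ht. destruct (HC y t Ht) as [p [q [J [Q1 Q2]]]]. eexists _, p, q. split; [exact J |].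
    rewrite cutoff_ge by (apply Hb; lra). repeat split; auto. lra.
Qed.

Lemma regular_le_super (T : R) (V S : R -> R -> R) : regular_on T V ->
  cont_on S T -> bounded_below_on T S ->
  (forall y t, 0 < t < T -> exists d p q, jet S y t d p q /\ q / (1 + p ^ 2) - 1 / S y t <= d) ->
  (forall y, V y 0 <= S y 0) ->
  forall y t, 0 <= t < T -> V y t <= S y t.
Proof.
  intros HV HS [c1 [Hc1 Hl1]] HJ. destruct (regular_jet T V HV) as [C HC].
  destruct (regular_on_bounded T V HV) as [c2 [Hc2 Hl2]].
  set (c := Rmin c1 c2). assert (Hc : 0 < c) by now apply Rmin_glb_lt.
  assert (Ha : forall y t, 0 <= t < T -> c <= S y t).
  { intros y t Ht. eapply Rle_trans; [apply Rmin_l | now apply Hl1]. }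
  assert (Hb : forall y t, 0 <= t < T -> c <= V y t).
  { intros y t Ht. eapply Rle_trans; [apply Rmin_r | now apply Hl2]. }
  destruct (cutoff_bounds c Hc) as [B1 [B2 [B3 B4]]].
  apply (comparison_bounded_sub (cutoff c) (/ c ^ 2) C T V S); auto.
  - apply (regular_on_mcf T V HV).
  - intros y t Ht. destruct (HC y t Ht) as [p [q [J [Q1 Q2]]]]. eexists _, p, q. split; [exact J |].
    rewrite cutoff_ge by (apply Hb; lra). repeat split; auto. lra.
  - intros y t Ht. destruct (HJ y t Ht) as [d [p [q [J E]]]]. exists d, p, q. split; [exact J |].
    rewrite cutoff_ge by (apply Ha; lra). exact E.
Qed.

Lemma regular_le (T : R) (V W : R -> R -> R) : regular_on T V -> regular_on T W ->
  (forall y, V y 0 <= W y 0) -> forall y t, 0 <= t < T -> V y t <= W y t.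
Proof.
  intros HV HW H0. pose proof (regular_on_mcf T W HW) as HWm.
  apply regular_le_super; auto; [apply HWm | now apply regular_on_bounded |].
  intros y t Ht. destruct (mcf_on_jet T W y t HWm Ht) as [p [q J]].
  eexists _, p, q. split; [exact J | lra].
Qed.

Lemma regular_on_le (T T' : R) (V : R -> R -> R) : T' <= T -> regular_on T V -> regular_on T' V.
Proof.
  intros HT [c [C [Hc [HV Hl]]]]. exists c, C. split; [exact Hc | split].
  - now apply trunc_sol_le with T.
  - intros y t Ht. apply Hl. lra.
Qed.

Lemma C21_ext (V W : R -> R -> R) (T y t : R) : (forall z s, 0 <= s < T -> V z s = W z s) -> 0 < t < T ->
  C21_at W y t -> C21_at V y t /\ u_t V y t = u_t W y t /\ u_y V y t = u_y W y t /\ u_yy V y t = u_yy W y t.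
Proof.
  intros E Ht [H1 [H2 [H3 [H4 [H5 H6]]]]].
  assert (Hloc : forall s, 0 < s < T -> locally s (fun r => 0 <= r < T)).
  { intros s Hs. assert (Hm : 0 < Rmin s (T - s)) by (apply Rmin_glb_lt; lra).
    exists (mkposreal _ Hm). intros r Hr. change (Rabs (r - s) < Rmin s (T - s)) in Hr. apply Rabs_def2 in Hr.
    pose proof (Rmin_l s (T - s)). pose proof (Rmin_r s (T - s)). lra. }
  assert (Et : forall z s, 0 < s < T -> u_t V z s = u_t W z s).
  { intros z s Hs. apply Derive_ext_loc. generalize (Hloc s Hs). apply filter_imp. intros r Hr. now apply E. }
  assert (Ey : forall z s, 0 < s < T -> u_y V z s = u_y W z s).
  { intros z s Hs. apply Derive_ext. intros x. apply E. lra. }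
  assert (Eyy : forall z s, 0 < s < T -> u_yy V z s = u_yy W z s).
  { intros z s Hs. unfold u_yy. apply Derive_n_ext. intros x. apply E. lra. }
  assert (Hloc2 : forall F G : R -> R -> R, (forall z s, 0 < s < T -> F z s = G z s) ->
     continuous (fun p : R * R => G (fst p) (snd p)) (y, t) -> continuous (fun p : R * R => F (fst p) (snd p)) (y, t)).
  { intros F G EFG HG. apply (continuity_2d_pt_filterlim F). apply (continuity_2d_pt_filterlim G) in HG.
    apply continuity_2d_pt_ext_loc with G; [| exact HG].
    assert (Hm : 0 < Rmin t (T - t)) by (apply Rmin_glb_lt; lra).
    exists (mkposreal _ Hm). simpl. intros z s _ Hs. apply Rabs_def2 in Hs.
    pose proof (Rmin_l t (T - t)). pose proof (Rmin_r t (T - t)). symmetry. apply EFG. lra. }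
  split; [| split; [now apply Et | split; [now apply Ey | now apply Eyy]]].
  split; [| split; [| split; [| split; [| split]]]].
  - apply (ex_derive_ext_loc (fun s => W y s)); [| exact H1].
    generalize (Hloc t Ht). apply filter_imp. intros r Hr. symmetry. now apply E.
  - apply (ex_derive_ext (fun z => W z t)); [| exact H2]. intros z. symmetry. apply E. lra.
  - apply (ex_derive_ext (fun z => u_y W z t)); [| exact H3]. intros z. symmetry. now apply Ey.
  - now apply (Hloc2 (u_t V) (u_t W)).
  - now apply (Hloc2 (u_y V) (u_y W)).
  - now apply (Hloc2 (u_yy V) (u_yy W)).
Qed.

Lemma regular_on_ext (T T' : R) (V W : R -> R -> R) : T' <= T -> (forall y t, 0 <= t < T -> V y t = W y t) ->
  regular_on T W -> regular_on T' V.
Proof.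
  intros HT E [c [C [Hc [[HW1 HW2] Hl]]]]. exists c, C. split; [exact Hc | split; [split |]].
  - intros y t Ht e He. destruct (HW1 y t ltac:(lra) e He) as [d [Hd Hd']].
    assert (Hm : 0 < Rmin d (T - t)) by (apply Rmin_glb_lt; lra).
    exists (Rmin d (T - t)). split; [exact Hm |]. intros z s Hs Hz Hst.
    pose proof (Rmin_l d (T - t)). pose proof (Rmin_r d (T - t)). pose proof (Rabs_def2 _ _ Hst).
    rewrite !E by lra. apply Hd'; lra.
  - intros y t Ht. destruct (HW2 y t ltac:(lra)) as [H1 H2].
    destruct (C21_ext V W T y t E ltac:(lra) H1) as [H3 [E1 [E2 E3]]].
    rewrite E1, E2, E3, (E y t) by lra. split; auto.
  - intros y t Ht. rewrite E by lra. apply Hl. lra.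
Qed.

(** The constants of [regular_on] may depend on the horizon, so a global solution is assembled from
    finite ones, which agree on common times by [regular_le] in both directions. *)
Lemma glue_regular (g : R -> R) :
  (forall T, 0 < T -> exists U, (forall y, U y 0 = g y) /\ regular_on T U) ->
  exists V, (forall y, V y 0 = g y) /\ forall T, 0 < T -> regular_on T V.
Proof.
  intros H.
  assert (Hn : forall n : nat, exists U, (forall y, U y 0 = g y) /\ regular_on (INR n + 2) U).
  { intros n. apply H. pose proof (pos_INR n). lra. }
  set (W := fun n => proj1_sig (constructive_indefinite_description _ (Hn n))).
  assert (HW : forall n, (forall y, W n y 0 = g y) /\ regular_on (INR n + 2) (W n)).
  { intros n. exact (proj2_sig (constructive_indefinite_description _ (Hn n))). }
  assert (Huniq : forall n m y t, (n <= m)%nat -> 0 <= t < INR n + 2 -> W n y t = W m y t).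
  { intros n m y t Hnm Ht. destruct (HW n) as [A1 A2]. destruct (HW m) as [B1 B2].
    assert (B3 : regular_on (INR n + 2) (W m)).
    { apply regular_on_le with (INR m + 2); [apply le_INR in Hnm; lra | exact B2]. }
    apply Rle_antisym; apply (regular_le (INR n + 2)); auto; intros z; rewrite A1, B1; lra. }
  (* [idx 1 t] is the integer part of [t]. Piece [n] lives up to [n + 2], so before [n + 1] every
     piece selected has index at most [n] and agrees there with [W n]. *)
  exists (fun y t => W (idx 1 t) y t).
  assert (HVW : forall n y t, 0 <= t < INR n + 1 -> W (idx 1 t) y t = W n y t).
  { intros n y t Ht. pose proof (idx_spec 1 t Rlt_0_1 ltac:(lra)) as Hi. rewrite Rmult_1_r in Hi.
    apply Huniq; [| lra].
    apply Nat.lt_succ_r, INR_lt. rewrite S_INR. lra. }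
  split.
  - intros y. pose proof (HVW 0%nat y 0 ltac:(simpl; lra)) as E. simpl in E. rewrite E. apply HW.
  - intros T HT. destruct (nfloor_ex T ltac:(lra)) as [n [_ Hn2]].
    apply regular_on_ext with (INR n + 1) (W n); [lra | |].
    + intros y t Ht. now apply HVW.
    + apply regular_on_le with (INR n + 2); [lra | apply HW].
Qed.

Lemma is_derive_sqrt_comp (h : R -> R) (x l : R) : 0 < h x -> is_derive h x l ->
  is_derive (fun z => sqrt (h z)) x (l / (2 * sqrt (h x))).
Proof.
  intros Hx Hh. apply (is_derive_comp sqrt h x (/ (2 * sqrt (h x))) l); [| exact Hh].
  apply is_derive_Reals. now apply derivable_pt_lim_sqrt.
Qed.

(** * Growth, symmetry, scaling and necks of the solution starting from a hyperboloid *)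

Section Envelope.

Variables (gam C1 : R) (V : R -> R -> R).
Hypotheses (Hgam : 0 < gam) (HC1 : 0 < C1)
  (HV0 : forall y, V y 0 = sqrt (C1 + gam ^ 2 * y ^ 2))
  (HV : forall T, 0 < T -> regular_on T V).

Lemma radicand_pos (y : R) : 0 < C1 + gam ^ 2 * y ^ 2.
Proof. pose proof (Rmult_le_pos _ _ (pow2_ge_0 gam) (pow2_ge_0 y)). lra. Qed.

Lemma V_pos (y t : R) : 0 <= t -> 0 < V y t.
Proof. intros Ht. apply (regular_on_mcf (t + 1) V); [apply HV |]; lra. Qed.

Lemma V_lower (y t : R) : 0 <= t -> gam ^ 2 * y ^ 2 - 4 * t <= V y t ^ 2.
Proof.
  intros Ht.
  pose proof (cone_lower (t + 1) gam 0 V (regular_on_mcf _ _ (HV (t + 1) ltac:(lra)))) as H.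
  rewrite <- (Rminus_0_r (gam ^ 2 * y ^ 2)). apply H; [| lra].
  intros z. rewrite HV0, pow2_sqrt by (left; apply radicand_pos). lra.
Qed.

(** For [w = sqrt (C1 + gam^2 y^2 + 2 gam^2 t)] the time derivative [gam^2 / w] already dominates
    the second space derivative [gam^2 (w^2 - gam^2 y^2) / w^3], and the reaction term has a
    favourable sign. *)
Lemma V_upper (y t : R) : 0 <= t -> V y t ^ 2 <= C1 + gam ^ 2 * y ^ 2 + 2 * gam ^ 2 * t.
Proof.
  intros Ht.
  (* The absolute value keeps the radicand positive for every real [s], which matters for continuity
     at [s = 0]. *)
  set (B := fun z s => C1 + gam ^ 2 * z ^ 2 + 2 * gam ^ 2 * Rabs s).
  assert (HB : forall z s, C1 <= B z s).
  { intros z s. unfold B. pose proof (Rmult_le_pos _ _ (pow2_ge_0 gam) (pow2_ge_0 z)).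
    pose proof (Rmult_le_pos _ _ (pow2_ge_0 gam) (Rabs_pos s)). lra. }
  assert (HBr : forall z s, 0 < sqrt (B z s)) by (intros; apply sqrt_lt_R0; specialize (HB z s); lra).
  assert (HBs : forall z s, sqrt (B z s) ^ 2 = B z s) by (intros; apply pow2_sqrt; specialize (HB z s); lra).
  assert (Hle : V y t <= sqrt (B y t)).
  { apply (regular_le_super (t + 1) V (fun z s => sqrt (B z s))).
    - apply HV. lra.
    - intros z s Hs. apply (cont_on_filterlim (fun z s => sqrt (B z s)) z s).
      enough (Hcont : continuous (fun p : R * R => sqrt (B (fst p) (snd p))) (z, s)).
      { intros P HP. exact (filter_le_within (F := locally (z, s)) _ _ (Hcont P HP)). }
      apply (continuous_comp (fun p : R * R => B (fst p) (snd p)) sqrt (z, s)).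
      + unfold B.
        apply (continuous_plus (fun p : R * R => C1 + gam ^ 2 * fst p ^ 2) (fun p : R * R => 2 * gam ^ 2 * Rabs (snd p))).
        * apply (continuous_comp (fun p : R * R => fst p) (fun z => C1 + gam ^ 2 * z ^ 2)); [apply continuous_fst |].
          apply (ex_derive_continuous (fun z => C1 + gam ^ 2 * z ^ 2)). auto_derive. exact I.
        * apply (continuous_comp (fun p : R * R => snd p) (fun s => 2 * gam ^ 2 * Rabs s)); [apply continuous_snd |].
          apply (continuous_mult (fun _ => 2 * gam ^ 2) Rabs); [apply continuous_const | apply continuous_Rabs].
      + apply continuous_sqrt.
    - exists (sqrt C1). split; [now apply sqrt_lt_R0 |]. intros z s _. apply sqrt_le_1_alt, HB.
    - intros z s Hs. set (w := sqrt (B z s)).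
      assert (Hw : 0 < w) by apply HBr. assert (Hw2 : w ^ 2 = B z s) by apply HBs.
      assert (Hloc : forall r, 0 < r -> B z r = C1 + gam ^ 2 * z ^ 2 + 2 * gam ^ 2 * r).
      { intros r Hr. unfold B. now rewrite Rabs_pos_eq by lra. }
      exists (gam ^ 2 / w), (gam ^ 2 * z / w), (gam ^ 2 * (B z s - gam ^ 2 * z ^ 2) / w ^ 3).
      split.
      + apply (jet_intro (fun z s => sqrt (B z s)) (fun x => gam ^ 2 * x / sqrt (B x s)) z s _ _ 1 Rlt_0_1).
        * apply (is_derive_ext_loc (fun r => sqrt (C1 + gam ^ 2 * z ^ 2 + 2 * gam ^ 2 * r))).
          { exists (mkposreal s (proj1 Hs)). intros r Hr. change (Rabs (r - s) < s) in Hr.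
            apply Rabs_def2 in Hr. now rewrite Hloc by lra. }
          pose proof (Hloc s (proj1 Hs)) as Es. pose proof (HB z s).
          replace (gam ^ 2 / w) with (2 * gam ^ 2 / (2 * sqrt (C1 + gam ^ 2 * z ^ 2 + 2 * gam ^ 2 * s)))
            by (rewrite <- Es; fold w; field; lra).
          apply (is_derive_sqrt_comp (fun r => C1 + gam ^ 2 * z ^ 2 + 2 * gam ^ 2 * r)); [lra |].
          auto_derive; [exact I | ring].
        * intros x _. pose proof (HB x s). pose proof (HBr x s).
          replace (gam ^ 2 * x / sqrt (B x s)) with (2 * gam ^ 2 * x / (2 * sqrt (B x s))) by (field; lra).
          apply (is_derive_sqrt_comp (fun x => B x s)); [lra |]. unfold B.
          auto_derive; [exact I | ring].
        * replace (gam ^ 2 * (B z s - gam ^ 2 * z ^ 2) / w ^ 3) with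
            ((gam ^ 2 * w - gam ^ 2 * z * (2 * gam ^ 2 * z / (2 * w))) / w ^ 2) by (rewrite <- Hw2; field; lra).
          apply (is_derive_div (fun x => gam ^ 2 * x) (fun x => sqrt (B x s))); [| | fold w; lra].
          -- auto_derive; [exact I | ring].
          -- pose proof (HB z s). apply (is_derive_sqrt_comp (fun x => B x s)); [lra |]. unfold B.
             auto_derive; [exact I | ring].
      + pose proof (HB z s) as HBz.
        assert (Hg2 : 0 < gam ^ 2) by nra.
        assert (Hq : 0 <= gam ^ 2 * (B z s - gam ^ 2 * z ^ 2) / w ^ 3 <= gam ^ 2 / w).
        { assert (Hz : 0 <= gam ^ 2 * z ^ 2 <= B z s).
          { unfold B. pose proof (Rmult_le_pos _ _ (pow2_ge_0 gam) (pow2_ge_0 z)).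
            pose proof (Rmult_le_pos _ _ (pow2_ge_0 gam) (Rabs_pos s)). lra. }
          assert (Hw3 : 0 < w ^ 3) by (apply pow_lt; exact Hw).
          split.
          - apply Rmult_le_pos; [apply Rmult_le_pos; lra | left; now apply Rinv_0_lt_compat].
          - replace (gam ^ 2 / w) with (gam ^ 2 * B z s / w ^ 3) by (rewrite <- Hw2; field; lra).
            unfold Rdiv. apply Rmult_le_compat_r; [left; now apply Rinv_0_lt_compat |].
            apply Rmult_le_compat_l; lra. }
        set (q := gam ^ 2 * (B z s - gam ^ 2 * z ^ 2) / w ^ 3) in *.
        set (p := gam ^ 2 * z / w).
        assert (q / (1 + p ^ 2) <= q).
        { apply (Rmult_le_reg_r (1 + p ^ 2)); [apply one_plus_sqr_pos |]. unfold Rdiv.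
          rewrite Rmult_assoc, Rinv_l by (pose proof (one_plus_sqr_pos p); lra).
          pose proof (pow2_ge_0 p). nra. }
        assert (0 < 1 / w) by (apply Rdiv_lt_0_compat; lra). fold w. lra.
    - intros z. rewrite HV0. right. f_equal. unfold B. rewrite Rabs_R0. ring.
    - lra. }
  pose proof (V_pos y t Ht) as Hp.
  assert (V y t ^ 2 <= sqrt (B y t) ^ 2) by (apply pow_incr; lra).
  rewrite HBs in H. unfold B in H. rewrite Rabs_pos_eq in H by exact Ht. exact H.
Qed.

(** With [m ^ 2 = k] and [k * lam ^ 2 = 1] these are the symmetries of the flow. [lam = 1, m = -1]
    gives reflections, [m = / lam] dilations. *)
Lemma V_affine_jets (T lam m n k : R) : 0 < T -> 0 < lam -> 0 < k -> m ^ 2 = k -> k * lam ^ 2 = 1 ->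
  let Z := fun z s => lam * V (m * z + n) (k * s) in
  cont_on Z T /\ bounded_below_on T Z /\
  (forall y t, 0 < t < T -> exists p q, jet Z y t (q / (1 + p ^ 2) - 1 / Z y t) p q).
Proof.
  intros HT Hlam Hk Hm Hkl Z.
  assert (HkT : 0 < k * T) by now apply Rmult_lt_0_compat.
  pose proof (HV (k * T) HkT) as Hr.
  split; [| split].
  - apply cont_on_affine with (k * T); [exact Hk | lra |]. apply (regular_on_mcf _ _ Hr).
  - destruct (regular_on_bounded _ _ Hr) as [c [Hc Hl]]. exists (lam * c).
    split; [now apply Rmult_lt_0_compat |]. intros y t Ht. apply Rmult_le_compat_l; [lra |].
    apply Hl. nra.
  - intros y t Ht.
    destruct (mcf_on_jet (k * T) V (m * y + n) (k * t) (regular_on_mcf _ _ Hr) ltac:(nra)) as [p [q J]].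
    apply (jet_affine V lam m n k) in J.
    assert (Hv : 0 < V (m * y + n) (k * t)) by (apply V_pos; nra).
    exists (lam * m * p), (lam * m ^ 2 * q).
    assert (E : (lam * m * p) ^ 2 = p ^ 2).
    { replace ((lam * m * p) ^ 2) with (m ^ 2 * lam ^ 2 * p ^ 2) by ring. rewrite Hm, Hkl. ring. }
    rewrite E. unfold Z at 2. rewrite Hm in *.
    replace (lam * k * q / (1 + p ^ 2) - 1 / (lam * V (m * y + n) (k * t))) with
      (lam * k * (q / (1 + p ^ 2) - 1 / V (m * y + n) (k * t))); [exact J |].
    assert (Hkl2 : lam * k = / lam) by (apply (Rmult_eq_reg_r lam); [rewrite Rinv_l by lra; lra | lra]).
    rewrite Hkl2. field. pose proof (one_plus_sqr_pos p). repeat split; lra.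
Qed.

Lemma V_even (y t : R) : 0 <= t -> V (- y) t = V y t.
Proof.
  intros Ht.
  assert (H : forall z, V (- z) t <= V z t).
  { intros z. destruct (V_affine_jets (t + 1) 1 (-1) 0 1 ltac:(lra) Rlt_0_1 Rlt_0_1 ltac:(ring) ltac:(ring)) as [A1 [A2 A3]].
    pose proof (jet_le_regular (t + 1) m_infty _ V (HV (t + 1) ltac:(lra)) A1 A2 A3) as Hc. cbv beta in Hc.
    replace (V (- z) t) with (1 * V (-1 * z + 0) (1 * t)) by (rewrite !Rmult_1_l; f_equal; ring).
    apply Hc; [| | exact I | lra].
    - intros x _. rewrite Rmult_1_l, Rmult_0_r, !HV0. right. f_equal. ring.
    - intros l s E. discriminate. }
  apply Rle_antisym; [apply H |]. pose proof (H (- y)) as H2. now rewrite Ropp_involutive in H2.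
Qed.

(* Alexandrov reflection at [(x + y) / 2]. *)
Lemma V_monotone (x y t : R) : 0 <= t -> 0 <= x <= y -> V x t <= V y t.
Proof.
  intros Ht Hxy. set (a := (x + y) / 2).
  destruct (V_affine_jets (t + 1) 1 (-1) (2 * a) 1 ltac:(lra) Rlt_0_1 Rlt_0_1 ltac:(ring) ltac:(ring)) as [A1 [A2 A3]].
  pose proof (jet_le_regular (t + 1) a _ V (HV (t + 1) ltac:(lra)) A1 A2 A3) as Hc. cbv beta in Hc.
  replace (V x t) with (1 * V (-1 * y + 2 * a) (1 * t)) by (rewrite !Rmult_1_l; f_equal; unfold a; field).
  apply Hc; [| | simpl; unfold a; lra | lra].
  - intros z Hz. simpl in Hz. rewrite Rmult_1_l, Rmult_0_r, !HV0. apply sqrt_le_1_alt.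
    apply Rplus_le_compat_l, Rmult_le_compat_l; [apply pow2_ge_0 |].
    assert (0 <= a) by (unfold a; lra). nra.
  - intros l s E Hs. injection E as <-. right. rewrite !Rmult_1_l. f_equal. ring.
Qed.

(** The dilated initial hyperboloid has constant [lam ^ 2 * C1 >= C1] and the same asymptotic cone,
    hence lies above. This is the source of monotonicity in self-similar variables. *)
Lemma V_scaling (lam y t : R) : 1 <= lam -> 0 <= t -> V y t <= lam * V (y / lam) (t / lam ^ 2).
Proof.
  intros Hl Ht.
  assert (Hl2 : 0 < lam ^ 2) by nra.
  destruct (V_affine_jets (t + 1) lam (/ lam) 0 (/ lam ^ 2)) as [A1 [A2 A3]]; try lra.
  { now apply Rinv_0_lt_compat. }
  { field. lra. }
  { field. lra. }
  pose proof (regular_le_super (t + 1) V _ (HV (t + 1) ltac:(lra)) A1 A2) as Hc. cbv beta in Hc.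
  replace (lam * V (y / lam) (t / lam ^ 2)) with (lam * V (/ lam * y + 0) (/ lam ^ 2 * t))
    by (f_equal; f_equal; unfold Rdiv; ring).
  apply Hc; [| | lra].
  - intros z s Hs. destruct (A3 z s Hs) as [p [q J]]. eexists _, p, q. split; [exact J | lra].
  - intros z. rewrite Rmult_0_r, !HV0.
    rewrite <- (sqrt_pow2 lam) at 1 by lra. rewrite <- sqrt_mult by (try (left; apply radicand_pos); lra).
    apply sqrt_le_1_alt.
    replace (lam ^ 2 * (C1 + gam ^ 2 * (/ lam * z + 0) ^ 2)) with (lam ^ 2 * C1 + gam ^ 2 * z ^ 2) by (field; lra).
    assert (1 <= lam ^ 2) by nra. nra.
Qed.

(* A thin neck is pinched off by the shrinking hyperboloid [u^2 = y0^2 / 4 + y^2 / 2 - (s - t) / 2]. *)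
Lemma V_neck (Y t : R) : 0 < t -> 0 < Y <= 1 -> Y / 2 * sqrt t <= V (Y * sqrt t) t.
Proof.
  intros Ht HY. apply Rnot_lt_le. intros Hlt.
  assert (Hst : 0 < sqrt t) by now apply sqrt_lt_R0.
  assert (Hst2 : sqrt t ^ 2 = t) by (apply pow2_sqrt; lra).
  set (y0 := Y * sqrt t) in *. set (m := V y0 t) in *.
  assert (Hy0 : 0 < y0) by (apply Rmult_lt_0_compat; lra).
  assert (Hy02 : y0 ^ 2 <= t).
  { unfold y0. rewrite Rpow_mult_distr, Hst2. assert (Y ^ 2 <= 1) by nra. nra. }
  assert (Hm0 : 0 < m) by (apply V_pos; lra).
  assert (Hm : m < y0 / 2) by (unfold y0; lra).
  set (A := y0 ^ 2 / 4). assert (HA : 0 < A) by (unfold A; nra).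
  assert (HmA : m ^ 2 < A) by (unfold A; nra).
  set (t1 := t + 2 * A).
  (* By scaling [V ^ 2] at [y0] grows at most by the factor [s / t <= 3 / 2], so it stays below
     [3 / 2 * A], whereas the hyperboloid there is at least [3 * A - A]. At [t1 = t + 2 * A] its
     neck has closed, which would make [V 0 t1 ^ 2] negative. *)
  assert (Hlat : forall s, t <= s <= t1 -> V y0 s ^ 2 < A + / 2 * y0 ^ 2 + - / 2 * (s - t)).
  { intros s Hs.
    set (lam := sqrt (s / t)).
    assert (Hst1 : 1 <= s / t).
    { apply (Rmult_le_reg_r t); [lra |]. unfold Rdiv. rewrite Rmult_assoc, Rinv_l; lra. }
    assert (Hlam : 1 <= lam) by (unfold lam; rewrite <- sqrt_1; now apply sqrt_le_1_alt).
    assert (Hlam2 : lam ^ 2 = s / t) by (apply pow2_sqrt; lra).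
    pose proof (V_scaling lam y0 s Hlam ltac:(lra)) as Hsc.
    replace (s / lam ^ 2) with t in Hsc by (rewrite Hlam2; field; lra).
    assert (Hmono : V (y0 / lam) t <= m).
    { assert (Hil : 0 < / lam <= 1).
      { split; [apply Rinv_0_lt_compat; lra |]. rewrite <- Rinv_1. apply Rinv_le_contravar; lra. }
      apply V_monotone; [lra |]. unfold Rdiv. split; nra. }
    assert (HVs : V y0 s <= lam * m) by nra.
    pose proof (V_pos y0 s ltac:(lra)) as Hp.
    assert (H1 : V y0 s ^ 2 <= (lam * m) ^ 2) by (apply pow_incr; lra).
    rewrite Rpow_mult_distr, Hlam2 in H1.
    assert (H2 : s / t <= 3 / 2).
    { apply (Rmult_le_reg_r t); [lra |]. unfold Rdiv at 1. rewrite Rmult_assoc, Rinv_l by lra.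
      unfold t1, A in Hs. lra. }
    assert (H3 : s / t * m ^ 2 <= 3 / 2 * A) by (apply Rmult_le_compat; nra).
    unfold t1, A in *. lra. }
  pose proof (hyperboloid_upper (t1 + 1) y0 t t1 A (/ 2) (- / 2) V
    (regular_on_mcf _ _ (HV (t1 + 1) ltac:(unfold t1; lra))) ltac:(lra) ltac:(lra) ltac:(lra) ltac:(lra)) as Hc.
  assert (Hfin : V 0 t1 ^ 2 < A + / 2 * 0 ^ 2 + - / 2 * (t1 - t)).
  { apply Hc; [| | lra | unfold t1; lra].
    - intros y Hy.
      assert (HVy : V y t <= m).
      { destruct (Rle_lt_dec 0 y) as [H | H]; [apply V_monotone; lra |].
        rewrite <- V_even by lra. apply V_monotone; lra. }
      pose proof (V_pos y t ltac:(lra)) as Hp.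
      assert (V y t ^ 2 <= m ^ 2) by (apply pow_incr; lra). pose proof (pow2_ge_0 y). lra.
    - intros s Hs. rewrite V_even by lra. pose proof (Hlat s Hs). split; lra. }
  pose proof (pow2_ge_0 (V 0 t1)). unfold t1 in *. lra.
Qed.

End Envelope.

(** * Self-similar variables *)

Lemma ucv_eq (x : nat -> R) (l l' : R) : l = l' -> ucv x l -> ucv x l'.
Proof. now intros ->. Qed.

(** * Passage to the limit in the self-similar equation *)

Section Limit.

Variables (W W1 D : R -> R -> R) (w : R -> R) (a b delta P : R).
Hypotheses (Hab : a < b) (Hdelta : 0 < delta).
Hypothesis HWb : forall x t, a <= x <= b -> 1 <= t -> delta <= W x t /\ Rabs (W1 x t) <= P.
Hypothesis HW1 : forall x t, 0 < t -> is_derive (fun z => W z t) x (W1 x t).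
Hypothesis HWt : forall x t, 0 < t -> is_derive (fun s => W x s) t (D x t / t).
Hypothesis HD : forall x t, 0 < t -> D x t <= 0.
Hypothesis HDc : forall x t, 0 < t -> continuity_2d_pt (fun s z => D z s) t x.
Hypothesis HZ : forall x t, 0 < t ->
  is_derive (fun z => atan (W1 z t) + z * W z t / 2) x (D x t + (/ W x t + W x t)).
Hypothesis Hlim : forall x, a <= x <= b -> forall eps, 0 < eps -> exists t0, forall t, t0 <= t ->
  Rabs (W x t - w x) < eps.

Lemma W_cont_y (x t : R) : 0 < t -> continuous (fun z => W z t) x.
Proof. intros Ht. apply (ex_derive_continuous (fun z => W z t)). eexists. now apply HW1. Qed.

Lemma D_cont_y (x t : R) : 0 < t -> continuous (fun z => D z t) x.
Proof.
  intros Ht. apply filterlim_locally. intros eps. destruct (HDc x t Ht eps) as [d Hd].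
  exists d. intros z Hz. apply Hd; [rewrite Rminus_diag, Rabs_R0; apply cond_pos | exact Hz].
Qed.

Lemma ex_RInt_D (x y t : R) : 0 < t -> ex_RInt (fun z => D z t) x y.
Proof. intros Ht. apply (ex_RInt_continuous (V := R_CompleteNormedModule)). intros z _. now apply D_cont_y. Qed.

Lemma ex_RInt_W (x y t : R) : 0 < t -> ex_RInt (fun z => W z t) x y.
Proof. intros Ht. apply (ex_RInt_continuous (V := R_CompleteNormedModule)). intros z _. now apply W_cont_y. Qed.

Lemma area_derive (t : R) : 0 < t ->
  is_derive (fun s => RInt (fun z => W z s) a b) t (RInt (fun z => D z t) a b / t).
Proof.
  intros Ht.
  assert (Hloc : locally t (fun s => 0 < s)).
  { exists (mkposreal t Ht). intros s Hs. change (Rabs (s - t) < t) in Hs. apply Rabs_def2 in Hs. lra. }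
  replace (RInt (fun z => D z t) a b / t) with (RInt (fun z => Derive (fun s => W z s) t) a b).
  - apply (is_derive_RInt_param (fun s z => W z s)).
    + generalize Hloc. apply filter_imp. intros s Hs z _. eexists. now apply HWt.
    + intros z _.
      apply continuity_2d_pt_ext_loc with (fun s z => D z s * / s).
      * exists (mkposreal t Ht). intros s x Hs _. simpl in Hs. apply Rabs_def2 in Hs.
        symmetry. apply is_derive_unique, HWt. lra.
      * apply continuity_2d_pt_mult; [now apply HDc |].
        apply continuity_2d_pt_inv; [apply continuity_2d_pt_id1 | lra].
    + generalize Hloc. apply filter_imp. intros s Hs. now apply ex_RInt_W.
  - rewrite (RInt_ext _ (fun z => scal (/ t) (D z t))).
    + rewrite (RInt_scal (V := R_CompleteNormedModule)) by now apply ex_RInt_D.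
      unfold scal. simpl. unfold mult. simpl. unfold Rdiv. apply Rmult_comm.
    + intros z _. transitivity (D z t / t); [now apply is_derive_unique, HWt |]. unfold scal. simpl. unfold mult. simpl.
      unfold Rdiv. apply Rmult_comm.
Qed.

Lemma area_D_le_0 (x y t : R) : 0 < t -> x <= y -> RInt (fun z => D z t) x y <= 0.
Proof.
  intros Ht Hxy. replace 0 with (RInt (fun _ => 0) x y)
    by (rewrite RInt_const; unfold scal; simpl; unfold mult; simpl; ring).
  apply RInt_le; [exact Hxy | now apply ex_RInt_D | apply ex_RInt_const |]. intros; now apply HD.
Qed.

(** The area under [W] decreases and is bounded below, so its drop over [[2 ^ n, 2 ^ S n]] tends to
    0. The mean value theorem finds a time in this interval where the integral of [D] is at most
    twice that drop in size; as [D <= 0], it is the whole [L^1] norm. *)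
Lemma good_times : exists tn : nat -> R, (forall n, 1 <= tn n) /\
  (forall A, ultra (fun n => A <= tn n)) /\ ucv (fun n => RInt (fun z => D z (tn n)) a b) 0.
Proof.
  set (I := fun t => RInt (fun z => W z t) a b).
  assert (Hp : forall n, 1 <= 2 ^ n) by (intros; apply pow_R1_Rle; lra).
  assert (Hmvt : forall n, exists t, 2 ^ n <= t <= 2 ^ S n /\
    I (2 ^ S n) - I (2 ^ n) = RInt (fun z => D z t) a b / t * 2 ^ n).
  { intros n. pose proof (Hp n). destruct (MVT_gen I (2 ^ n) (2 ^ S n) (fun t => RInt (fun z => D z t) a b / t)) as [t [Ht Et]].
    - intros t Ht. apply area_derive. simpl in Ht. rewrite Rmin_left in Ht by lra. lra.
    - intros t Ht. simpl in Ht. rewrite Rmin_left in Ht by lra.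
      apply continuity_pt_filterlim. apply (ex_derive_continuous I). eexists. apply area_derive. lra.
    - rewrite Rmin_left, Rmax_right in Ht by (simpl; lra). exists t. split; [exact Ht |].
      rewrite Et. f_equal. simpl. ring. }
  set (tn := fun n => proj1_sig (constructive_indefinite_description _ (Hmvt n))).
  assert (Htn : forall n, 2 ^ n <= tn n <= 2 ^ S n /\
    I (2 ^ S n) - I (2 ^ n) = RInt (fun z => D z (tn n)) a b / tn n * 2 ^ n).
  { intros n. exact (proj2_sig (constructive_indefinite_description _ (Hmvt n))). }
  exists tn.
  assert (Htn1 : forall n, 1 <= tn n).
  { intros n. pose proof (Hp n). destruct (Htn n). lra. }
  split; [exact Htn1 | split].
  - intros A. destruct (nfloor_ex (Rmax 0 A) (Rmax_l 0 A)) as [N [_ HN]].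
    generalize (ultra_ge (S N)). apply ultra_imp. intros n Hn.
    destruct (Htn n) as [[H1 _] _]. pose proof (Rmax_r 0 A).
    assert (INR n <= 2 ^ n).
    { clear. induction n as [| n IH]; [simpl; lra |]. rewrite S_INR. simpl.
      assert (1 <= 2 ^ n) by (apply pow_R1_Rle; lra). lra. }
    apply le_INR in Hn. rewrite S_INR in Hn. lra.
  - assert (Hneg : forall n, RInt (fun z => D z (tn n)) a b <= 0).
    { intros n. apply area_D_le_0; [pose proof (Htn1 n) |]; lra. }
    assert (Hrel : forall n, Rabs (RInt (fun z => D z (tn n)) a b - 0) <= 2 * (I (2 ^ n) - I (2 ^ S n))).
    { intros n. rewrite Rminus_0_r, Rabs_left1 by apply Hneg. destruct (Htn n) as [[H1 H2] H3].
      pose proof (Htn1 n). pose proof (Hneg n). pose proof (Hp n).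
      replace (I (2 ^ n) - I (2 ^ S n)) with (- RInt (fun z => D z (tn n)) a b * (2 ^ n / tn n))
        by (replace (I (2 ^ n) - I (2 ^ S n)) with (- (I (2 ^ S n) - I (2 ^ n))) by ring; rewrite H3; field; lra).
      assert (/ 2 <= 2 ^ n / tn n).
      { apply (Rmult_le_reg_r (tn n)); [lra |]. unfold Rdiv. rewrite Rmult_assoc, Rinv_l by lra. simpl in H2. lra. }
      nra. }
    assert (Hconv : ex_finite_lim_seq (fun n => I (2 ^ n))).
    { apply ex_finite_lim_seq_decr with 0.
      - intros n. pose proof (Hrel n). pose proof (Rabs_pos (RInt (fun z => D z (tn n)) a b - 0)). lra.
      - intros n. replace 0 with (RInt (fun _ => 0) a b)
          by (rewrite RInt_const; unfold scal; simpl; unfold mult; simpl; ring).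
        pose proof (Hp n).
        apply RInt_le; [lra | apply ex_RInt_const | apply ex_RInt_W; lra |].
        intros x Hx. destruct (HWb x (2 ^ n)); lra. }
    destruct Hconv as [l Hl]. intros e He.
    apply is_lim_seq_spec in Hl. destruct (Hl (mkposreal (e / 8) ltac:(lra))) as [N HN]. simpl in HN.
    generalize (ultra_ge N). apply ultra_imp. intros n Hn.
    pose proof (HN n Hn) as H1. pose proof (HN (S n) ltac:(lia)) as H2.
    apply Rabs_def2 in H1. apply Rabs_def2 in H2. specialize (Hrel n). simpl in *. lra.
Qed.

Let Ck := P * (/ delta ^ 2 + 1).

Lemma P_nonneg : 0 <= P.
Proof. destruct (HWb a 1) as [_ H]; [lra | lra |]. pose proof (Rabs_pos (W1 a 1)). lra. Qed.

Lemma Ck_nonneg : 0 <= Ck.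
Proof.
  unfold Ck. pose proof P_nonneg. assert (0 < / delta ^ 2) by (apply Rinv_0_lt_compat; nra). nra.
Qed.

Lemma W_lip (x y t : R) : a <= x <= b -> a <= y <= b -> 1 <= t -> Rabs (W x t - W y t) <= P * Rabs (x - y).
Proof.
  intros Hx Hy Ht. destruct (MVT_gen (fun z => W z t) y x (fun z => W1 z t)) as [c [Hc Ec]].
  - intros z _. apply HW1. lra.
  - intros z _. apply continuity_pt_filterlim. apply W_cont_y. lra.
  - rewrite Ec, Rabs_mult. apply Rmult_le_compat_r; [apply Rabs_pos |]. apply HWb; [| exact Ht].
    unfold Rmin, Rmax in Hc. destruct (Rle_dec y x); lra.
Qed.

Lemma k_lip (x y t : R) : a <= x <= b -> a <= y <= b -> 1 <= t ->
  Rabs ((/ W x t + W x t) - (/ W y t + W y t)) <= Ck * Rabs (x - y).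
Proof.
  intros Hx Hy Ht. pose proof (W_lip x y t Hx Hy Ht) as H.
  destruct (HWb x t Hx Ht) as [H1 _]. destruct (HWb y t Hy Ht) as [H2 _].
  set (p := W x t) in *. set (q := W y t) in *.
  assert (Hi : 0 < / p <= / delta /\ 0 < / q <= / delta).
  { repeat split; try (apply Rinv_0_lt_compat; lra); apply Rinv_le_contravar; lra. }
  replace ((/ p + p) - (/ q + q)) with ((p - q) * (1 - / p * / q)) by (field; lra).
  rewrite Rabs_mult. unfold Ck.
  replace (P * (/ delta ^ 2 + 1) * Rabs (x - y)) with (P * Rabs (x - y) * (/ delta ^ 2 + 1)) by ring.
  apply Rmult_le_compat; [apply Rabs_pos | apply Rabs_pos | exact H |].
  assert (0 < / p * / q <= / delta ^ 2).
  { split; [apply Rmult_lt_0_compat; lra |]. replace (/ delta ^ 2) with (/ delta * / delta) by (field; lra).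
    apply Rmult_le_compat; lra. }
  apply Rabs_le. lra.
Qed.

(** The integrated equation. [D] has a sign, so its integral over [[x, y]] is controlled by that
    over [[a, b]]; the rest is an integral of a Lipschitz function. *)
Lemma Z_taylor (x y z t : R) : a <= x -> x <= y -> y <= b -> x <= z <= y -> 1 <= t ->
  Rabs (atan (W1 y t) + y * W y t / 2 - (atan (W1 x t) + x * W x t / 2) - (y - x) * (/ W z t + W z t))
    <= Ck * (y - x) ^ 2 - RInt (fun s => D s t) a b.
Proof.
  intros Hx Hxy Hy Hz Ht.
  assert (Ht0 : 0 < t) by lra.
  assert (Hkc : forall s, a <= s <= b -> continuous (fun s => / W s t + W s t) s).
  { intros s Hs. apply (continuous_plus (fun s => / W s t) (fun s => W s t)); [| now apply W_cont_y].
    apply (continuous_comp (fun s => W s t) Rinv); [now apply W_cont_y |].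
    destruct (HWb s t Hs Ht). apply (ex_derive_continuous Rinv). auto_derive. lra. }
  assert (Hek : ex_RInt (fun s => / W s t + W s t) x y).
  { apply (ex_RInt_continuous (V := R_CompleteNormedModule)). intros s Hs.
    rewrite Rmin_left, Rmax_right in Hs by lra. apply Hkc. lra. }
  assert (HI : is_RInt (fun s => D s t + (/ W s t + W s t)) x y
    (minus (atan (W1 y t) + y * W y t / 2) (atan (W1 x t) + x * W x t / 2))).
  { apply (is_RInt_derive (fun z => atan (W1 z t) + z * W z t / 2)).
    - intros s _. now apply HZ.
    - intros s Hs. rewrite Rmin_left, Rmax_right in Hs by lra.
      apply (continuous_plus (fun s => D s t)); [now apply D_cont_y | apply Hkc; lra]. }
  pose proof (is_RInt_unique (V := R_CompleteNormedModule) _ _ _ _ HI) as E1.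
  pose proof (RInt_plus (V := R_CompleteNormedModule) _ _ x y (ex_RInt_D x y t Ht0) Hek) as E2.
  unfold minus, plus, opp in E1, E2. simpl in E1, E2.
  assert (Hk : Rabs (RInt (fun s => / W s t + W s t) x y - (y - x) * (/ W z t + W z t)) <= Ck * (y - x) ^ 2).
  { replace ((y - x) * (/ W z t + W z t)) with (RInt (fun _ => / W z t + W z t) x y)
      by (rewrite RInt_const; unfold scal; simpl; unfold mult; simpl; ring).
    rewrite <- (RInt_minus (V := R_CompleteNormedModule)) by (auto; apply ex_RInt_const).
    replace (Ck * (y - x) ^ 2) with ((y - x) * (Ck * (y - x))) by ring.
    apply abs_RInt_le_const; [exact Hxy | apply (ex_RInt_minus (V := R_NormedModule)); [exact Hek | apply ex_RInt_const] |].
    intros s Hs. eapply Rle_trans; [apply (k_lip s z t); lra |].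
    apply Rmult_le_compat_l; [apply Ck_nonneg |]. apply Rabs_le. lra. }
  assert (HDi : RInt (fun s => D s t) a b <= RInt (fun s => D s t) x y <= 0).
  { split; [| now apply area_D_le_0].
    rewrite <- (RInt_Chasles (V := R_CompleteNormedModule) (fun s => D s t) a x b) by now apply ex_RInt_D.
    rewrite <- (RInt_Chasles (V := R_CompleteNormedModule) (fun s => D s t) x y b) by now apply ex_RInt_D.
    unfold plus. simpl. pose proof (area_D_le_0 a x t Ht0 Hx). pose proof (area_D_le_0 y b t Ht0 Hy). lra. }
  apply Rabs_le_between in Hk.
  assert (E3 : atan (W1 y t) + y * W y t / 2 - (atan (W1 x t) + x * W x t / 2) =
    RInt (fun s => D s t) x y + RInt (fun s => / W s t + W s t) x y).
  { rewrite <- E2. rewrite E1. reflexivity. }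
  rewrite E3. apply Rabs_le. lra.
Qed.

Lemma taylor_is_derive_on (F G : R -> R) (C : R) :
  (forall x y, a <= x <= b -> a <= y <= b -> Rabs (F y - F x - (y - x) * G x) <= C * (y - x) ^ 2) ->
  forall x, a < x < b -> is_derive F x (G x).
Proof.
  intros H x Hx. apply is_derive_approx. intros e He.
  pose proof (Rabs_pos C) as HC.
  set (r := Rmin (e / (Rabs C + 1)) (Rmin (x - a) (b - x))).
  assert (Hr : 0 < r).
  { unfold r. repeat apply Rmin_glb_lt; try lra. apply Rdiv_lt_0_compat; lra. }
  assert (R1 : r <= e / (Rabs C + 1)) by apply Rmin_l.
  assert (R2 : r <= x - a) by (eapply Rle_trans; [apply Rmin_r | apply Rmin_l]).
  assert (R3 : r <= b - x) by (eapply Rle_trans; [apply Rmin_r | apply Rmin_r]).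
  exists r. split; [exact Hr |]. intros h Hh. pose proof (Rabs_def2 _ _ Hh) as Hh2.
  specialize (H x (x + h) ltac:(lra) ltac:(lra)). replace (x + h - x) with h in H by ring.
  eapply Rle_trans; [exact H |]. rewrite <- (pow2_abs h). pose proof (Rabs_pos h). pose proof (Rle_abs C).
  assert (Rabs C * Rabs h <= e).
  { apply Rle_trans with ((Rabs C + 1) * (e / (Rabs C + 1))); [apply Rmult_le_compat; lra |].
    right. field. lra. }
  replace (C * Rabs h ^ 2) with (C * Rabs h * Rabs h) by ring.
  apply Rmult_le_compat_r; [lra |]. nra.
Qed.

(** Along the good times the Taylor estimates for [W] and for [atan W1 + x * W / 2] hold up to
    errors that vanish. In the limit they are exact and give differentiability together with the
    equation. *)
Theorem limit_ode (x : R) : a < x < b -> exists p : R -> R,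
  locally x (fun z => is_derive w z (p z)) /\
  is_derive p x ((1 + p x ^ 2) * (/ w x + (w x - x * p x) / 2)).
Proof.
  intros Hx.
  destruct good_times as [tn [Ht1 [Htinf HtD]]].
  (* The [L^1] norm of [D] at time [tn n], the only trace that [D] leaves in what follows. *)
  set (eps := fun n => - RInt (fun s => D s (tn n)) a b).
  assert (Heps : ucv eps 0).
  { unfold eps. replace 0 with (-1 * 0) by ring.
    apply ucv_ext with (fun n => -1 * RInt (fun s => D s (tn n)) a b); [intros; ring | now apply ucv_scal]. }
  assert (Heps0 : forall n, 0 <= eps n).
  { intros n. unfold eps. pose proof (area_D_le_0 a b (tn n) ltac:(pose proof (Ht1 n); lra) ltac:(lra)). lra. }
  assert (Hw : forall z, a <= z <= b -> ucv (fun n => W z (tn n)) (w z)).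
  { intros z Hz e He. destruct (Hlim z Hz e He) as [t0 H0]. generalize (Htinf t0). apply ultra_imp.
    intros n Hn. now apply H0. }
  set (p := fun z => ulim (fun n => W1 z (tn n))).
  assert (Hp : forall z, a <= z <= b -> ucv (fun n => W1 z (tn n)) (p z)).
  { intros z Hz. apply ulim_cv with P. apply ultra_all. intros n. now apply HWb. }
  assert (Hwd : forall z, a <= z <= b -> delta <= w z).
  { intros z Hz. apply (ucv_le (fun _ => delta) (fun n => W z (tn n))); [apply ucv_const | now apply Hw |].
    apply ultra_all. intros n. now apply HWb. }
  pose proof P_nonneg as HP. pose proof Ck_nonneg as HCk.
  set (Bab := Rabs a + Rabs b).
  set (Mk := Rabs (w a) + 1 + P * (b - a)).
  assert (Hkb : exists K, 0 <= K /\ ultra (fun n => forall z, a <= z <= b -> Rabs (/ W z (tn n) + W z (tn n)) <= K /\ Rabs (W z (tn n)) <= K)).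
  { exists (/ delta + Mk). assert (Hid : 0 < / delta) by now apply Rinv_0_lt_compat.
    assert (HMk : 0 <= Mk).
    { unfold Mk. pose proof (Rabs_pos (w a)). assert (0 <= P * (b - a)) by (apply Rmult_le_pos; lra). lra. }
    split; [lra |].
    generalize (Hw a ltac:(lra) 1 Rlt_0_1). apply ultra_imp. intros n Hn z Hz.
    destruct (HWb z (tn n) Hz (Ht1 n)) as [H1 _].
    pose proof (W_lip z a (tn n) Hz ltac:(lra) (Ht1 n)) as H2.
    assert (P * Rabs (z - a) <= P * (b - a)) by (apply Rmult_le_compat_l; [lra | rewrite Rabs_pos_eq; lra]).
    apply Rabs_def2 in Hn. apply Rabs_le_between in H2. pose proof (Rle_abs (w a)).
    assert (0 < / W z (tn n) <= / delta).
    { split; [apply Rinv_0_lt_compat; lra | apply Rinv_le_contravar; lra]. }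
    split; apply Rabs_le; unfold Mk in *; lra. }
  destruct Hkb as [K [HK0 HK]].
  set (C' := (1 + P ^ 2) * (Ck * (b - a) + K + (Bab * P + K))).
  (* Slopes are Lipschitz up to an error proportional to [eps n]: [Z_taylor] bounds flux increments
     and [atan_colip] transfers this to slopes, which lie in [[- P, P]]. *)
  assert (HW1mod : ultra (fun n => forall z y, a <= z -> z <= y -> y <= b ->
     Rabs (W1 y (tn n) - W1 z (tn n)) <= C' * (y - z) + (1 + P ^ 2) * eps n)).
  { revert HK. apply ultra_imp. intros n HKn z y Hz Hzy Hy.
    destruct (HWb z (tn n) ltac:(lra) (Ht1 n)) as [_ Q1]. destruct (HWb y (tn n) ltac:(lra) (Ht1 n)) as [_ Q2].
    eapply Rle_trans; [apply (atan_colip _ _ P Q2 Q1) |].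
    pose proof (Z_taylor z y z (tn n) Hz Hzy Hy ltac:(lra) (Ht1 n)) as T.
    destruct (HKn z ltac:(lra)) as [K1 K2]. destruct (HKn y ltac:(lra)) as [_ K3].
    pose proof (W_lip y z (tn n) ltac:(lra) ltac:(lra) (Ht1 n)) as L. rewrite (Rabs_pos_eq (y - z)) in L by lra.
    unfold C'. replace ((1 + P ^ 2) * (Ck * (b - a) + K + (Bab * P + K)) * (y - z) + (1 + P ^ 2) * eps n) with
      ((1 + P ^ 2) * ((Ck * (b - a) + K + (Bab * P + K)) * (y - z) + eps n)) by ring.
    apply Rmult_le_compat_l; [left; apply one_plus_sqr_pos |].
    assert (HyW : Rabs (y * W y (tn n) - z * W z (tn n)) <= (Bab * P + K) * (y - z)).
    { replace (y * W y (tn n) - z * W z (tn n)) with (y * (W y (tn n) - W z (tn n)) + (y - z) * W z (tn n)) by ring.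
      eapply Rle_trans; [apply Rabs_triang |]. rewrite !Rabs_mult, (Rabs_pos_eq (y - z)) by lra.
      assert (Rabs y <= Bab).
      { unfold Bab. unfold Rabs. destruct (Rcase_abs y), (Rcase_abs a), (Rcase_abs b); lra. }
      pose proof (Rabs_pos y). pose proof (Rabs_pos (W y (tn n) - W z (tn n))).
      assert (Rabs y * Rabs (W y (tn n) - W z (tn n)) <= Bab * (P * (y - z))) by (apply Rmult_le_compat; lra).
      assert ((y - z) * Rabs (W z (tn n)) <= (y - z) * K) by (apply Rmult_le_compat_l; lra). lra. }
    assert (Hk1 : Rabs ((y - z) * (/ W z (tn n) + W z (tn n))) <= (y - z) * K).
    { rewrite Rabs_mult, (Rabs_pos_eq (y - z)) by lra. apply Rmult_le_compat_l; lra. }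
    assert (Hk2 : Ck * (y - z) ^ 2 <= Ck * (b - a) * (y - z)).
    { replace (Ck * (y - z) ^ 2) with (Ck * (y - z) * (y - z)) by ring. apply Rmult_le_compat_r; [lra |].
      apply Rmult_le_compat_l; lra. }
    pose proof (Rabs_pos ((y * W y (tn n) - z * W z (tn n)))).
    apply Rabs_le_between in T. apply Rabs_le_between in HyW. apply Rabs_le_between in Hk1.
    fold (eps n) in T. unfold eps in *. apply Rabs_le. split; lra. }
  assert (HC'0 : 0 <= C').
  { unfold C'. apply Rmult_le_pos; [left; apply one_plus_sqr_pos |].
    assert (0 <= Ck * (b - a)) by (apply Rmult_le_pos; lra).
    assert (0 <= Bab * P) by (apply Rmult_le_pos; [unfold Bab; pose proof (Rabs_pos a); pose proof (Rabs_pos b) |]; lra).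
    lra. }
  assert (Hwt : forall z y, a <= z <= b -> a <= y <= b -> Rabs (w y - w z - (y - z) * p z) <= C' * (y - z) ^ 2).
  { intros z y Hz Hy.
    apply (ucv_le (fun n => Rabs (W y (tn n) - W z (tn n) - (y - z) * W1 z (tn n)))
      (fun n => C' * (y - z) ^ 2 + (1 + P ^ 2) * Rabs (y - z) * eps n)).
    - apply ucv_abs, ucv_minus; [now apply ucv_minus; apply Hw | now apply ucv_scal, Hp].
    - apply ucv_eq with (C' * (y - z) ^ 2 + (1 + P ^ 2) * Rabs (y - z) * 0); [ring |].
      apply ucv_plus; [apply ucv_const | now apply ucv_scal].
    - revert HW1mod. apply ultra_imp. intros n Hn.
      assert (Htn0 : 0 < tn n) by (pose proof (Ht1 n); lra).
      destruct (MVT_gen (fun s => W s (tn n)) z y (fun s => W1 s (tn n))) as [c [Hc Ec]].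
      + intros s _. now apply HW1.
      + intros s _. apply continuity_pt_filterlim. now apply W_cont_y.
      + rewrite Ec. replace (W1 c (tn n) * (y - z) - (y - z) * W1 z (tn n)) with
          ((y - z) * (W1 c (tn n) - W1 z (tn n))) by ring.
        rewrite Rabs_mult, <- (pow2_abs (y - z)).
        assert (Hcz : Rabs (W1 c (tn n) - W1 z (tn n)) <= C' * Rabs (y - z) + (1 + P ^ 2) * eps n).
        { unfold Rmin, Rmax in Hc. destruct (Rle_dec z y) as [Hzy | Hzy].
          - eapply Rle_trans; [apply Hn; lra |]. rewrite (Rabs_pos_eq (y - z)) by lra.
            apply Rplus_le_compat_r, Rmult_le_compat_l; lra.
          - rewrite Rabs_minus_sym. eapply Rle_trans; [apply Hn; lra |]. rewrite (Rabs_left (y - z)) by lra.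
            apply Rplus_le_compat_r, Rmult_le_compat_l; lra. }
        pose proof (Rabs_pos (y - z)). apply (Rmult_le_compat_l (Rabs (y - z))) in Hcz; [| lra]. lra. }
  assert (Hat : forall s, continuous atan s).
  { intros s. apply (ex_derive_continuous atan). eexists. apply is_derive_atan_comp. }
  assert (Hpt : forall z y, a <= z <= b -> a <= y <= b ->
     Rabs ((atan (p y) + y * w y / 2) - (atan (p z) + z * w z / 2) - (y - z) * (/ w z + w z)) <= Ck * (y - z) ^ 2).
  { intros z y Hz Hy.
    assert (Hcv : forall s, a <= s <= b -> ucv (fun n => atan (W1 s (tn n)) + s * W s (tn n) / 2) (atan (p s) + s * w s / 2)).
    { intros s Hs. apply ucv_plus; [apply (ucv_cont atan); [apply Hat | now apply Hp] |].
      apply ucv_ext with (fun n => s / 2 * W s (tn n)); [intros; field |].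
      replace (s * w s / 2) with (s / 2 * w s) by field. now apply ucv_scal, Hw. }
    apply (ucv_le (fun n => Rabs ((atan (W1 y (tn n)) + y * W y (tn n) / 2) - (atan (W1 z (tn n)) + z * W z (tn n) / 2)
         - (y - z) * (/ W z (tn n) + W z (tn n))))
      (fun n => Ck * (y - z) ^ 2 + eps n)).
    - apply ucv_abs, ucv_minus; [now apply ucv_minus; apply Hcv |]. apply ucv_scal.
      apply ucv_plus; [| now apply Hw]. apply (ucv_cont Rinv); [| now apply Hw].
      specialize (Hwd z Hz). apply (ex_derive_continuous Rinv). auto_derive. lra.
    - apply ucv_eq with (Ck * (y - z) ^ 2 + 0); [ring |]. apply ucv_plus; [apply ucv_const | exact Heps].
    - apply ultra_all. intros n. destruct (Rle_lt_dec z y) as [Hzy | Hzy].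
      + pose proof (Z_taylor z y z (tn n) ltac:(lra) Hzy ltac:(lra) ltac:(lra) (Ht1 n)) as T. unfold eps. lra.
      + pose proof (Z_taylor y z z (tn n) ltac:(lra) ltac:(lra) ltac:(lra) ltac:(lra) (Ht1 n)) as T.
        rewrite <- Rabs_Ropp. replace ((y - z) ^ 2) with ((z - y) ^ 2) by ring. unfold eps.
        match type of T with Rabs ?X <= _ => match goal with |- Rabs ?Y <= _ => replace Y with X by ring end end.
        lra. }
  exists p.
  assert (Hwd' : forall z, a < z < b -> is_derive w z (p z)) by now apply (taylor_is_derive_on w p C').
  split.
  - assert (Hm : 0 < Rmin (x - a) (b - x)) by (apply Rmin_glb_lt; lra).
    exists (mkposreal _ Hm). intros z Hz. change (Rabs (z - x) < Rmin (x - a) (b - x)) in Hz.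
    apply Rabs_def2 in Hz. pose proof (Rmin_l (x - a) (b - x)). pose proof (Rmin_r (x - a) (b - x)).
    apply Hwd'. lra.
  - assert (Hphi : is_derive (fun z => atan (p z) + z * w z / 2) x (/ w x + w x)).
    { now apply (taylor_is_derive_on (fun z => atan (p z) + z * w z / 2) (fun z => / w z + w z) Ck). }
    assert (Hatp : is_derive (fun z => atan (p z)) x (/ w x + (w x - x * p x) / 2)).
    { apply (is_derive_ext (fun z => (atan (p z) + z * w z / 2) - z * w z / 2)); [intros; simpl; ring |].
      replace (/ w x + (w x - x * p x) / 2) with (/ w x + w x - (w x + x * p x) / 2) by (field; pose proof (Hwd x ltac:(lra)); lra).
      apply (is_derive_minus (fun z => atan (p z) + z * w z / 2) (fun z => z * w z / 2)); [exact Hphi |].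
      apply (is_derive_ext (fun z => / 2 * (z * w z))); [intros; simpl; field |].
      replace ((w x + x * p x) / 2) with (/ 2 * (1 * w x + x * p x)) by field.
      apply is_derive_scal.
      apply (is_derive_mult (fun z => z) w x 1 (p x)).
      - apply (is_derive_id x).
      - apply Hwd'. exact Hx.
      - intros; apply Rmult_comm. }
    apply (is_derive_ext (fun z => tan (atan (p z)))); [intros z; apply tan_atan |].
    rewrite Rmult_comm.
    apply (is_derive_comp tan (fun z => atan (p z)) x); [| exact Hatp].
    rewrite <- (tan_atan (p x)) at 2. rewrite Rplus_comm.
    apply is_derive_tan. pose proof (atan_bound (p x)). apply Rgt_not_eq, cos_gt_0; lra.
Qed.

End Limit.

(** * Monotonicity from differential inequalities *)

Lemma backward_barrier (f f' : R -> R) (a b c : R) :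
  (forall x, a <= x <= b -> is_derive f x (f' x)) ->
  (forall x, a <= x <= b -> c < f x -> f' x <= 0) -> c < f b ->
  forall x, a <= x <= b -> f b <= f x.
Proof.
  intros Hd Hneg Hb x Hx. apply Rnot_lt_le. intros Hlt.
  set (c' := Rmax c (f x)).
  assert (Hc'b : c' < f b) by (apply Rmax_lub_lt; assumption).
  (* To the right of the last point with [f <= c'] the function exceeds [c], hence does not
     increase, and cannot climb to [f b > c']. *)
  destruct (completeness (fun s => x <= s <= b /\ f s <= c')) as [s [Hub Hl]].
  { exists b. intros s [Hs _]. lra. }
  { exists x. split; [lra | apply Rmax_r]. }
  assert (Hs : x <= s <= b).
  { split; [apply Hub; split; [lra | apply Rmax_r] | apply Hl; intros r [Hr _]; lra]. }
  assert (Hfs : f s <= c').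
  { apply Rnot_lt_le. intros Hgt.
    assert (Hcs : continuous f s) by (apply (ex_derive_continuous f); eexists; apply Hd; lra).
    destruct (proj1 (filterlim_locally _ _) Hcs (mkposreal (f s - c') ltac:(lra))) as [d Hd'].
    assert (s <= s - d); [| pose proof (cond_pos d); lra].
    apply Hl. intros r [Hr Hfr]. apply Rnot_lt_le. intros Hrs.
    assert (Hrs2 : r <= s) by (apply Hub; split; assumption).
    assert (Hbr : Rabs (r - s) < d) by (apply Rabs_def1; pose proof (cond_pos d); lra).
    specialize (Hd' r Hbr).
    change (Rabs (f r - f s) < f s - c') in Hd'. apply Rabs_def2 in Hd'. lra. }
  assert (Hsb : s < b).
  { destruct (Rle_lt_or_eq_dec _ _ (proj2 Hs)) as [H | H]; [exact H | rewrite H in Hfs; lra]. }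
  destruct (MVT_cor2 f f' s b Hsb) as [r [Er Hr]].
  { intros r Hr. apply is_derive_Reals, Hd. lra. }
  assert (Hfr : c' < f r).
  { apply Rnot_le_lt. intros Hle. assert (r <= s); [| lra]. apply Hub. split; [lra | exact Hle]. }
  assert (f' r <= 0) by (apply Hneg; [lra | pose proof (Rmax_l c (f x)); fold c' in H; lra]).
  nra.
Qed.

Lemma nondecreasing_of_derive (f f' : R -> R) (a b : R) : a <= b ->
  (forall x, a <= x <= b -> is_derive f x (f' x)) -> (forall x, a <= x <= b -> 0 <= f' x) -> f a <= f b.
Proof.
  intros Hab Hd Hp. destruct (Rle_lt_or_eq_dec _ _ Hab) as [H | ->]; [| lra].
  destruct (MVT_cor2 f f' a b H) as [r [Er Hr]].
  { intros r Hr. apply is_derive_Reals, Hd. lra. }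
  pose proof (Hp r ltac:(lra)). nra.
Qed.

(** * The rescaled solution and its decreasing limit *)

Section SelfSimilar.

Variables (gam C1 : R) (V : R -> R -> R).
Hypotheses (Hgam : 0 < gam) (HC1 : 0 < C1)
  (HV0 : forall y, V y 0 = sqrt (C1 + gam ^ 2 * y ^ 2))
  (HV : forall T, 0 < T -> regular_on T V).

Definition sW (x t : R) : R := V (x * sqrt t) t / sqrt t.
Definition sP (x t : R) : R := u_y V (x * sqrt t) t.
(* [sD x t] is [t] times the time derivative of [sW]. *)
Definition sD (x t : R) : R := sqrt t * u_t V (x * sqrt t) t + x / 2 * sP x t - sW x t / 2.

Lemma V_C21 (y t : R) : 0 < t -> C21_at V y t /\
  u_t V y t = u_yy V y t / (1 + u_y V y t ^ 2) - 1 / V y t.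
Proof. intros Ht. apply (regular_on_mcf (t + 1) V); [apply HV |]; lra. Qed.

Lemma V_pos' (y t : R) : 0 <= t -> 0 < V y t.
Proof. now apply (V_pos V HV). Qed.

Lemma sW_pos (x t : R) : 0 < t -> 0 < sW x t.
Proof. intros Ht. apply Rdiv_lt_0_compat; [apply V_pos'; lra | now apply sqrt_lt_R0]. Qed.

(** [V_scaling] with the factor [sqrt s / sqrt t], which leaves the self-similar variable [x]
    fixed. *)
Lemma sW_decr (x t s : R) : 0 < t <= s -> sW x s <= sW x t.
Proof.
  intros Hts. assert (Ht : 0 < sqrt t) by (apply sqrt_lt_R0; lra). assert (Hs : 0 < sqrt s) by (apply sqrt_lt_R0; lra).
  assert (Hle : sqrt t <= sqrt s) by (apply sqrt_le_1_alt; lra).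
  assert (Hl : 1 <= sqrt s / sqrt t).
  { apply (Rmult_le_reg_r (sqrt t)); [lra |]. unfold Rdiv. rewrite Rmult_assoc, Rinv_l; lra. }
  pose proof (V_scaling gam C1 V HC1 HV0 HV (sqrt s / sqrt t) (x * sqrt s) s Hl ltac:(lra)) as H.
  replace (x * sqrt s / (sqrt s / sqrt t)) with (x * sqrt t) in H by (field; lra).
  replace (s / (sqrt s / sqrt t) ^ 2) with t in H.
  2:{ replace ((sqrt s / sqrt t) ^ 2) with (sqrt s ^ 2 / sqrt t ^ 2) by (field; lra).
      rewrite !pow2_sqrt by lra. field. lra. }
  unfold sW. apply (Rmult_le_reg_r (sqrt s)); [lra |].
  replace (V (x * sqrt s) s / sqrt s * sqrt s) with (V (x * sqrt s) s) by (field; lra).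
  replace (V (x * sqrt t) t / sqrt t * sqrt s) with (sqrt s / sqrt t * V (x * sqrt t) t) by (field; lra).
  exact H.
Qed.

Lemma sW_even (x t : R) : 0 < t -> sW (- x) t = sW x t.
Proof.
  intros Ht. unfold sW. rewrite <- (V_even gam C1 V HV0 HV (x * sqrt t) t) by lra. f_equal. f_equal. ring.
Qed.

Lemma sW_mono (x y t : R) : 0 < t -> 0 <= x <= y -> sW x t <= sW y t.
Proof.
  intros Ht Hxy. assert (Hs : 0 < sqrt t) by now apply sqrt_lt_R0.
  unfold sW, Rdiv. apply Rmult_le_compat_r; [left; now apply Rinv_0_lt_compat |].
  apply (V_monotone gam C1 V HV0 HV); [lra | nra].
Qed.

Lemma sW_neck (x t : R) : 0 < t -> 0 < x <= 1 -> x / 2 <= sW x t.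
Proof.
  intros Ht Hx. assert (Hs : 0 < sqrt t) by now apply sqrt_lt_R0.
  pose proof (V_neck gam C1 V HC1 HV0 HV x t Ht Hx) as H.
  unfold sW. apply (Rmult_le_reg_r (sqrt t)); [exact Hs |].
  unfold Rdiv at 2. rewrite Rmult_assoc, Rinv_l; lra.
Qed.

Lemma sW_sqr (x t : R) : 0 < t -> sW x t ^ 2 * t = V (x * sqrt t) t ^ 2.
Proof.
  intros Ht. assert (Hs : 0 < sqrt t) by now apply sqrt_lt_R0.
  unfold sW. transitivity (V (x * sqrt t) t ^ 2 * (t / sqrt t ^ 2)); [field; lra |].
  rewrite pow2_sqrt by lra. field. lra.
Qed.

Lemma sW_lower (x t : R) : 0 < t -> gam ^ 2 * x ^ 2 - 4 <= sW x t ^ 2.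
Proof.
  intros Ht. pose proof (V_lower gam C1 V HC1 HV0 HV (x * sqrt t) t ltac:(lra)) as H.
  rewrite <- sW_sqr, Rpow_mult_distr, pow2_sqrt in H by lra.
  apply (Rmult_le_reg_r t); [exact Ht |]. lra.
Qed.

Lemma sW_upper (x t : R) : 0 < t -> sW x t ^ 2 <= C1 / t + gam ^ 2 * x ^ 2 + 2 * gam ^ 2.
Proof.
  intros Ht. pose proof (V_upper gam C1 V Hgam HC1 HV0 HV (x * sqrt t) t ltac:(lra)) as H.
  rewrite <- sW_sqr, Rpow_mult_distr, pow2_sqrt in H by lra.
  apply (Rmult_le_reg_r t); [exact Ht |].
  replace ((C1 / t + gam ^ 2 * x ^ 2 + 2 * gam ^ 2) * t) with (C1 + gam ^ 2 * (x ^ 2 * t) + 2 * gam ^ 2 * t) by (field; lra).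
  exact H.
Qed.

Lemma is_derive_scaled (g : R -> R) (s x l : R) : is_derive g (x * s) l -> is_derive (fun z => g (z * s)) x (s * l).
Proof. intros Hg. apply (is_derive_comp g (fun z => z * s)); [exact Hg |]. auto_derive; [exact I | ring]. Qed.

Lemma sW_derive (x t : R) : 0 < t -> is_derive (fun z => sW z t) x (sP x t).
Proof.
  intros Ht. assert (Hs : 0 < sqrt t) by now apply sqrt_lt_R0.
  apply (is_derive_ext (fun z => / sqrt t * V (z * sqrt t) t)); [intros; unfold sW, Rdiv; simpl; ring |].
  replace (sP x t) with (/ sqrt t * (sqrt t * sP x t)) by (field; lra).
  apply is_derive_scal. apply (is_derive_scaled (fun y => V y t)). apply Derive_correct.
  apply (V_C21 _ t Ht).
Qed.

Lemma sP_derive (x t : R) : 0 < t -> is_derive (fun z => sP z t) x (sqrt t * u_yy V (x * sqrt t) t).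
Proof.
  intros Ht. apply (is_derive_scaled (fun y => u_y V y t)). apply Derive_correct. apply (V_C21 _ t Ht).
Qed.

Lemma sW_derive_t (x t : R) : 0 < t -> is_derive (fun s => sW x s) t (sD x t / t).
Proof.
  intros Ht. assert (Hs : 0 < sqrt t) by now apply sqrt_lt_R0.
  (* The curve [(x * sqrt s, s)] moves in both variables, so the chain rule needs joint
     differentiability; continuity of [u_y] provides it. *)
  assert (Hdiff : differentiable_pt_lim V (x * sqrt t) t (sP x t) (u_t V (x * sqrt t) t)).
  { apply filterdiff_differentiable_pt_lim.
    apply (is_derive_filterdiff V (x * sqrt t) t (u_y V) (u_t V (x * sqrt t) t)).
    - exists (mkposreal t Ht). intros [y s] [_ Hsb]. simpl in *. change (Rabs (s - t) < t) in Hsb.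
      apply Rabs_def2 in Hsb. apply Derive_correct. apply (V_C21 y s). lra.
    - apply Derive_correct. apply (V_C21 _ t Ht).
    - exact (proj1 (proj2 (proj2 (proj2 (proj2 (proj1 (V_C21 (x * sqrt t) t Ht))))))). }
  assert (Hsq : is_derive (fun s => x * sqrt s) t (x * (1 / (2 * sqrt t)))).
  { apply is_derive_scal. apply is_derive_sqrt_comp; [exact Ht | apply (is_derive_id t)]. }
  assert (Hc : is_derive (fun s => V (x * sqrt s) s) t (sP x t * (x * (1 / (2 * sqrt t))) + u_t V (x * sqrt t) t * 1)).
  { apply is_derive_Reals. apply (derivable_pt_lim_comp_2d V (fun s => x * sqrt s) (fun s => s)); [exact Hdiff | |].
    - now apply is_derive_Reals.
    - apply derivable_pt_lim_id. }
  replace (sD x t / t) with (((sP x t * (x * (1 / (2 * sqrt t))) + u_t V (x * sqrt t) t * 1) * sqrt t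
     - V (x * sqrt t) t * (1 / (2 * sqrt t))) / sqrt t ^ 2).
  - apply (is_derive_div (fun s => V (x * sqrt s) s) sqrt); [exact Hc | | lra].
    apply (is_derive_sqrt_comp (fun s => s)); [exact Ht | apply (is_derive_id t)].
  - unfold sD, sW. rewrite pow2_sqrt by lra. field. lra.
Qed.

Lemma sD_le_0 (x t : R) : 0 < t -> sD x t <= 0.
Proof.
  intros Ht. assert (H : 0 <= - (sD x t / t)).
  { apply (max_left_derive (fun s => - sW x s) t _ t Ht).
    - intros s Hs. pose proof (sW_decr x s t ltac:(lra)). lra.
    - apply (is_derive_opp (fun s => sW x s)). now apply sW_derive_t. }
  assert (0 < / t) by now apply Rinv_0_lt_compat. unfold Rdiv in H. nra.
Qed.

Lemma comp_scaled_continuous (F : R -> R -> R) (x t : R) : 0 < t ->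
  continuous (fun p : R * R => F (fst p) (snd p)) (x * sqrt t, t) ->
  continuous (fun p : R * R => F (snd p * sqrt (fst p)) (fst p)) (t, x).
Proof.
  intros Ht HF.
  apply (continuous_comp_2 (fun p : R * R => snd p * sqrt (fst p)) (fun p : R * R => fst p) F); [| apply continuous_fst | exact HF].
  apply (continuous_mult (fun p : R * R => snd p) (fun p : R * R => sqrt (fst p))); [apply continuous_snd |].
  apply (continuous_comp (fun p : R * R => fst p) sqrt); [apply continuous_fst | apply continuous_sqrt].
Qed.

Lemma V_continuous (y t : R) : 0 < t -> continuous (fun p : R * R => V (fst p) (snd p)) (y, t).
Proof.
  intros Ht. apply (continuity_2d_pt_filterlim V). intros eps.
  destruct (proj1 (regular_on_mcf _ _ (HV (t + 1) ltac:(lra))) y t ltac:(lra) eps (cond_pos eps)) as [d [Hd Hd']].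
  assert (Hm : 0 < Rmin d t) by (apply Rmin_glb_lt; lra).
  exists (mkposreal _ Hm). simpl. intros z s Hz Hs. pose proof (Rmin_l d t). pose proof (Rmin_r d t).
  pose proof (Rabs_def2 _ _ Hs). apply Hd'; lra.
Qed.

Lemma sD_continuity (x t : R) : 0 < t -> continuity_2d_pt (fun s z => sD z s) t x.
Proof.
  intros Ht. apply continuity_2d_pt_filterlim. unfold sD, sW, sP.
  destruct (V_C21 (x * sqrt t) t Ht) as [[_ [_ [_ [K1 [K2 _]]]]] _].
  pose proof (comp_scaled_continuous (u_t V) x t Ht K1) as Q1.
  pose proof (comp_scaled_continuous (u_y V) x t Ht K2) as Q2.
  pose proof (comp_scaled_continuous V x t Ht (V_continuous _ _ Ht)) as Q3.
  assert (Hs : 0 < sqrt t) by now apply sqrt_lt_R0.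
  assert (Qs : continuous (fun p : R * R => sqrt (fst p)) (t, x))
    by (apply (continuous_comp (fun p : R * R => fst p) sqrt); [apply continuous_fst | apply continuous_sqrt]).
  apply (continuous_minus (fun p : R * R => sqrt (fst p) * u_t V (snd p * sqrt (fst p)) (fst p)
      + snd p / 2 * u_y V (snd p * sqrt (fst p)) (fst p))
    (fun p : R * R => V (snd p * sqrt (fst p)) (fst p) / sqrt (fst p) / 2)).
  - apply (continuous_plus (fun p : R * R => sqrt (fst p) * u_t V (snd p * sqrt (fst p)) (fst p))).
    + now apply (continuous_mult (fun p : R * R => sqrt (fst p))).
    + apply (continuous_mult (fun p : R * R => snd p / 2)); [| exact Q2].
      apply (continuous_mult (fun p : R * R => snd p) (fun _ => / 2)); [apply continuous_snd | apply continuous_const].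
  - apply (continuous_mult (fun p : R * R => V (snd p * sqrt (fst p)) (fst p) / sqrt (fst p)) (fun _ => / 2));
      [| apply continuous_const].
    apply (continuous_mult (fun p : R * R => V (snd p * sqrt (fst p)) (fst p)) (fun p : R * R => / sqrt (fst p))); [exact Q3 |].
    apply (continuous_comp (fun p : R * R => sqrt (fst p)) Rinv); [exact Qs |].
    apply (ex_derive_continuous Rinv). auto_derive. simpl. lra.
Qed.

(** The flow equation in self-similar variables. Since [sD <= 0], it bounds the derivative of the
    flux from above, which is the one-sided information behind the slope bounds. *)
Lemma atan_sP_derive (x t : R) : 0 < t ->
  is_derive (fun z => atan (sP z t)) x (sD x t + / sW x t + (sW x t - x * sP x t) / 2).
Proof.
  intros Ht. assert (Hs : 0 < sqrt t) by now apply sqrt_lt_R0.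
  pose proof (V_pos' (x * sqrt t) t ltac:(lra)) as Hp.
  replace (sD x t + / sW x t + (sW x t - x * sP x t) / 2) with
    (sqrt t * u_yy V (x * sqrt t) t * / (1 + sP x t ^ 2)).
  - apply (is_derive_comp atan (fun z => sP z t)); [apply is_derive_atan_comp | now apply sP_derive].
  - unfold sD. rewrite (proj2 (V_C21 (x * sqrt t) t Ht)). unfold sW, sP. field.
    pose proof (one_plus_sqr_pos (u_y V (x * sqrt t) t)). repeat split; lra.
Qed.

Lemma sZ_derive (x t : R) : 0 < t ->
  is_derive (fun z => atan (sP z t) + z * sW z t / 2) x (sD x t + (/ sW x t + sW x t)).
Proof.
  intros Ht.
  replace (sD x t + (/ sW x t + sW x t)) with
    ((sD x t + / sW x t + (sW x t - x * sP x t) / 2) + / 2 * (1 * sW x t + x * sP x t)) by (pose proof (sW_pos x t Ht); field; lra).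
  - apply (is_derive_plus (fun z => atan (sP z t)) (fun z => z * sW z t / 2)); [now apply atan_sP_derive |].
    apply (is_derive_ext (fun z => / 2 * (z * sW z t))); [intros; simpl; field |].
    apply is_derive_scal.
    apply (is_derive_mult (fun z => z) (fun z => sW z t) x 1 (sP x t)).
    + apply (is_derive_id x).
    + now apply sW_derive.
    + intros; apply Rmult_comm.
Qed.

Lemma sP_nonneg (x t : R) : 0 < t -> 0 < x -> 0 <= sP x t.
Proof.
  intros Ht Hx. apply (max_left_derive (fun z => sW z t) x _ x Hx).
  - intros s Hs. apply sW_mono; lra.
  - now apply sW_derive.
Qed.

Lemma sP_odd (x t : R) : 0 < t -> sP (- x) t = - sP x t.
Proof.
  intros Ht. rewrite <- (is_derive_unique _ _ _ (sW_derive (- x) t Ht)).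
  apply is_derive_unique.
  apply (is_derive_ext (fun z => sW (- z) t)); [intros z; now apply sW_even |].
  replace (- sP x t) with (-1 * sP x t) by ring.
  apply (is_derive_comp (fun z => sW z t) (fun z => - z) (- x)).
  - rewrite Ropp_involutive. now apply sW_derive.
  - auto_derive; [exact I | ring].
Qed.

Lemma sP_nonneg0 (x t : R) : 0 < t -> 0 <= x -> 0 <= sP x t.
Proof.
  intros Ht [Hx | <-]; [now apply sP_nonneg |].
  pose proof (sP_odd 0 t Ht) as H. rewrite Ropp_0 in H. lra.
Qed.

Lemma sW_le (x b t : R) : 1 <= t -> Rabs x <= b -> sW x t <= C1 + gam ^ 2 * b ^ 2 + 2 * gam ^ 2 + 1.
Proof.
  intros Ht Hx. pose proof (sW_upper x t ltac:(lra)) as H.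
  assert (C1 / t <= C1).
  { apply (Rmult_le_reg_r t); [lra |]. unfold Rdiv. rewrite Rmult_assoc, Rinv_l; nra. }
  assert (x ^ 2 <= b ^ 2) by (rewrite <- (pow2_abs x); apply pow_incr; split; [apply Rabs_pos | exact Hx]).
  assert (gam ^ 2 * x ^ 2 <= gam ^ 2 * b ^ 2) by (apply Rmult_le_compat_l; [apply pow2_ge_0 | lra]).
  pose proof (sW_pos x t ltac:(lra)). nra.
Qed.

(* The slope decreases in [x] as long as it exceeds [(sW + 2 / sW) / x]. *)
Lemma gradient_bound (a' a b delta : R) : 0 < a' < a -> 0 < delta ->
  exists Q, 0 <= Q /\ forall t, 1 <= t -> (forall x, a' <= x <= b -> delta <= sW x t) ->
    forall x, a <= x <= b -> sP x t <= Q.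
Proof.
  intros Ha Hdelta.
  set (M := C1 + gam ^ 2 * b ^ 2 + 2 * gam ^ 2 + 1).
  assert (HM : 0 < M).
  { unfold M. pose proof (Rmult_le_pos _ _ (pow2_ge_0 gam) (pow2_ge_0 b)). pose proof (pow2_ge_0 gam). lra. }
  assert (Hid : 0 < / delta) by now apply Rinv_0_lt_compat.
  (* Slopes above [P0] at some [s >= a'] make [s * sP] exceed [sW + 2 / sW], which is exactly when
     the bound for the derivative of the flux is negative. *)
  set (P0 := (M + 2 * / delta) / a').
  assert (HP0 : 0 < P0) by (apply Rdiv_lt_0_compat; lra).
  assert (HMa : 0 < M / (a - a')) by (apply Rdiv_lt_0_compat; lra).
  exists (P0 + M / (a - a')). split; [lra |].
  intros t Ht Hlow x Hx. apply Rnot_lt_le. intros Hgt.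
  assert (Ht0 : 0 < t) by lra.
  assert (Hback : forall z, a' <= z <= x -> sP x t <= sP z t).
  { intros z Hz.
    pose proof (backward_barrier (fun z => atan (sP z t))
      (fun x => sD x t + / sW x t + (sW x t - x * sP x t) / 2) a' x (atan P0)) as Hbb.
    assert (Hat : atan (sP x t) <= atan (sP z t)).
    { apply Hbb; [| | | exact Hz].
      - intros s _. now apply atan_sP_derive.
      - intros s Hs Hps.
        assert (Hps' : P0 < sP s t).
        { apply Rnot_le_lt. intros [Hl | Hl]; [apply atan_increasing in Hl; lra | rewrite Hl in Hps; lra]. }
        pose proof (Hlow s ltac:(lra)) as Hls.
        pose proof (sW_le s b t Ht ltac:(rewrite Rabs_pos_eq; lra)) as Hus. fold M in Hus.
        assert (/ sW s t <= / delta) by (apply Rinv_le_contravar; lra).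
        assert (M + 2 * / delta <= s * sP s t).
        { replace (M + 2 * / delta) with (a' * P0) by (unfold P0; field; lra). apply Rmult_le_compat; lra. }
        pose proof (sD_le_0 s t Ht0). lra.
      - apply atan_increasing. lra. }
    apply Rnot_lt_le. intros Hlt. apply atan_increasing in Hlt. lra. }
  (* The slope is at least [sP x t] all the way back to [a'], so that the graph would rise by more
     than its upper bound [M]. *)
  assert (HW : sW a' t + sP x t * (x - a') <= sW x t).
  { pose proof (nondecreasing_of_derive (fun z => sW z t - sP x t * (z - a')) (fun z => sP z t - sP x t) a' x ltac:(lra)) as Hn.
    cbv beta in Hn. rewrite Rminus_diag, Rmult_0_r, Rminus_0_r in Hn.
    assert (sW a' t <= sW x t - sP x t * (x - a')); [| lra].
    apply Hn.
    - intros z _. apply (is_derive_minus (fun z => sW z t) (fun z => sP x t * (z - a'))); [now apply sW_derive |].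
      auto_derive; [exact I | ring].
    - intros z Hz. pose proof (Hback z Hz). lra. }
  pose proof (sW_le x b t Ht ltac:(rewrite Rabs_pos_eq; lra)) as Hux. fold M in Hux.
  pose proof (sW_pos a' t Ht0).
  assert (M < sP x t * (x - a')); [| lra].
  apply Rlt_le_trans with (sP x t * (a - a')).
  - replace M with (M / (a - a') * (a - a')) by (field; lra). apply Rmult_lt_compat_r; lra.
  - apply Rmult_le_compat_l; lra.
Qed.

Lemma sW_limit : exists w : R -> R, (forall x t, 0 < t -> w x <= sW x t) /\
  (forall x eps, 0 < eps -> exists t0, forall t, t0 <= t -> Rabs (sW x t - w x) < eps).
Proof.
  assert (H : forall x, exists l, (forall t, 0 < t -> l <= sW x t) /\
    forall eps, 0 < eps -> exists t0, forall t, t0 <= t -> Rabs (sW x t - l) < eps).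
  { intros x. destruct (completeness (fun r => exists t, 0 < t /\ r = - sW x t)) as [m [Hub Hl]].
    - exists 0. intros r [t [Ht ->]]. pose proof (sW_pos x t Ht). lra.
    - exists (- sW x 1), 1. split; [lra | reflexivity].
    - exists (- m).
      assert (Hlow : forall t, 0 < t -> - m <= sW x t).
      { intros t Ht. assert (- sW x t <= m) by (apply Hub; exists t; auto). lra. }
      split; [exact Hlow |]. intros eps He.
      assert (Hex : exists t0, 0 < t0 /\ sW x t0 < - m + eps).
      { apply NNPP. intros Hn. assert (m <= m - eps); [| lra]. apply Hl. intros r [t [Ht ->]].
        apply Rnot_lt_le. intros Hlt. apply Hn. exists t. split; [exact Ht | lra]. }
      destruct Hex as [t0 [Ht0 H0]]. exists t0. intros t Htt.
      pose proof (sW_decr x t0 t ltac:(lra)). pose proof (Hlow t ltac:(lra)). apply Rabs_def1; lra. }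
  exists (fun x => proj1_sig (constructive_indefinite_description _ (H x))).
  split.
  - intros x. exact (proj1 (proj2_sig (constructive_indefinite_description _ (H x)))).
  - intros x. exact (proj2 (proj2_sig (constructive_indefinite_description _ (H x)))).
Qed.

Definition solves_expander_ode (w : R -> R) (x : R) : Prop :=
  is_derive w x (Derive w x) /\
  is_derive (Derive w) x ((1 + Derive w x ^ 2) * (/ w x + (w x - x * Derive w x) / 2)).

Lemma limit_solves_ode (w : R -> R) (a b delta P : R) : a < b -> 0 < delta ->
  (forall x eps, 0 < eps -> exists t0, forall t, t0 <= t -> Rabs (sW x t - w x) < eps) ->
  (forall x t, a <= x <= b -> 1 <= t -> delta <= sW x t /\ Rabs (sP x t) <= P) ->
  forall x, a < x < b -> solves_expander_ode w x.
Proof.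
  intros Hab Hdelta Hlim Hb x Hx.
  destruct (limit_ode sW sP sD w a b delta P Hab Hdelta Hb sW_derive sW_derive_t sD_le_0 sD_continuity
    sZ_derive (fun x _ => Hlim x) x Hx) as [p [H1 H2]].
  pose proof (locally_singleton _ _ H1) as H0.
  assert (E : Derive w x = p x) by now apply is_derive_unique.
  unfold solves_expander_ode. rewrite E. split; [exact H0 |].
  apply (is_derive_ext_loc p); [| exact H2].
  generalize H1. apply filter_imp. intros z Hz. symmetry. now apply is_derive_unique.
Qed.

(* A solution on [(0, oo)] cannot emanate from the axis at the origin: [w <= P x] there, so that
   [w'' >= 1 / w - C] is not integrable. *)
Lemma no_touching_axis (w : R -> R) :
  (forall x, 0 < x -> 0 < w x) -> (forall x, 0 < x -> solves_expander_ode w x) ->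
  (forall x, 0 < x -> 0 <= Derive w x) -> (forall eps, 0 < eps -> exists x, 0 < x /\ w x < eps) -> False.
Proof.
  intros Hpos Hode Hmono Hzero.
  set (p := Derive w).
  assert (Hwd : forall x, 0 < x -> is_derive w x (p x)) by (intros x Hx; now apply Hode).
  assert (Hpd : forall x, 0 < x -> is_derive p x ((1 + p x ^ 2) * (/ w x + (w x - x * p x) / 2)))
    by (intros x Hx; now apply Hode).
  assert (Hwm : forall x y, 0 < x <= y -> w x <= w y).
  { intros x y Hxy. apply (nondecreasing_of_derive w p); [lra | |].
    - intros z Hz. apply Hwd. lra.
    - intros z Hz. apply Hmono. lra. }
  (* Otherwise [(w ^ 2)' >= 4 / x] on [(0, 1]], which is not integrable at 0. The point [x] below is
     small enough to contradict [0 <= w x ^ 2]. *)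
  assert (Hex : exists y, 0 < y <= 1 /\ y * w y * p y < 2).
  { apply NNPP. intros Hn.
    assert (Hge : forall y, 0 < y <= 1 -> 2 <= y * w y * p y).
    { intros y Hy. apply Rnot_lt_le. intros Hlt. apply Hn. exists y. auto. }
    set (x := exp (- (w 1 ^ 2 / 4 + 1))). assert (Hx : 0 < x) by apply exp_pos.
    assert (Hx1 : x <= 1).
    { apply Rle_trans with (exp 0); [| rewrite exp_0; lra].
      unfold x. apply exp_mono. pose proof (pow2_ge_0 (w 1)). lra. }
    assert (H : w x ^ 2 - 4 * ln x <= w 1 ^ 2 - 4 * ln 1).
    { apply (nondecreasing_of_derive (fun z => w z ^ 2 - 4 * ln z) (fun z => 2 * w z * p z - 4 * / z) x 1 Hx1).
      - intros z Hz. apply (is_derive_minus (fun z => w z ^ 2) (fun z => 4 * ln z)).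
        + replace (2 * w z * p z) with (INR 2 * p z * w z ^ pred 2) by (simpl; ring).
          apply is_derive_pow. apply Hwd. lra.
        + apply is_derive_scal. apply is_derive_Reals, derivable_pt_lim_ln. lra.
      - intros z Hz. specialize (Hge z ltac:(lra)).
        apply (Rmult_le_reg_r z); [lra |].
        replace ((2 * w z * p z - 4 * / z) * z) with (2 * (z * w z * p z) - 4) by (field; lra). lra. }
    rewrite ln_1 in H. unfold x in H at 2. rewrite ln_exp in H. pose proof (pow2_ge_0 (w x)). lra. }
  destruct Hex as [y [Hy Hym]].
  (* As long as [x * w * p < 2], the equation gives [p' >= 0], so [x * w * p] is nondecreasing.
     Going to smaller [x] the bound therefore persists, and [w] is convex on [(0, y]]. *)
  assert (Hm : forall x, 0 < x <= y -> x * w x * p x < 2).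
  { intros x Hx.
    pose proof (backward_barrier (fun z => - (z * w z * p z))
      (fun z => - ((1 * w z + z * p z) * p z + z * w z * ((1 + p z ^ 2) * (/ w z + (w z - z * p z) / 2)))) x y (-2)) as Hbb.
    assert (- (y * w y * p y) <= - (x * w x * p x)); [| lra].
    apply Hbb; [| | lra | lra].
    - intros z Hz. apply (is_derive_opp (fun z => z * w z * p z)).
      apply (is_derive_mult (fun z => z * w z) p); [| apply Hpd; lra |].
      + apply (is_derive_mult (fun z => z) w z 1 (p z)); [apply (is_derive_id z) | apply Hwd; lra |].
        intros; apply Rmult_comm.
      + intros; apply Rmult_comm.
    - intros z Hz Hzm.
      pose proof (Hpos z ltac:(lra)) as W0. pose proof (Hmono z ltac:(lra)) as P0'. fold p in P0'.
      assert (Hin : 0 <= / w z + (w z - z * p z) / 2).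
      { apply (Rmult_le_reg_r (w z)); [exact W0 |].
        replace ((/ w z + (w z - z * p z) / 2) * w z) with (1 + (w z ^ 2 - z * w z * p z) / 2) by (field; lra).
        pose proof (pow2_ge_0 (w z)). lra. }
      pose proof (one_plus_sqr_pos (p z)) as Q.
      assert (0 <= (1 + p z ^ 2) * (/ w z + (w z - z * p z) / 2)) by (apply Rmult_le_pos; lra).
      assert (0 <= z * w z) by (apply Rmult_le_pos; lra).
      assert (0 <= z * p z) by (apply Rmult_le_pos; lra).
      assert (0 <= (1 * w z + z * p z) * p z) by (apply Rmult_le_pos; lra).
      assert (0 <= z * w z * ((1 + p z ^ 2) * (/ w z + (w z - z * p z) / 2))) by (apply Rmult_le_pos; lra).
      lra. }
  assert (Hin : forall z, 0 < z <= y -> 0 <= / w z + (w z - z * p z) / 2).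
  { intros z Hz. pose proof (Hpos z ltac:(lra)) as W0. specialize (Hm z Hz).
    apply (Rmult_le_reg_r (w z)); [exact W0 |].
    replace ((/ w z + (w z - z * p z) / 2) * w z) with (1 + (w z ^ 2 - z * w z * p z) / 2) by (field; lra).
    pose proof (pow2_ge_0 (w z)). lra. }
  assert (Hpm : forall x, 0 < x <= y -> p x <= p y).
  { intros x Hx. apply (nondecreasing_of_derive p (fun z => (1 + p z ^ 2) * (/ w z + (w z - z * p z) / 2))); [lra | |].
    - intros z Hz. apply Hpd. lra.
    - intros z Hz. apply Rmult_le_pos; [left; apply one_plus_sqr_pos | apply Hin; lra]. }
  set (P := p y).
  assert (Hlin : forall x, 0 < x <= y -> w x <= P * x).
  { intros x Hx. apply le_epsilon. intros e He.
    destruct (Hzero e He) as [x1 [Hx1 He1]].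
    set (x2 := Rmin x1 x). assert (Hx2 : 0 < x2) by (apply Rmin_glb_lt; lra).
    assert (Hx21 : x2 <= x1) by apply Rmin_l. assert (Hx22 : x2 <= x) by apply Rmin_r.
    assert (P * x2 - w x2 <= P * x - w x).
    { apply (nondecreasing_of_derive (fun z => P * z - w z) (fun z => P - p z)); [exact Hx22 | |].
      - intros z Hz. apply (is_derive_minus (fun z => P * z) w); [auto_derive; [exact I | ring] | apply Hwd; lra].
      - intros z Hz. pose proof (Hpm z ltac:(lra)). fold P in H. lra. }
    assert (HP : 0 <= P) by (apply Hmono; lra).
    pose proof (Hwm x2 x1 ltac:(lra)). assert (0 <= P * x2) by (apply Rmult_le_pos; lra). lra. }
  assert (HP : 0 < P).
  { pose proof (Hlin y ltac:(lra)). pose proof (Hpos y ltac:(lra)). nra. }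
  assert (HiP : 0 < / P) by now apply Rinv_0_lt_compat.
  (* With [w <= P * z] and [0 <= p <= P], the equation yields [p' >= / (P * z) - P / 2]. Hence
     [p - / P * ln z + P / 2 * z] is nondecreasing; its value at [y] is [B], while near 0 the
     logarithm would force [p < 0]. *)
  set (B := P - / P * ln y + P / 2 * y).
  set (x := Rmin y (exp (- (P * (Rabs B + 1))))).
  assert (Hx : 0 < x <= y) by (split; [apply Rmin_glb_lt; [lra | apply exp_pos] | apply Rmin_l]).
  assert (Hlnx : ln x <= - (P * (Rabs B + 1))).
  { rewrite <- (ln_exp (- (P * (Rabs B + 1)))). apply ln_le; [lra | apply Rmin_r]. }
  assert (H : p x - / P * ln x + P / 2 * x <= p y - / P * ln y + P / 2 * y).
  { apply (nondecreasing_of_derive (fun z => p z - / P * ln z + P / 2 * z)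
      (fun z => (1 + p z ^ 2) * (/ w z + (w z - z * p z) / 2) - / P * / z + P / 2)); [lra | |].
    - intros z Hz. apply (is_derive_plus (fun z => p z - / P * ln z) (fun z => P / 2 * z)).
      + apply (is_derive_minus p (fun z => / P * ln z)); [apply Hpd; lra |].
        apply is_derive_scal. apply is_derive_Reals, derivable_pt_lim_ln. lra.
      + auto_derive; [exact I | ring].
    - intros z Hz. pose proof (Hin z ltac:(lra)) as H0. pose proof (pow2_ge_0 (p z)) as H1.
      assert (/ w z + (w z - z * p z) / 2 <= (1 + p z ^ 2) * (/ w z + (w z - z * p z) / 2)) by nra.
      pose proof (Hpos z ltac:(lra)) as W0. pose proof (Hlin z ltac:(lra)) as Hl.
      assert (/ (P * z) <= / w z) by (apply Rinv_le_contravar; lra).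
      assert (E : / (P * z) = / P * / z) by (field; lra).
      pose proof (Hpm z ltac:(lra)) as Hpz. fold P in Hpz. pose proof (Hmono z ltac:(lra)) as Hp0. fold p in Hp0.
      assert (z * p z <= 1 * P) by (apply Rmult_le_compat; lra). lra. }
  fold P in H. fold B in H.
  assert (H2 : Rabs B + 1 <= - (/ P * ln x)).
  { replace (- (/ P * ln x)) with (/ P * - ln x) by ring.
    replace (Rabs B + 1) with (/ P * (P * (Rabs B + 1))) by (field; lra).
    apply Rmult_le_compat_l; lra. }
  pose proof (Rle_abs B). pose proof (Hmono x ltac:(lra)) as Hp0. fold p in Hp0.
  assert (0 <= P / 2 * x) by (apply Rmult_le_pos; lra). lra.
Qed.

Theorem expander_profile_exists : exists w : R -> R,
  (forall x, 0 < w x) /\ (forall x, solves_expander_ode w x) /\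
  (forall x, gam ^ 2 * x ^ 2 - 4 <= w x ^ 2 <= gam ^ 2 * x ^ 2 + 2 * gam ^ 2).
Proof.
  destruct sW_limit as [w [Hwle Hlim]].
  assert (Hpass : forall (x A : R), (forall t, 1 <= t -> A <= sW x t) -> A <= w x).
  { intros x A HA. apply le_epsilon. intros e He. destruct (Hlim x e He) as [t0 H0].
    specialize (H0 (Rmax 1 t0) (Rmax_r 1 t0)). specialize (HA (Rmax 1 t0) (Rmax_l 1 t0)).
    apply Rabs_def2 in H0. lra. }
  assert (Hmono : forall x y, 0 <= x <= y -> w x <= w y).
  { intros x y Hxy. apply Hpass. intros t Ht. eapply Rle_trans; [apply (Hwle x t); lra |].
    apply sW_mono; lra. }
  assert (Hneck : forall x, 0 < x <= 1 -> x / 2 <= w x).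
  { intros x Hx. apply Hpass. intros t Ht. apply sW_neck; lra. }
  assert (Hposx : forall x, 0 < x -> 0 < w x).
  { intros x Hx. destruct (Rle_lt_dec x 1) as [H | H].
    - pose proof (Hneck x ltac:(lra)). lra.
    - pose proof (Hneck 1 ltac:(lra)). pose proof (Hmono 1 x ltac:(lra)). lra. }
  (* The slope bound on [[x / 2, x + 1]] needs room on its left with [sW] bounded below, hence the
     point [x / 4]; monotonicity spreads the positive value of [w] there. *)
  assert (Hode : forall x, 0 < x -> solves_expander_ode w x).
  { intros x Hx.
    destruct (gradient_bound (x / 4) (x / 2) (x + 1) (w (x / 4)) ltac:(lra) ltac:(apply Hposx; lra)) as [Q [HQ0 HQ]].
    assert (Hlow : forall z t, x / 4 <= z -> 1 <= t -> w (x / 4) <= sW z t).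
    { intros z t Hz Ht. eapply Rle_trans; [apply (Hmono (x / 4) z); lra | apply Hwle; lra]. }
    apply (limit_solves_ode w (x / 2) (x + 1) (w (x / 4)) Q); try lra; auto.
    - apply Hposx. lra.
    - intros z t Hz Ht. split; [apply Hlow; lra |].
      rewrite Rabs_pos_eq by (apply sP_nonneg; lra).
      apply HQ; auto. intros s Hs. apply Hlow; lra. }
  (* [no_touching_axis] keeps [w] away from 0 on [(0, oo)]. As [w <= sW], the bound holds for all
     rescaled solutions; evenness and continuity extend it to [x <= 0]. *)
  assert (HL : exists L, 0 < L /\ forall x t, 1 <= t -> L <= sW x t).
  { assert (HL1 : exists L, 0 < L /\ forall x, 0 < x -> L <= w x).
    { apply NNPP. intros Hn. apply (no_touching_axis w); auto.
      - intros x Hx. apply (max_left_derive w x _ x Hx); [| exact (proj1 (Hode x Hx))].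
        intros s Hs. apply Hmono. lra.
      - intros e He. apply NNPP. intros Hn2. apply Hn. exists e. split; [exact He |].
        intros x Hx. apply Rnot_lt_le. intros Hlt. apply Hn2. exists x. auto. }
    destruct HL1 as [L [HL0 HL1]]. exists L. split; [exact HL0 |].
    assert (Hp : forall x t, 0 < x -> 1 <= t -> L <= sW x t).
    { intros x t Hx Ht. apply Rle_trans with (w x); [now apply HL1 | apply Hwle; lra]. }
    intros x t Ht. destruct (Rtotal_order x 0) as [H | [-> | H]].
    - rewrite <- sW_even by lra. apply Hp; lra.
    - apply Rnot_lt_le. intros Hlt.
      assert (Hc : continuous (fun z => sW z t) 0).
      { apply (ex_derive_continuous (fun z => sW z t)). eexists. apply sW_derive. lra. }
      destruct (proj1 (filterlim_locally _ _) Hc (mkposreal (L - sW 0 t) ltac:(lra))) as [d Hd].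
      pose proof (cond_pos d).
      assert (Hbd : Rabs (d / 2 - 0) < d) by (apply Rabs_def1; lra).
      specialize (Hd (d / 2) Hbd).
      change (Rabs (sW (d / 2) t - sW 0 t) < L - sW 0 t) in Hd. apply Rabs_def2 in Hd.
      pose proof (Hp (d / 2) t ltac:(lra) Ht). lra.
    - now apply Hp. }
  destruct HL as [L [HL0 HL]].
  exists w. split; [| split].
  - intros x. apply Rlt_le_trans with L; [exact HL0 |]. apply Hpass. intros t Ht. now apply HL.
  - intros x. set (N := Rabs x + 1).
    pose proof (Rabs_pos x) as Hax.
    set (M := C1 + gam ^ 2 * N ^ 2 + 2 * gam ^ 2 + 1).
    assert (HM : 0 < M).
    { unfold M. pose proof (Rmult_le_pos _ _ (pow2_ge_0 gam) (pow2_ge_0 N)). pose proof (pow2_ge_0 gam). lra. }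
    assert (HiL : 0 < / L) by now apply Rinv_0_lt_compat.
    (* Near the origin [gradient_bound] has no room on the left. Instead [sP 0 t = 0] and the flux
       has derivative at most [C], so on [[0, r]] it is at most [1 / 2 < PI / 4] and the slope stays
       below 1. *)
    set (C := / L + M / 2). set (r := / (2 * C)).
    assert (HC : 0 < C) by (unfold C; lra).
    assert (Hr : 0 < r) by (apply Rinv_0_lt_compat; lra).
    destruct (gradient_bound (r / 2) r N L ltac:(lra) HL0) as [Q [HQ0 HQ]].
    assert (Hgrad : forall z t, 0 <= z <= N -> 1 <= t -> 0 <= sP z t <= Q + 1).
    { intros z t Hz Ht. split; [apply sP_nonneg0; lra |].
      destruct (Rle_lt_dec r z) as [H | H].
      - assert (sP z t <= Q); [| lra]. apply HQ; auto; lra.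
      - assert (Hs0 : sP 0 t = 0).
        { pose proof (sP_odd 0 t ltac:(lra)) as Ho. rewrite Ropp_0 in Ho. lra. }
        assert (Ha : C * 0 - atan (sP 0 t) <= C * z - atan (sP z t)).
        { apply (nondecreasing_of_derive (fun z => C * z - atan (sP z t))
            (fun z => C - (sD z t + / sW z t + (sW z t - z * sP z t) / 2))); [lra | |].
          - intros s _. apply (is_derive_minus (fun z => C * z) (fun z => atan (sP z t)));
              [auto_derive; [exact I | ring] | apply atan_sP_derive; lra].
          - intros s Hs. pose proof (sD_le_0 s t ltac:(lra)). pose proof (HL s t Ht).
            assert (/ sW s t <= / L) by (apply Rinv_le_contravar; lra).
            pose proof (sW_le s N t Ht ltac:(rewrite Rabs_pos_eq; lra)) as Hus. fold M in Hus.
            assert (0 <= s * sP s t) by (apply Rmult_le_pos; [lra | apply sP_nonneg0; lra]).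
            unfold C. lra. }
        rewrite Hs0, atan_0 in Ha.
        assert (C * z <= / 2).
        { apply Rle_trans with (C * r); [apply Rmult_le_compat_l; lra |]. right. unfold r. field. lra. }
        assert (atan (sP z t) < atan 1) by (rewrite atan_1; pose proof PI2_1; lra).
        assert (sP z t < 1); [| lra].
        apply Rnot_le_lt. intros [Hl | Hl]; [apply atan_increasing in Hl; lra | rewrite <- Hl in H1; lra]. }
    apply (limit_solves_ode w (- N) N L (Q + 1)); auto.
    + unfold N. lra.
    + intros z t Hz Ht. split; [now apply HL |].
      destruct (Rle_lt_dec 0 z) as [H | H].
      * destruct (Hgrad z t ltac:(lra) Ht). rewrite Rabs_pos_eq; lra.
      * destruct (Hgrad (- z) t ltac:(lra) Ht) as [G1 G2]. rewrite sP_odd in G1, G2 by lra.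
        rewrite Rabs_left1; lra.
    + pose proof (Rle_abs x). pose proof (Rle_abs (- x)). rewrite Rabs_Ropp in H0. unfold N. lra.
  - intros x.
    assert (Hw0 : 0 <= w x) by (apply Hpass; intros t Ht; left; apply sW_pos; lra).
    split; apply le_epsilon; intros e He.
    + set (s := sW x 1 + w x + 1).
      assert (Hs : 0 < s) by (pose proof (sW_pos x 1 Rlt_0_1); unfold s; lra).
      destruct (Hlim x (e / s) ltac:(now apply Rdiv_lt_0_compat)) as [t0 H0].
      set (t := Rmax 1 t0). specialize (H0 t (Rmax_r 1 t0)). pose proof (Rmax_l 1 t0). fold t in H.
      pose proof (sW_lower x t ltac:(lra)) as H1. apply Rabs_def2 in H0.
      pose proof (sW_decr x 1 t ltac:(lra)). pose proof (Hwle x t ltac:(lra)).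
      assert (sW x t ^ 2 - w x ^ 2 <= e); [| lra].
      replace (sW x t ^ 2 - w x ^ 2) with ((sW x t - w x) * (sW x t + w x)) by ring.
      assert (Hd : 0 <= sW x t - w x <= e / s) by lra.
      apply Rle_trans with (e / s * s); [| right; field; lra].
      apply Rmult_le_compat; try lra. unfold s. lra.
    + set (t := Rmax 1 (C1 / e)). assert (Ht1 : 1 <= t) by apply Rmax_l.
      assert (Hte : C1 / e <= t) by apply Rmax_r.
      pose proof (sW_upper x t ltac:(lra)) as H1. pose proof (Hwle x t ltac:(lra)).
      assert (w x ^ 2 <= sW x t ^ 2) by (apply pow_incr; lra).
      assert (C1 / t <= e); [| lra].
      apply (Rmult_le_reg_r t); [lra |]. replace (C1 / t * t) with C1 by (field; lra).
      apply (Rmult_le_compat_r e) in Hte; [| lra]. replace (C1 / e * e) with C1 in Hte by (field; lra). lra.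
Qed.

End SelfSimilar.

(** * From the profile to an expander curve *)

(** The derivatives are carried as witnesses, which makes closure under products a plain induction
    instead of a Leibniz formula for [Derive_n]. *)
Fixpoint times_derivable (n : nat) (f : R -> R) : Prop :=
  match n with
  | O => True
  | S n => exists f' : R -> R, (forall x, is_derive f x (f' x)) /\ times_derivable n f'
  end.

Lemma times_derivable_ext (n : nat) (f g : R -> R) : (forall x, f x = g x) ->
  times_derivable n f -> times_derivable n g.
Proof.
  destruct n as [| n]; [easy |]. intros E [f' [H1 H2]]. exists f'. split; [| exact H2].
  intros x. now apply (is_derive_ext f).
Qed.

Lemma times_derivable_S (n : nat) : forall f, times_derivable (S n) f -> times_derivable n f.
Proof.
  induction n as [| n IH]; [easy |]. intros f [f' [H1 H2]]. exists f'. split; [exact H1 | now apply IH].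
Qed.

Lemma times_derivable_plus (n : nat) : forall f g, times_derivable n f -> times_derivable n g ->
  times_derivable n (fun x => f x + g x).
Proof.
  induction n as [| n IH]; [easy |]. intros f g [f' [F1 F2]] [g' [G1 G2]].
  exists (fun x => f' x + g' x). split; [| now apply IH]. intros x. now apply (is_derive_plus f g).
Qed.

Lemma times_derivable_mult (n : nat) : forall f g, times_derivable n f -> times_derivable n g ->
  times_derivable n (fun x => f x * g x).
Proof.
  induction n as [| n IH]; [easy |]. intros f g Hf Hg.
  pose proof (times_derivable_S n f Hf) as F0. pose proof (times_derivable_S n g Hg) as G0.
  destruct Hf as [f' [F1 F2]]. destruct Hg as [g' [G1 G2]].
  exists (fun x => f' x * g x + f x * g' x). split.
  - intros x. apply (is_derive_mult f g); auto. intros; apply Rmult_comm.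
  - apply times_derivable_plus; now apply IH.
Qed.

Lemma times_derivable_scal (n : nat) (c : R) : forall f, times_derivable n f ->
  times_derivable n (fun x => c * f x).
Proof.
  induction n as [| n IH]; [easy |]. intros f [f' [F1 F2]].
  exists (fun x => c * f' x). split; [| now apply IH]. intros x. now apply is_derive_scal.
Qed.

Lemma times_derivable_smooth (f : R -> R) : (forall n, times_derivable n f) -> smooth f.
Proof.
  intros H.
  assert (Haux : forall n m, times_derivable (n + m) f ->
    exists g, (forall x, Derive_n f n x = g x) /\ times_derivable m g).
  { induction n as [| n IH]; intros m Hm; [now exists f |].
    replace (S n + m)%nat with (n + S m)%nat in Hm by lia.
    destruct (IH (S m) Hm) as [g [E [g' [H1 H2]]]]. exists g'. split; [| exact H2].
    intros x. simpl. rewrite (Derive_ext _ g); [| exact E]. now apply is_derive_unique. }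
  intros [| n] x; [exact I |].
  destruct (Haux n 1%nat (H _)) as [g [E [g' [H1 _]]]]. simpl.
  apply (ex_derive_ext g); [intros; symmetry; apply E |]. eexists. apply H1.
Qed.

(** * Arclength parametrisation, smoothness and asymptotics of the profile curve *)

Section Curve.

Variables (alpha : R) (w : R -> R).
Hypotheses (Halpha : 0 < alpha < PI / 2) (Hw : forall x, 0 < w x)
  (Hode : forall x, solves_expander_ode w x)
  (Hbd : forall x, tan alpha ^ 2 * x ^ 2 - 4 <= w x ^ 2 <= tan alpha ^ 2 * x ^ 2 + 2 * tan alpha ^ 2).

Let p := Derive w.
Let speed (x : R) := sqrt (1 + p x ^ 2).

Lemma speed_ge_1 (x : R) : 1 <= speed x.
Proof.
  unfold speed. rewrite <- sqrt_1. apply sqrt_le_1_alt. rewrite sqrt_1. pose proof (pow2_ge_0 (p x)). lra.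
Qed.

Lemma p_derive (x : R) : is_derive p x ((1 + p x ^ 2) * (/ w x + (w x - x * p x) / 2)).
Proof. apply Hode. Qed.

Lemma speed_continuous (x : R) : continuous speed x.
Proof.
  apply (continuous_comp (fun x => 1 + p x ^ 2) sqrt); [| apply continuous_sqrt].
  apply (continuous_comp p (fun z => 1 + z ^ 2)).
  - apply (ex_derive_continuous p). eexists. apply p_derive.
  - apply (ex_derive_continuous (fun z => 1 + z ^ 2)). auto_derive. exact I.
Qed.

Definition arclength (x : R) : R := RInt speed 0 x.

Lemma arclength_derive (x : R) : is_derive arclength x (speed x).
Proof.
  apply (is_derive_RInt speed arclength 0 x); [| apply speed_continuous].
  apply filter_forall. intros z. apply (RInt_correct (V := R_CompleteNormedModule)).
  apply (ex_RInt_continuous (V := R_CompleteNormedModule)). intros s _. apply speed_continuous.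
Qed.

(** Since the speed is at least 1, arclength maps onto all of [R] and its inverse [position] is
    1-Lipschitz. *)
Lemma arclength_expands (x y : R) : x <= y -> y - x <= arclength y - arclength x.
Proof.
  intros Hxy.
  assert (arclength x - x <= arclength y - y); [| lra].
  apply (nondecreasing_of_derive (fun z => arclength z - z) (fun z => speed z - 1)); [exact Hxy | |].
  - intros z _. apply (is_derive_minus arclength (fun z => z)); [apply arclength_derive | apply (is_derive_id z)].
  - intros z _. pose proof (speed_ge_1 z). lra.
Qed.

Lemma arclength_surjective (s : R) : exists x, arclength x = s.
Proof.
  assert (H0 : arclength 0 = 0) by (unfold arclength; apply (RInt_point (V := R_CompleteNormedModule))).
  pose proof (Rabs_pos s) as Ha. pose proof (Rle_abs s). pose proof (Rle_abs (- s)). rewrite Rabs_Ropp in *.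
  pose proof (arclength_expands 0 (Rabs s) Ha). pose proof (arclength_expands (- Rabs s) 0 ltac:(lra)).
  destruct (IVT_gen arclength (- Rabs s) (Rabs s) s) as [x [_ Ex]].
  - intros x. apply continuity_pt_filterlim. apply (ex_derive_continuous arclength). eexists. apply arclength_derive.
  - rewrite Rmin_left, Rmax_right by lra. lra.
  - now exists x.
Qed.

Definition position (s : R) : R :=
  proj1_sig (constructive_indefinite_description _ (arclength_surjective s)).

Lemma arclength_position (s : R) : arclength (position s) = s.
Proof. exact (proj2_sig (constructive_indefinite_description _ (arclength_surjective s))). Qed.

Lemma position_lip (s r : R) : Rabs (position s - position r) <= Rabs (s - r).
Proof.
  assert (H : forall s r, position s <= position r -> Rabs (position s - position r) <= Rabs (s - r)).
  { intros a b Hab. pose proof (arclength_expands _ _ Hab) as H. rewrite !arclength_position in H.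
    rewrite (Rabs_minus_sym (position a)), (Rabs_minus_sym a), (Rabs_pos_eq (position b - _)), Rabs_pos_eq; lra. }
  destruct (Rle_lt_dec (position s) (position r)) as [Hle | Hle]; [now apply H |].
  rewrite (Rabs_minus_sym (position s)), (Rabs_minus_sym s). apply H. lra.
Qed.

Lemma position_arclength (x : R) : position (arclength x) = x.
Proof.
  pose proof (arclength_position (arclength x)) as E.
  destruct (Rle_lt_dec (position (arclength x)) x) as [H | H].
  - pose proof (arclength_expands _ _ H). lra.
  - pose proof (arclength_expands _ _ (Rlt_le _ _ H)). lra.
Qed.

Lemma position_derive (s : R) : is_derive position s (/ speed (position s)).
Proof.
  set (x := position s). pose proof (speed_ge_1 x) as Hq. set (q := speed x) in *.
  apply is_derive_approx. intros e He.
  pose proof (arclength_derive x) as HS. fold q in HS. apply is_derive_Reals in HS.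
  destruct (HS e He) as [d Hd]. exists d. split; [apply cond_pos |]. intros h Hh.
  set (k := position (s + h) - x).
  assert (Hk : Rabs k <= Rabs h).
  { unfold k, x. eapply Rle_trans; [apply position_lip |]. right. f_equal. ring. }
  assert (HSk : arclength (x + k) - arclength x = h).
  { unfold k. replace (x + (position (s + h) - x)) with (position (s + h)) by ring.
    unfold x. rewrite !arclength_position. ring. }
  assert (Hkq : Rabs (h - k * q) <= e * Rabs h).
  { destruct (Req_dec k 0) as [Hk0 | Hk0].
    - rewrite Hk0, Rplus_0_r, Rminus_diag in HSk. rewrite <- HSk, Hk0, Rmult_0_l, Rminus_diag, Rabs_R0. lra.
    - specialize (Hd k Hk0 ltac:(lra)). rewrite HSk in Hd.
      replace (h / k - q) with ((h - k * q) / k) in Hd by (field; exact Hk0).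
      unfold Rdiv in Hd. rewrite Rabs_mult, Rabs_inv in Hd.
      assert (Hk1 : 0 < Rabs k) by now apply Rabs_pos_lt.
      apply (Rmult_lt_compat_r (Rabs k)) in Hd; [| exact Hk1].
      rewrite Rmult_assoc, Rinv_l, Rmult_1_r in Hd by lra. nra. }
  change (Rabs (k - h * / q) <= e * Rabs h). replace (k - h * / q) with (- (h - k * q) * / q) by (field; lra).
  rewrite Rabs_mult, Rabs_Ropp.
  assert (Hiq : 0 < / q <= 1).
  { split; [apply Rinv_0_lt_compat; lra |]. rewrite <- Rinv_1. apply Rinv_le_contravar; lra. }
  rewrite (Rabs_pos_eq (/ q)) by lra. pose proof (Rabs_pos (h - k * q)). nra.
Qed.

Definition height (s : R) : R := w (position s).
Definition angle (s : R) : R := atan (p (position s)).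

Lemma cos_angle (s : R) : cos (angle s) = / speed (position s).
Proof.
  unfold angle, speed. rewrite cos_atan. unfold Rdiv. rewrite Rmult_1_l.
  do 2 f_equal. unfold Rsqr. ring.
Qed.

Lemma sin_angle (s : R) : sin (angle s) = p (position s) / speed (position s).
Proof.
  unfold angle, speed. rewrite sin_atan. do 2 f_equal. unfold Rsqr. ring.
Qed.

Lemma position_derive' (s : R) : is_derive position s (cos (angle s)).
Proof. rewrite cos_angle. apply position_derive. Qed.

Lemma height_derive (s : R) : is_derive height s (sin (angle s)).
Proof.
  rewrite sin_angle. unfold Rdiv. rewrite Rmult_comm.
  apply (is_derive_comp w position); [apply Hode | apply position_derive].
Qed.

(** The curvature that the expander equation prescribes. *)
Definition turning (s : R) : R :=
  1 / height s * cos (angle s) - position s / 2 * sin (angle s) + height s / 2 * cos (angle s).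

Lemma angle_derive (s : R) : is_derive angle s (turning s).
Proof.
  unfold turning. rewrite cos_angle, sin_angle. unfold height.
  set (x := position s). pose proof (speed_ge_1 x) as Hq. pose proof (Hw x) as Hwx.
  replace (1 / w x * / speed x - x / 2 * (p x / speed x) + w x / 2 * / speed x) with
    (/ speed x * ((1 + p x ^ 2) * (/ w x + (w x - x * p x) / 2) * / (1 + p x ^ 2)))
    by (field; pose proof (one_plus_sqr_pos (p x)); repeat split; lra).
  apply (is_derive_comp (fun z => atan (p z)) position); [| apply position_derive].
  fold x. apply (is_derive_comp atan p x); [apply is_derive_atan_comp | apply p_derive].
Qed.

Lemma cos_angle_derive (s : R) : is_derive (fun r => cos (angle r)) s (- sin (angle s) * turning s).
Proof.
  rewrite Rmult_comm. apply (is_derive_comp cos angle); [apply is_derive_cos | apply angle_derive].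
Qed.

Lemma sin_angle_derive (s : R) : is_derive (fun r => sin (angle r)) s (cos (angle s) * turning s).
Proof.
  rewrite Rmult_comm. apply (is_derive_comp sin angle); [apply is_derive_sin | apply angle_derive].
Qed.

Lemma height_pos (s : R) : 0 < height s.
Proof. apply Hw. Qed.

(** The five functions satisfy a closed system of differential equations with polynomial right-hand
    sides, so all of them gain one derivative at once. [/ height] is included to make [turning]
    polynomial. *)
Lemma curve_times_derivable (n : nat) :
  times_derivable n position /\ times_derivable n height /\
  times_derivable n (fun s => cos (angle s)) /\ times_derivable n (fun s => sin (angle s)) /\
  times_derivable n (fun s => / height s).
Proof.
  induction n as [| n [IHy [IHu [IHc [IHs IHv]]]]]; [repeat split |].
  assert (IHk : times_derivable n turning).
  { apply times_derivable_ext with (fun s => / height s * cos (angle s) + (- / 2 * (position s * sin (angle s))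
      + / 2 * (height s * cos (angle s)))).
    - intros s. unfold turning. field. pose proof (height_pos s). lra.
    - apply times_derivable_plus; [now apply times_derivable_mult |].
      apply times_derivable_plus; apply times_derivable_scal; now apply times_derivable_mult. }
  split; [| split; [| split; [| split]]].
  - exists (fun s => cos (angle s)). split; [apply position_derive' | exact IHc].
  - exists (fun s => sin (angle s)). split; [apply height_derive | exact IHs].
  - exists (fun s => - sin (angle s) * turning s). split; [apply cos_angle_derive |].
    apply times_derivable_ext with (fun s => -1 * (sin (angle s) * turning s)); [intros; ring |].
    now apply times_derivable_scal, times_derivable_mult.
  - exists (fun s => cos (angle s) * turning s). split; [apply sin_angle_derive |]. now apply times_derivable_mult.
  - exists (fun s => -1 * (sin (angle s) * (/ height s * / height s))). split.
    + intros s. pose proof (height_pos s).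
      replace (-1 * (sin (angle s) * (/ height s * / height s))) with (- sin (angle s) / height s ^ 2) by (field; lra).
      apply is_derive_inv; [apply height_derive | lra].
    + apply times_derivable_scal, times_derivable_mult; [exact IHs |]. now apply times_derivable_mult.
Qed.

Lemma profile_expander_curve :
  expander_curve (fun q => exists x, q = (x, w x)).
Proof.
  exists position, height, angle. split; [| split].
  - split; [| split].
    + apply times_derivable_smooth. intros n. apply curve_times_derivable.
    + apply times_derivable_smooth. intros n. apply curve_times_derivable.
    + intros s. split; [apply height_pos | split; [apply position_derive' | apply height_derive]].
  - intros s. unfold expander_equation, curvature.
    assert (E1 : Derive_n position 2 s = - sin (angle s) * turning s).
    { change (Derive (Derive position) s = - sin (angle s) * turning s).
      rewrite (Derive_ext (Derive position) (fun r => cos (angle r))).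
      - apply is_derive_unique, cos_angle_derive.
      - intros r. apply is_derive_unique, position_derive'. }
    assert (E2 : Derive_n height 2 s = cos (angle s) * turning s).
    { change (Derive (Derive height) s = cos (angle s) * turning s).
      rewrite (Derive_ext (Derive height) (fun r => sin (angle r))).
      - apply is_derive_unique, sin_angle_derive.
      - intros r. apply is_derive_unique, height_derive. }
    rewrite E1, E2.
    replace (- sin (angle s) * turning s * - sin (angle s) + cos (angle s) * turning s * cos (angle s))
      with ((sin (angle s) ^ 2 + cos (angle s) ^ 2) * turning s) by ring.
    replace (sin (angle s) ^ 2 + cos (angle s) ^ 2) with 1.
    2:{ rewrite <- (sin2_cos2 (angle s)). unfold Rsqr. ring. }
    unfold turning. ring.
  - intros q. split.
    + intros [x ->]. exists (arclength x). unfold height. now rewrite position_arclength.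
    + intros [s ->]. now exists (position s).
Qed.

(** Taking square roots in [Hbd] leaves a bounded vertical error, which the factor [sqrt t] later
    sends to 0. *)
Lemma profile_near_cone (x : R) : Rabs (w x - tan alpha * Rabs x) <= 2 * tan alpha + 2.
Proof.
  assert (Hg : 0 < tan alpha) by (apply tan_gt_0; lra).
  set (gam := tan alpha) in *. destruct (Hbd x) as [H1 H2]. fold gam in H1, H2.
  pose proof (Hw x) as Hp. pose proof (Rabs_pos x) as Hx. rewrite <- (pow2_abs x) in H1, H2.
  set (y := Rabs x) in *. assert (Hgy : 0 <= gam * y) by (apply Rmult_le_pos; lra).
  replace (gam ^ 2 * y ^ 2) with ((gam * y) ^ 2) in H1, H2 by ring.
  assert (U : w x <= gam * y + 2 * gam).
  { apply Rnot_lt_le. intros Hlt. assert ((gam * y + 2 * gam) ^ 2 <= w x ^ 2) by (apply pow_incr; nra). nra. }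
  assert (L : gam * y - 2 <= w x).
  { apply Rnot_lt_le. intros Hlt. assert (w x ^ 2 <= (gam * y - 2) ^ 2) by (apply pow_incr; lra). nra. }
  apply Rabs_le. lra.
Qed.

Lemma dist2_vertical (x y z : R) : dist2 (x, y) (x, z) = Rabs (y - z).
Proof.
  unfold dist2, dist_euc. simpl. rewrite Rminus_diag, Rsqr_0, Rplus_0_l. apply sqrt_Rsqr_abs.
Qed.

Lemma profile_asymptotic :
  asymptotic_to (fun q => exists x, q = (x, w x)) (fun q => ray alpha q \/ ray (PI - alpha) q).
Proof.
  assert (Hg : 0 < tan alpha) by (apply tan_gt_0; lra).
  assert (Hcos : 0 < cos alpha) by (apply cos_gt_0; lra).
  assert (Hsin : sin alpha = tan alpha * cos alpha) by (unfold tan; field; lra).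
  assert (Hc2 : cos (PI - alpha) = - cos alpha) by (rewrite Rtrigo_facts.cos_pi_minus; reflexivity).
  assert (Hs2 : sin (PI - alpha) = sin alpha) by (rewrite Rtrigo_facts.sin_pi_minus; reflexivity).
  set (K := 2 * tan alpha + 2).
  intros rho eps _ Heps.
  assert (HeK : 0 < eps / K) by (apply Rdiv_lt_0_compat; unfold K; lra).
  exists (mkposreal ((eps / K) ^ 2) ltac:(nra)). intros t Ht Ht0.
  change (Rabs (t - 0) < (eps / K) ^ 2) in Ht. rewrite Rminus_0_r, Rabs_pos_eq in Ht by lra.
  assert (Hst : 0 < sqrt t) by now apply sqrt_lt_R0.
  assert (HstK : sqrt t * K < eps).
  { assert (H : sqrt t < eps / K).
    { rewrite <- (sqrt_pow2 (eps / K)) by lra. apply sqrt_lt_1_alt. lra. }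
    apply (Rmult_lt_compat_r K) in H; [| unfold K; lra].
    replace (eps / K * K) with eps in H by (field; unfold K; lra). exact H. }
  assert (Hdist : forall x, Rabs (sqrt t * w x - sqrt t * (tan alpha * Rabs x)) < eps).
  { intros x. rewrite <- Rmult_minus_distr_l, Rabs_mult, (Rabs_pos_eq (sqrt t)) by lra.
    apply Rle_lt_trans with (sqrt t * K); [| exact HstK].
    apply Rmult_le_compat_l; [lra | apply profile_near_cone]. }
  split.
  - intros q [q' [[x ->] ->]] _. simpl.
    exists (sqrt t * x, sqrt t * (tan alpha * Rabs x)). split.
    + assert (Hr : 0 <= sqrt t * Rabs x / cos alpha).
      { apply Rmult_le_pos; [apply Rmult_le_pos; [lra | apply Rabs_pos] | left; now apply Rinv_0_lt_compat]. }
      destruct (Rle_lt_dec 0 x) as [H | H]; [left | right]; exists (sqrt t * Rabs x / cos alpha); split; auto.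
      * rewrite Hsin, Rabs_pos_eq by lra. f_equal; field; lra.
      * rewrite Hc2, Hs2, Hsin, Rabs_left by lra. f_equal; field; lra.
    + rewrite dist2_vertical. apply Hdist.
  - intros q Hq _.
    assert (Hex : exists x, q = (sqrt t * x, sqrt t * (tan alpha * Rabs x))).
    { destruct Hq as [[r [Hr ->]] | [r [Hr ->]]].
      - exists (r * cos alpha / sqrt t). rewrite Rabs_pos_eq.
        + rewrite Hsin. f_equal; field; lra.
        + apply Rmult_le_pos; [apply Rmult_le_pos; lra | left; now apply Rinv_0_lt_compat].
      - exists (- (r * cos alpha / sqrt t)). rewrite Rabs_Ropp, Rabs_pos_eq.
        + rewrite Hc2, Hs2, Hsin. f_equal; field; lra.
        + apply Rmult_le_pos; [apply Rmult_le_pos; lra | left; now apply Rinv_0_lt_compat]. }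
    destruct Hex as [x ->]. exists (sqrt t * x, sqrt t * w x). split.
    + exists (x, w x). split; [now exists x | reflexivity].
    + rewrite dist2_vertical, Rabs_minus_sym. apply Hdist.
Qed.

End Curve.

Lemma hyperbola_regular (gam C1 : R) : 0 < gam -> 0 < C1 -> exists L K,
  (forall x y, Rabs (sqrt (C1 + gam ^ 2 * x ^ 2) - sqrt (C1 + gam ^ 2 * y ^ 2)) <= L * Rabs (x - y)) /\
  (forall x h, Rabs (sqrt (C1 + gam ^ 2 * (x + h) ^ 2) + sqrt (C1 + gam ^ 2 * (x - h) ^ 2)
     - 2 * sqrt (C1 + gam ^ 2 * x ^ 2)) <= K * h ^ 2).
Proof.
  intros Hg HC1. set (g := fun x => sqrt (C1 + gam ^ 2 * x ^ 2)).
  assert (Hrad : forall x, C1 <= C1 + gam ^ 2 * x ^ 2).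
  { intros x. pose proof (Rmult_le_pos _ _ (pow2_ge_0 gam) (pow2_ge_0 x)). lra. }
  assert (Hc : 0 < sqrt C1) by now apply sqrt_lt_R0.
  assert (Hgc : forall x, sqrt C1 <= g x) by (intros; apply sqrt_le_1_alt, Hrad).
  assert (Hg2 : forall x, g x ^ 2 = C1 + gam ^ 2 * x ^ 2) by (intros; apply pow2_sqrt; specialize (Hrad x); lra).
  exists gam, (2 * (gam ^ 2 / sqrt C1)).
  apply (smooth_data g (fun x => gam ^ 2 * x / g x) (fun x => gam ^ 2 * C1 / g x ^ 3)).
  - intros x. pose proof (Hgc x). replace (gam ^ 2 * x / g x) with (2 * gam ^ 2 * x / (2 * g x)) by (field; lra).
    apply (is_derive_sqrt_comp (fun x => C1 + gam ^ 2 * x ^ 2)); [specialize (Hrad x); lra |].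
    auto_derive; [exact I | ring].
  - intros x. pose proof (Hgc x).
    replace (gam ^ 2 * C1 / g x ^ 3) with ((gam ^ 2 * g x - gam ^ 2 * x * (2 * gam ^ 2 * x / (2 * g x))) / g x ^ 2).
    + apply (is_derive_div (fun x => gam ^ 2 * x) g); [auto_derive; [exact I | ring] | | lra].
      apply (is_derive_sqrt_comp (fun x => C1 + gam ^ 2 * x ^ 2)); [specialize (Hrad x); lra |].
      auto_derive; [exact I | ring].
    + replace C1 with (g x ^ 2 - gam ^ 2 * x ^ 2) by (rewrite Hg2; ring). field. lra.
  - intros x. pose proof (Hgc x). unfold Rdiv. rewrite Rabs_mult, Rabs_inv, (Rabs_pos_eq (g x)) by lra.
    apply (Rmult_le_reg_r (g x)); [lra |]. rewrite Rmult_assoc, Rinv_l, Rmult_1_r by lra.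
    rewrite Rabs_mult, (Rabs_pos_eq (gam ^ 2)) by apply pow2_ge_0.
    assert (gam * Rabs x <= g x).
    { apply Rnot_lt_le. intros Hlt. assert (g x ^ 2 <= (gam * Rabs x) ^ 2) by (apply pow_incr; lra).
      rewrite Hg2, Rpow_mult_distr, pow2_abs in H0. lra. }
    replace (gam ^ 2 * Rabs x) with (gam * (gam * Rabs x)) by ring. apply Rmult_le_compat_l; lra.
  - intros x. pose proof (Hgc x).
    assert (Hg20 : 0 <= gam ^ 2) by apply pow2_ge_0.
    assert (Hq0 : 0 <= gam ^ 2 * C1 / g x ^ 3).
    { apply Rmult_le_pos; [apply Rmult_le_pos; lra | left; apply Rinv_0_lt_compat, pow_lt; lra]. }
    rewrite Rabs_pos_eq by exact Hq0.
    apply Rle_trans with (gam ^ 2 / g x).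
    + replace (gam ^ 2 / g x) with (gam ^ 2 * g x ^ 2 / g x ^ 3) by (field; lra).
      unfold Rdiv. apply Rmult_le_compat_r; [left; apply Rinv_0_lt_compat, pow_lt; lra |].
      apply Rmult_le_compat_l; [exact Hg20 |]. rewrite Hg2. apply Hrad.
    + unfold Rdiv. apply Rmult_le_compat_l; [exact Hg20 |]. apply Rinv_le_contravar; lra.
Qed.

Theorem eternal_expander (alpha : R) (ua : R -> R) (u : R -> R -> R) :
  0 < alpha < PI / 2 -> profile_facts alpha ua -> (forall T, 0 < T -> mcf_on T u) ->
  (forall y, u y 0 = ua y) -> expander_angle alpha.
Proof.
  intros Ha Hua Hu Hu0.
  assert (Hg : 0 < tan alpha) by (apply tan_gt_0; lra).
  destruct (profile_upper _ _ Hua) as [C1 [HC1 Hup]]. destruct (profile_lower _ _ Hua) as [C0 Hlow].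
  destruct (hyperbola_regular (tan alpha) C1 Hg HC1) as [L [K [HL HK]]].
  destruct (glue_regular (fun y => sqrt (C1 + tan alpha ^ 2 * y ^ 2))) as [V [HV0 HV]].
  { intros T HT.
    destruct (uniform_lower_bound (T + 1) T (tan alpha) C0 u (Hu (T + 1) ltac:(lra)) Hg) as [c [Hc Hcl]];
      [intros y; rewrite Hu0; apply Hlow | lra |].
    destruct (trunc_exists (fun y => sqrt (C1 + tan alpha ^ 2 * y ^ 2)) L K c T Hc HT HL HK) as [U [C [HU0 [HU _]]]].
    exists U. split; [exact HU0 |]. exists c, C. split; [exact Hc | split; [exact HU |]].
    intros y t Ht. apply Rle_trans with (u y t); [apply Hcl; lra |].
    apply (mcf_le_trunc c C T u U Hc (Hu T HT) HU); [intros z s Hs; apply Hcl; lra | | exact Ht].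
    intros z. rewrite HU0, Hu0. rewrite <- (sqrt_pow2 (ua z)) by apply (profile_nonneg _ _ Hua).
    apply sqrt_le_1_alt, Hup. }
  destruct (expander_profile_exists (tan alpha) C1 V Hg HC1 HV0 HV) as [w [Hw [Hode Hbd]]].
  split; [exact Ha |]. exists (fun q => exists x, q = (x, w x)). split.
  - now apply profile_expander_curve.
  - now apply profile_asymptotic.
Qed.

Theorem lemma3p11 (alpha : R) (M : R * R * R -> Prop) (T : Rbar)
    (u : R -> R -> R)
    (Halpha : 0 < alpha < PI / 2)
    (Hcrit : Rbar_lt alpha alpha_crit_star3)
    (HM : is_smoothing alpha M)
    (Hu : mcf_evolution M T u) :
  pinches_in_finite_time T u.
Proof.
  destruct HM as [ua [Hprof HMua]]. destruct Hu as [HT [Hsol Hmax]].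
  pose proof (smoothing_profile_facts alpha ua Halpha Hprof) as Hua.
  (* Evolution and smoothing share only the surface [M]; a nonnegative profile is determined by
     it. *)
  assert (Hu0 : forall y, u y 0 = ua y).
  { apply (rev_surface_inj ua (fun y => u y 0)); [apply (profile_nonneg _ _ Hua) |].
    intros x. rewrite <- HMua. apply Hsol. }
  destruct T as [T | |]; [| exfalso | destruct HT].
  - exists T. split; [reflexivity |]. now apply (finite_time_pinching alpha T ua M u).
  - assert (Hang : expander_angle alpha).
    { apply (eternal_expander alpha ua u); auto. intros S _. now apply (mcf_solution_on M p_infty S u). }
    apply (Rbar_lt_not_le _ _ Hcrit). now apply (proj1 (Glb_Rbar_correct expander_angle)).
Qed.
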